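(* Let $\Delta\subset\mathbb R^2$ be a two-dimensional lattice polygon, $n=2\operatorname{Area}(\Delta)$, and let $\omega_z,\omega_w$ be the coordinate widths of $\Delta$. For every $C_f\in\mathscr C_\Delta$ and every integer $s\geq2$, the number $N_s(f)$ of isolated $s$-nodes of the amoeba contour of $f$ satisfies $$N_s(f)\leq\left\lfloor\frac{8n^2\omega_z\omega_w}{s(s-1)}\right\rfloor.$$ Therefore $$N_s(f)\leq\left\lfloor\frac{8n^4}{s(s-1)}\right\rfloor=\left\lfloor\frac{128\operatorname{Area}(\Delta)^4}{s(s-1)}\right\rfloor.$$ If $f$ is a polynomial of projective degree $d$, so that after a monomial translation $\Delta\subset d\Delta_2=\operatorname{conv}\{(0,0),(d,0),(0,d)\}$, then $$N_s(f)\leq\left\lfloor\frac{8d^6}{s(s-1)}\right\rfloor.$$ These bounds count only isolated transverse multiple points and remain valid after deleting positive-dimensional overlap components of the two-lift coincidence scheme.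
   Context: Let $f\in\mathbb C[z^{\pm1},w^{\pm1}]$ have Newton polygon $\Delta$, let $C_f=\{f=0\}\subset(\mathbb C^* )^2$, and let $\overline C_f$ be its closure in the toric surface $X_\Delta$. Let $\mathrm{Log}(z,w)=(\log|z|,\log|w|)$. $S_f\subset C_f$ denotes the critical locus of $\mathrm{Log}|_{C_f}$ (the points where the real differential of $\mathrm{Log}|_{C_f}$ has rank less than $2$), and the contour of the amoeba is $\mathcal K_f=\mathrm{Log}(S_f)$. $\mathscr C_\Delta$ is the class of curves $C_f$ (with $f$ of Newton polygon $\Delta$) for which $C_f$ is smooth, $S_f$ is a smooth real curve, and $\overline C_f$ is torically nondegenerate; in particular $\overline C_f$ is smooth, avoids the zero-dimensional toric orbits, and meets the toric boundary divisors transversely. Coordinate widths: $\omega_z=\max_{(a,c)\in\Delta}c-\min_{(a,c)\in\Delta}c$ and $\omega_w=\max_{(a,c)\in\Delta}a-\min_{(a,c)\in\Delta}a$. For $s\geq2$, a point $x\in\mathcal K_f$ is an $s$-node if there are exactly $s$ distinct points $p_1,\dots,p_s\in S_f$ mapping to $x$ under $\mathrm{Log}$, the restriction $\mathrm{Log}|_{S_f}$ is immersive at every $p_i$, and the $s$ resulting tangent lines to the contour at $x$ are pairwise distinct. $N_s(f)$ is the number of isolated $s$-nodes. Two-lift coincidence scheme: let $\gamma_f:\overline C_f\to\mathbb P^1$, $\gamma_f=[zf_z:wf_w]$, be the logarithmic Gauss map, $\overline C_f^\sigma$ and $\gamma_f^\sigma$ the analogous objects for the coefficient-conjugate of $f$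 with coordinates $(\zeta,\eta)$, $D$ the normalization of $\overline C_f\times_{\mathbb P^1}\overline C_f^\sigma$, and $Z=z\zeta$, $W=w\eta$ as meromorphic functions on $D$. The two-lift coincidence scheme is the locus in $D\times D$ of pairs $(q_1,q_2)$ with $Z(q_1)=Z(q_2)$ and $W(q_1)=W(q_2)$; its positive-dimensional components include the diagonal and possible further ''overlap'' components. *)

(* Defs.v *)
From HB Require Import structures.
From mathcomp Require Import all_boot all_order all_algebra finmap.
From mathcomp Require Import complex.
From mathcomp Require Import all_classical all_reals all_analysis.
Set Implicit Arguments.
Unset Strict Implicit.
Unset Printing Implicit Defensive.
Import Order.TTheory GRing.Theory Num.Theory.
Import numFieldNormedType.Exports.
Local Open Scope classical_set_scope.
Local Open Scope ring_scope.

Section Polygons.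
Variable R : realType.
Implicit Type Delta : set (R * R).

Definition lat (m : int * int) : R * R := (m.1%:~R, m.2%:~R).

Definition hull (A : set (R * R)) : set (R * R) :=
  smallest (@convex_set R (R * R)%type) A.

Definition lattice_polygon Delta :=
  exists V : {fset (int * int)%type}, Delta = hull (lat @` [set` V]).

Definition two_dimensional Delta := (Delta°)%classic !=set0.

Definition area Delta : R :=
  fine ((@lebesgue_measure R \x @lebesgue_measure R)%E Delta).

(* The width indexed by z is taken along the exponent of w, and conversely:
   these are the degrees of z and w as functions on the compactified curve. *)
Definition width_z Delta : R := sup (snd @` Delta) - inf (snd @` Delta).
Definition width_w Delta : R := sup (fst @` Delta) - inf (fst @` Delta).

Definition simplex (d : nat) : set (R * R) :=
  hull [set lat (0, 0); lat (d%:Z, 0); lat (0, d%:Z)].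

(* Pairing of a covector nu in Z^2 with a point of R^2. *)
Definition pairing (nu : int * int) (u : R * R) : R :=
  nu.1%:~R * u.1 + nu.2%:~R * u.2.

End Polygons.

(* Coefficient functions Z^2 -> C with finite support; the value at (a, c) is
   the coefficient of z^a w^c. *)
Notation laurent R := {fsfun (int * int)%type -> R[i] with 0}.

Section Curves.
Variable R : realType.
Implicit Types (f : laurent R) (Delta : set (R * R)).

Definition newton_polygon f : set (R * R) :=
  hull (@lat R @` [set m | f m != 0]).

Definition leval f (z w : R[i]) : R[i] :=
  \sum_(m <- finsupp f) f m * z ^ m.1 * w ^ m.2.
Definition lder_z f (z w : R[i]) : R[i] :=
  \sum_(m <- finsupp f) f m * (m.1%:~R * z ^ (m.1 - 1)) * w ^ m.2.
Definition lder_w f (z w : R[i]) : R[i] :=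
  \sum_(m <- finsupp f) f m * z ^ m.1 * (m.2%:~R * w ^ (m.2 - 1)).

(* The points of C^2 for the real differential structure: ((Re z, Im z),
   (Re w, Im w)). *)
Definition RR4 := ((R * R) * (R * R))%type.
Definition cpx (u : R * R) : R[i] := (u.1 +i* u.2)%C.

Definition curve f : set RR4 := [set p : RR4 |
  [/\ cpx p.1 != 0, cpx p.2 != 0 & leval f (cpx p.1) (cpx p.2) = 0]].

Definition smooth_curve f := forall p, curve f p ->
  (lder_z f (cpx p.1) (cpx p.2) != 0) \/ (lder_w f (cpx p.1) (cpx p.2) != 0).

Definition curve_tangent f (p : RR4) : set RR4 := [set v : RR4 |
  lder_z f (cpx p.1) (cpx p.2) * cpx v.1
  + lder_w f (cpx p.1) (cpx p.2) * cpx v.2 = 0].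

Definition Log (p : RR4) : R * R :=
  (ln (ComplexField.Normc.normc (cpx p.1)),
   ln (ComplexField.Normc.normc (cpx p.2))).

(* The rank of a linear map into R^2 is less than 2 iff its image is not R^2. *)
Definition critical_locus f : set RR4 := [set p : RR4 |
  curve f p /\ 'd Log p @` curve_tangent f p <> setT].

Definition contour f : set (R * R) := Log @` critical_locus f.

(* phi is a smooth regular parametrization of S near p. The last clause says
   that phi maps every interval around 0 onto a neighbourhood of p in S, which
   excludes crossings and accumulation of S on itself. *)
Definition local_param (S : set RR4) (p : RR4) (phi : R -> RR4) :=
  [/\ phi 0 = p,
      \forall t \near (0 : R), S (phi t),
      exists2 delta : R, 0 < delta &
        forall (n : nat) (t : R), `|t| < delta -> derivable (derive1n n phi) t 1,
      derive1 phi 0 != 0 &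
      forall eps : R, 0 < eps ->
        \forall q \near p, S q -> exists2 t, `|t| < eps & phi t = q].

Definition smooth_real_curve (S : set RR4) :=
  forall p, S p -> exists phi, local_param S p phi.

Definition tangent_line (S : set RR4) (p : RR4) : set RR4 := [set v |
  exists2 phi, local_param S p phi & exists c : R, v = c *: derive1 phi 0].

(* In the toric surface of Delta, the divisor of the edge where nu takes its
   minimum k on Delta lies in a chart with coordinates (x, y) in C^* x C,
   glued to the torus by z = x ^ mu'.1 * y ^ nu'.1, w = x ^ mu'.2 * y ^ nu'.2,
   for which z ^ m.1 * w ^ m.2 = x ^ (mu . m) * y ^ (nu . m), where (mu, nu) is
   a basis of Z^2.  In this chart f is y ^ k times the function below, whose
   exponents of y are nonnegative, and the divisor is y = 0. *)
Definition dotz (nu m : int * int) : int := nu.1 * m.1 + nu.2 * m.2.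
Definition chart f (mu nu : int * int) (k : int) (x y : R[i]) : R[i] :=
  \sum_(m <- finsupp f) f m * x ^ dotz mu m * y ^ (dotz nu m - k).
Definition chart_dx f (mu nu : int * int) (k : int) (x y : R[i]) : R[i] :=
  \sum_(m <- finsupp f)
    f m * ((dotz mu m)%:~R * x ^ (dotz mu m - 1)) * y ^ (dotz nu m - k).

Definition edge_covector Delta (nu : int * int) (k : int) :=
  (forall u, Delta u -> k%:~R <= pairing nu u) /\
  exists u v, [/\ Delta u, Delta v, u != v,
    pairing nu u = k%:~R & pairing nu v = k%:~R].

(* The zero-dimensional orbit of a vertex m of Delta is the coordinate point m
   of the projective embedding by monomials, where the section f has value f m.
   Along a divisor, transversality to y = 0 means that the x-derivative is not
   zero, which also makes the closure of the curve smooth there. *)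
Definition torically_nondegenerate Delta f :=
  [/\ smooth_curve f,
      forall (nu m : int * int), Delta (lat R m) ->
        (forall u, Delta u -> u != lat R m ->
          pairing nu (lat R m) < pairing nu u) ->
        f m != 0 &
      forall (mu nu : int * int) (k : int),
        mu.1 * nu.2 - mu.2 * nu.1 = 1 -> edge_covector Delta nu k ->
        forall x : R[i], x != 0 -> chart f mu nu k x 0 = 0 ->
          chart_dx f mu nu k x 0 != 0].

Definition curve_class Delta f :=
  [/\ newton_polygon f = Delta, smooth_curve f,
      smooth_real_curve (critical_locus f) & torically_nondegenerate Delta f].

Definition critical_fiber f (x : R * R) : set RR4 :=
  [set p | critical_locus f p /\ Log p = x].

Definition immersive_at f (p : RR4) :=
  forall v, tangent_line (critical_locus f) p v -> v != 0 -> 'd Log p v != 0.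

Definition contour_tangent f (p : RR4) : set (R * R) :=
  'd Log p @` tangent_line (critical_locus f) p.

Definition s_node f (s : nat) : set (R * R) := [set x |
  [/\ contour f x,
      (critical_fiber f x #= `I_s)%card,
      forall p, critical_fiber f x p -> immersive_at f p &
      forall p p', critical_fiber f x p -> critical_fiber f x p' -> p <> p' ->
        contour_tangent f p <> contour_tangent f p']].

Definition isolated_nodes f (s : nat) : set (R * R) := isolated (s_node f s).

(* The two-lift coincidence scheme. *)

Notation Cn := (R[i])^o.
Notation CC4 := ((Cn * Cn) * (Cn * Cn))%type.

Definition conj_coef f : laurent R := [fsfun m in finsupp f => (f m)^*].

(* The part of the fiber product of the two logarithmic Gauss maps that lies in
   the torus, with coordinates ((z, w), (zeta, eta)). *)
Definition gauss_fiber f : set CC4 := [set P : CC4 |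
  let: ((z, w), (zeta, eta)) := P in let g := conj_coef f in
  [/\ [/\ z != 0, w != 0, zeta != 0 & eta != 0],
      leval f z w = 0, leval g zeta eta = 0 &
      (z * lder_z f z w) * (eta * lder_w g zeta eta)
      = (w * lder_w f z w) * (zeta * lder_z g zeta eta)]].

(* A germ at 0 of an injective holomorphic map from a punctured disc to the
   fiber product, meromorphic at 0.  Such a germ extends to a local coordinate
   centered at a point q of the normalization D, and every point of D arises in
   this way, because no component of the fiber product lies in the boundary. *)
Definition branch f (phi : Cn -> CC4) :=
  [/\ \forall t \near (0 : Cn)^', gauss_fiber f (phi t) /\ derivable phi t 1,
      exists (N : nat) (M : R[i]),
        \forall t \near (0 : Cn)^', `|t ^+ N *: phi t| <= M &
      exists2 U : set Cn, nbhs 0 U &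
        forall t u, U t -> U u -> t != 0 -> u != 0 -> phi t = phi u -> t = u].

(* A point q of D is represented by the filter of its punctured neighbourhoods,
   seen in the torus.  If phi is the germ of a coordinate centered at q, then
   phi @ t^' represents the point of D with coordinate t, for t close to 0. *)
Definition point_at (phi : Cn -> CC4) (t : Cn) : set_system CC4 := phi @ t^'.

Definition normalization f : set (set_system CC4) :=
  [set q | exists2 phi, branch f phi & q = point_at phi 0].

Definition Zfun (P : CC4) : Cn := P.1.1 * P.2.1.
Definition Wfun (P : CC4) : Cn := P.1.2 * P.2.2.

(* Values of a meromorphic function in P^1, where None is infinity. *)
Definition has_value (h : CC4 -> Cn) (q : set_system CC4) (c : option Cn) :=
  match c with
  | Some l => h @ q --> l
  | None => (fun P => (h P)^-1 : Cn) @ q --> (0 : Cn)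
  end.

Definition same_value (h : CC4 -> Cn) (q q' : set_system CC4) :=
  exists2 c, has_value h q c & has_value h q' c.

Definition coincident (q q' : set_system CC4) :=
  same_value Zfun q q' /\ same_value Wfun q q'.

(* The coincidence scheme without its positive-dimensional components: a point
   of a closed analytic set lies on no such component iff it is isolated. *)
Definition residual_coincident f (q q' : set_system CC4) :=
  coincident q q' /\
  exists phi phi', [/\ branch f phi, branch f phi',
    q = point_at phi 0, q' = point_at phi' 0 &
    exists2 U : set Cn, nbhs 0 U &
      forall t t', U t -> U t' -> coincident (point_at phi t) (point_at phi' t') ->
        t = 0 /\ t' = 0].

(* q is a point of D over (p, conj p). *)
Definition lift f (p : RR4) (q : set_system CC4) :=
  normalization f q /\
  q --> ((cpx p.1 : Cn, cpx p.2 : Cn),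
         ((cpx p.1)^* : Cn, (cpx p.2)^* : Cn)).

(* The nodes that remain after the positive-dimensional components of the
   coincidence scheme are deleted. *)
Definition residual_nodes f (s : nat) : set (R * R) := [set x |
  s_node f s x /\
  forall p p' q q', critical_fiber f x p -> critical_fiber f x p' -> p <> p' ->
    lift f p q -> lift f p' q' -> residual_coincident f q q'].

End Curves.

(* Main.v *)
(* The points of the critical locus S over an s-node are the centers of s arcs of
   S, along which z and w expand into formal power series.  For N nodes this
   gives Ns germs.  In the ring of families of power series indexed by these
   germs, f vanishes at (z, w), its conjugate vanishes at the conjugate series
   (zeta, eta), and, S being the locus where the logarithmic Gauss map is real,
   the two Gauss maps coincide: the arcs lie on the fiber product D.

   All geometry of D is replaced by dimension counts.  A monomial u has degree at
   most d when the spans of 1, u, .., u^a times a fixed set of monomials have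
   dimension at most a d + O(1).  Eliminating the leading monomial of f shows that z and
   w have degrees bounded by the widths of the support, and that the dimensions
   for the dilates of the support grow by at most n = 2 Area infinitely often; a
   monomial of degree d on the curve has thus degree at most n d on D, and
   Z = z zeta, W = w eta have degrees at most 2 n omega_z and 2 n omega_w.

   Hence Z and W satisfy a minimal equation P(Z, W) = 0 of that bidegree.  At a
   node, the s germs have the same values of Z and W and pairwise independent
   velocities, so P vanishes there to order s and dP/dW(Z, W) to order s - 1 at
   each germ.  The latter is not identically zero on any germ, and comparing its
   zeros with its degree gives N s (s - 1) <= 2 (2 n omega_z) (2 n omega_w).

   This needs Z to be nonconstant on each germ.  A logarithmic derivation reduces
   it to the Gauss map being nonconstant, which holds because S would otherwise
   contain a complex curve.  The other two bounds use the monomials of two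
   independent differences of points of the support, which have degree at most n,
   and the area of the simplex. *)

Require Import Defs.
From HB Require Import structures.
From mathcomp Require Import all_boot all_order all_algebra finmap.
From mathcomp Require Import complex ring lra zify.
From mathcomp Require Import all_classical all_reals all_analysis.
Import Order.TTheory GRing.Theory Num.Theory.
Import numFieldNormedType.Exports.
Local Open Scope classical_set_scope.
Local Open Scope ring_scope.
Set Implicit Arguments.
Unset Strict Implicit.
Unset Printing Implicit Defensive.

(** * Rank of families of vectors *)

(** The arcs of S are only smooth: an identity along an arc passes to its formal expansion, but a
    formal identity does not return to the arc. Hence the algebra takes place in a ring with one
    factor of formal power series for each point over a node. Nothing is known about the
    irreducibility of D, and this ring is not a domain: nonzero functions are replaced by [regular]
    ones, which are nonzero on every germ.

    Ranks of spans of monomials stand for dimensions of spaces of sections. They are submodular, so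
    that their increments along a ray decrease; one small increment is therefore enough to bound a
    degree.

    The constant 8 is a product of three factors 2. The monomials z and zeta contribute n omega_z
    each to the degree of Z, and W is similar. Moreover P has degree at most deg W in Z and at most
    deg Z in W, so that dP/dW(Z, W) has at most deg W deg Z + deg Z deg W poles, while it has at
    least s - 1 zeros at each of the N s germs. *)

Section Rank.
Variables (k : fieldType).
Implicit Type V W : lmodType k.

Inductive lspan V (P : set V) : V -> Prop :=
| lspan_mem v : P v -> lspan P v
| lspan_0 : lspan P 0
| lspan_lin c u v : lspan P u -> lspan P v -> lspan P (c *: u + v).

Definition lfree V (s : seq V) := forall c : nat -> k,
  \sum_(i < size s) c i *: s`_i = 0 -> forall i, (i < size s)%N -> c i = 0.

Definition spanned V (s : seq V) : set V := lspan [set v | v \in s].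

Definition finrk V (P : set V) := exists s : seq V, P `<=` spanned s.

Definition indep_in V (P : set V) (n : nat) :=
  exists s : seq V, [/\ lfree s, size s = n & forall v, v \in s -> lspan P v].

(** The default 0 is the value for infinite rank, so that a bound on [rk] has content only together
    with [finrk]. *)
Definition rk V (P : set V) : nat :=
  xget 0%N [set m | indep_in P m /\ forall n, indep_in P n -> (n <= m)%N].

Section Theory.
Variable V : lmodType k.
Implicit Types (P Q : set V) (s t : seq V) (u v : V).

Lemma lspanD P u v : lspan P u -> lspan P v -> lspan P (u + v).
Proof. by move=> hu hv; rewrite -[u]scale1r; apply: lspan_lin. Qed.

Lemma lspanZ P c u : lspan P u -> lspan P (c *: u).
Proof.
by move=> hu; rewrite -[_ *: _]addr0; apply: lspan_lin => //; apply: lspan_0.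
Qed.

Lemma lspanN P u : lspan P u -> lspan P (- u).
Proof. by rewrite -scaleN1r; apply: lspanZ. Qed.

Lemma lspanB P u v : lspan P u -> lspan P v -> lspan P (u - v).
Proof. by move=> hu hv; apply: lspanD => //; apply: lspanN. Qed.

Lemma lspan_sum P (I : Type) (r : seq I) (p : pred I) (F : I -> V) :
  (forall i, p i -> lspan P (F i)) -> lspan P (\sum_(i <- r | p i) F i).
Proof.
move=> h; elim/big_ind : _ => [|u v|i /h //]; first exact: lspan_0.
exact: lspanD.
Qed.

Lemma lspan_sub P Q v : P `<=` lspan Q -> lspan P v -> lspan Q v.
Proof.
move=> PQ; elim=> [u /PQ //||c u w _ hu _ hw]; first exact: lspan_0.
exact: lspan_lin.
Qed.

Lemma lspanS P Q v : P `<=` Q -> lspan P v -> lspan Q v.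
Proof. by move=> PQ; apply: lspan_sub => u /PQ; apply: lspan_mem. Qed.

Lemma spanned_nth s (c : nat -> k) :
  spanned s (\sum_(i < size s) c i *: s`_i).
Proof.
apply: lspan_sum => i _; apply: lspanZ; apply: lspan_mem.
by rewrite /= mem_nth.
Qed.

Lemma spannedP s v :
  spanned s v <-> exists c : nat -> k, v = \sum_(i < size s) c i *: s`_i.
Proof.
split=> [|[c ->]]; last exact: spanned_nth.
elim=> [u /= us||c u w _ [a ->] _ [b ->]].
- exists (fun i => (i == index u s)%:R).
  have hi : (index u s < size s)%N by rewrite index_mem.
  rewrite (bigD1 (Ordinal hi)) //= eqxx scale1r nth_index // big1 ?addr0 //.
  by move=> i; rewrite -val_eqE /= => /negbTE ->; rewrite scale0r.
- by exists (fun=> 0); rewrite big1 // => i _; rewrite scale0r.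
- exists (fun i => c * a i + b i).
  rewrite scaler_sumr -big_split /=; apply: eq_bigr => i _.
  by rewrite scalerA scalerDl.
Qed.

Lemma lfree_nil : lfree ([::] : seq V). Proof. by []. Qed.

Lemma lfree_cons s v : lfree s -> ~ spanned s v -> lfree (v :: s).
Proof.
move=> sfree vs c; rewrite /= big_ord_recl /= => h.
have [c0|c0] := eqVneq (c 0%N) 0.
  move: h; rewrite c0 scale0r add0r => /(sfree (fun i => c i.+1)) h.
  by move=> [|i] //= /h.
exfalso; apply: vs.
have -> : v = \sum_(i < size s) (- (c 0%N)^-1 * c i.+1) *: s`_i.
  apply: (scalerI c0); move/eqP: h; rewrite addr_eq0 => /eqP ->.
  rewrite scaler_sumr -sumrN; apply: eq_bigr => i _.
  by rewrite scalerA mulrA mulrN divff // mulN1r scaleNr.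
exact: (spanned_nth s (fun i => - (c 0%N)^-1 * c i.+1)).
Qed.

Lemma lfree_catP s t :
  (forall c : nat -> k, spanned t (\sum_(i < size s) c i *: s`_i) ->
    forall i, (i < size s)%N -> c i = 0) -> lfree t -> lfree (s ++ t).
Proof.
move=> hs ht c; rewrite size_cat big_split_ord /=.
under eq_bigr => i _ do rewrite nth_cat ltn_ord.
under [X in _ + X]eq_bigr => i _ do rewrite nth_cat ltnNge leq_addr addKn.
set S := \sum_(i < size s) _; set T := \sum_(i < size t) _ => h.
have Tt : spanned t T by exact: (spanned_nth t (fun i => c (size s + i)%N)).
have S0 : forall i, (i < size s)%N -> c i = 0.
  apply: hs; rewrite -/S; move/eqP: h; rewrite addr_eq0 => /eqP ->.
  exact: lspanN.
have T0 : T = 0 by rewrite -h /S big1 ?add0r // => i _; rewrite S0 ?scale0r.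
move=> i; have [/S0 //|is_] := ltnP i (size s).
rewrite -{1}(subnKC is_) ltn_add2l => /(ht (fun i => c (size s + i)%N) T0).
by rewrite subnKC.
Qed.

(** The matrix of the coordinates of [t] in terms of [s] would have more rows than columns, and a
    vector in its left kernel is a linear relation in [t]. *)
Lemma steinitz s t : lfree t -> (forall v, v \in t -> spanned s v) ->
  (size t <= size s)%N.
Proof.
move=> tfree ts; rewrite leqNgt; apply/negP => st.
have /choice[c hc] : forall i : 'I_(size t), exists c : nat -> k,
    t`_i = \sum_(j < size s) c j *: s`_j.
  by move=> i; apply/spannedP/ts/mem_nth.
pose M : 'M[k]_(size t, size s) := \matrix_(i, j) c i j.
have : kermx M != 0.
  rewrite kermx_eq0 /row_free eqn_leq negb_and -!ltnNge.
  by rewrite (leq_ltn_trans (rank_leq_col M) st) orbT.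
case/rowV0Pn => w /sub_kermxP wM w0.
move/eqP: w0; apply; apply/rowP => i; rewrite mxE.
have := tfree (fun j => if insub j is Some j' then w 0 j' else 0) _ i (ltn_ord i).
rewrite valK; apply.
transitivity (\sum_(i < size t) w 0 i *: \sum_(j < size s) c i j *: s`_j).
  by apply: eq_bigr => j _; rewrite valK hc.
under eq_bigr => j _ do rewrite scaler_sumr.
rewrite exchange_big big1 //= => j _.
under eq_bigr => l _ do rewrite scalerA.
rewrite -scaler_suml; suff -> : \sum_i0 w 0 i0 * c i0 j = 0 by rewrite scale0r.
transitivity ((w *m M) 0 j); last by rewrite wM mxE.
by rewrite mxE; apply: eq_bigr => l _; rewrite mxE.
Qed.

Lemma indep_le s P n : P `<=` spanned s -> indep_in P n -> (n <= size s)%N.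
Proof.
move=> Ps [t [tf <- tP]]; apply: steinitz => // v /tP; exact: lspan_sub.
Qed.

Lemma rkP P : finrk P ->
  indep_in P (rk P) /\ forall n, indep_in P n -> (n <= rk P)%N.
Proof.
move=> [s Ps].
have ex : exists n, `[< indep_in P n >].
  by exists 0%N; apply/asboolP; exists [::]; split.
have le n : `[< indep_in P n >] -> (n <= size s)%N by move/asboolP/indep_le; apply.
rewrite /rk; case: xgetP => [m _ //|/(_ (ex_maxn ex le))[]].
case: ex_maxnP => i /asboolP iP imax; split => // n /asboolP; exact: imax.
Qed.

Lemma finrk_sub P Q : finrk Q -> P `<=` lspan Q -> finrk P.
Proof. by move=> [s Qs] PQ; exists s => v /PQ; apply: lspan_sub. Qed.

Lemma rk_le P Q : finrk Q -> P `<=` lspan Q -> (rk P <= rk Q)%N.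
Proof.
move=> fQ PQ; have [[s [sf <- sP]] _] := rkP (finrk_sub fQ PQ).
apply: (rkP fQ).2; exists s; split => // v /sP; exact: lspan_sub.
Qed.

Lemma rk_size P s : P `<=` spanned s -> (rk P <= size s)%N.
Proof.
move=> Ps; have fP : finrk P by exists s.
by have [+ _] := rkP fP; apply: indep_le.
Qed.

Lemma basis_ext P s : finrk P -> lfree s -> (forall v, v \in s -> lspan P v) ->
  exists t, [/\ lfree (t ++ s), size (t ++ s) = rk P,
    (forall v, v \in t -> lspan P v) & P `<=` spanned (t ++ s)].
Proof.
move=> fP; move e: (rk P - size s)%N => n; elim: n s e => [|n IH] s e sf sP.
  have ss : size s = rk P.
    apply/eqP; rewrite eqn_leq (rkP fP).2 /=; last by exists s.
    by rewrite -subn_eq0 e.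
  exists [::]; split => //= v Pv; apply: contrapT => /(lfree_cons sf) vf.
  have : ((size s).+1 <= rk P)%N.
    apply: (rkP fP).2; exists (v :: s); split => // u.
    by rewrite inE => /orP[/eqP ->|/sP //]; exact: lspan_mem.
  by rewrite ss ltnn.
have [Ps|] := pselect (P `<=` spanned s).
  by have := rk_size Ps; rewrite -subn_eq0 e.
move/existsNP => [v /not_implyP[Pv vs]].
have [||u|t [tf st tP Pt]] := IH (v :: s).
- by rewrite /= subnS e.
- exact: lfree_cons.
- by rewrite inE => /orP[/eqP ->|/sP //]; exact: lspan_mem.
exists (rcons t v); rewrite cat_rcons; split => // u.
by rewrite mem_rcons inE => /orP[/eqP ->|/tP //]; exact: lspan_mem.
Qed.

Lemma rk_basis P : finrk P ->
  exists s, [/\ lfree s, size s = rk P, (forall v, v \in s -> lspan P v) &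
    P `<=` spanned s].
Proof.
move=> fP; have [//|s] := @basis_ext P [::] fP lfree_nil.
by rewrite cats0; exists s.
Qed.

Lemma finrkU P Q : finrk P -> finrk Q -> finrk (P `|` Q).
Proof.
move=> [s Ps] [t Qt]; exists (s ++ t) => v [/Ps|/Qt]; apply: lspanS => u /=;
  by rewrite mem_cat => ->; rewrite ?orbT.
Qed.

(** Grassmann's formula with [R] anywhere inside the intersection: a basis of [R] extends to bases
    of both spans, whose union spans the sum. *)
Lemma rk_modular P Q R : finrk P -> finrk Q -> R `<=` lspan P ->
  R `<=` lspan Q -> (rk (P `|` Q) + rk R <= rk P + rk Q)%N.
Proof.
move=> fP fQ RP RQ.
have fR := finrk_sub fP RP.
have [r [rf sr rR Rr]] := rk_basis fR.
have [v /rR|p [_ sp _ Pp]] := basis_ext fP rf; first exact: lspan_sub.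
have [v /rR|q [_ sq _ Qq]] := basis_ext fQ rf; first exact: lspan_sub.
have : (rk (P `|` Q) <= size (p ++ q ++ r))%N.
  apply: rk_size => v [/Pp|/Qq]; apply: lspanS => u /=;
  by rewrite !mem_cat => /orP[] ->; rewrite ?orbT.
move: sp sq; rewrite !size_cat; lia.
Qed.

(** It will count jets: [R] consists of the multiples of dP/dW(Z, W), and [s] of powers of a
    separating function, independent modulo these multiples. *)
Lemma rk_free_mod P R s : finrk P -> R `<=` lspan P ->
  (forall v, v \in s -> lspan P v) ->
  (forall c : nat -> k, lspan R (\sum_(i < size s) c i *: s`_i) ->
    forall i, (i < size s)%N -> c i = 0) ->
  (rk R + size s <= rk P)%N.
Proof.
move=> fP RP sP sfree.
have [r [rf sr rR Rr]] := rk_basis (finrk_sub fP RP).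
apply: (rkP fP).2; exists (s ++ r); split.
- apply: lfree_catP => // c h; apply: sfree.
  by move: h; apply: lspan_sub.
- by rewrite size_cat sr addnC.
- move=> v; rewrite mem_cat => /orP[/sP //|/rR].
  exact: lspan_sub.
Qed.

End Theory.

Section Linear.
Variables (V W : lmodType k) (f : V -> W).
Hypothesis flin : forall c u v, f (c *: u + v) = c *: f u + f v.

Lemma lspan_image P v : lspan P v -> lspan (f @` P) (f v).
Proof.
have f0 : f 0 = 0.
  by apply: (addrI (1 *: f 0)); rewrite -flin scaler0 scale1r !addr0.
elim=> [u Pu||c u w _ hu _ hw]; first by apply: lspan_mem; exists u.
  by rewrite f0; exact: lspan_0.
by rewrite flin; apply: lspan_lin.
Qed.

Lemma finrk_image P : finrk P -> finrk (f @` P).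
Proof.
move=> [s Ps]; exists (map f s) => _ [v /Ps vs <-].
by apply: lspanS (lspan_image vs) => _ [u us <-]; apply: map_f.
Qed.

Lemma rk_image_le P : finrk P -> (rk (f @` P) <= rk P)%N.
Proof.
move=> fP; have [s [_ <- _ Ps]] := rk_basis fP.
rewrite -(size_map f); apply: rk_size => _ [v /Ps vs <-].
by apply: lspanS (lspan_image vs) => _ [u us <-]; apply: map_f.
Qed.

Lemma rk_image_inj P : finrk P -> (forall v, f v = 0 -> v = 0) ->
  (rk P <= rk (f @` P))%N.
Proof.
move=> fP finj; have [s [sf <- sP _]] := rk_basis fP.
apply: (rkP (finrk_image fP)).2; exists (map f s); split.
- move=> c; rewrite size_map => h; apply: sf; apply: finj.
  rewrite -[RHS]h.
  have f0 : f 0 = 0.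
    by apply: (addrI (1 *: f 0)); rewrite -flin scaler0 scale1r !addr0.
  have fD u v : f (u + v) = f u + f v by rewrite -{1}[u]scale1r flin scale1r.
  rewrite (big_morph f fD f0); apply: eq_bigr => i _.
  by rewrite (nth_map 0) // -[_ *: _]addr0 flin f0 addr0.
- by rewrite size_map.
- by move=> _ /mapP[v /sP vP ->]; exact: lspan_image.
Qed.

End Linear.
End Rank.

(** * Hilbert function of a plane curve *)

Section Monomials.
Variables (k : fieldType) (U : comAlgType k).
Implicit Types u v x y : U.

Definition regular u := forall v, u * v = 0 -> v = 0.

Lemma regularM u v : regular u -> regular v -> regular (u * v).
Proof. by move=> ru rv w; rewrite -mulrA => /ru/rv. Qed.

Lemma regularX u n : regular u -> regular (u ^+ n).
Proof.
move=> ru; elim: n => [|n IH]; last by rewrite exprS; apply: regularM.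
by move=> v; rewrite expr0 mul1r.
Qed.

Lemma mulZD u c v w : u * (c *: v + w) = c *: (u * v) + u * w.
Proof. by rewrite mulrDr scalerAr. Qed.

Lemma rk_regular_image u (P : set U) : finrk P -> regular u ->
  (rk P <= rk ( *%R u @` P))%N.
Proof. by move=> fP ru; apply: rk_image_inj => // c v w; exact: mulZD. Qed.

Lemma lspanMl u v (P Q : set U) :
  (forall p, P p -> lspan Q (u * p)) -> lspan P v -> lspan Q (u * v).
Proof.
move=> h; elim=> [p /h //||c p w _ hp _ hw]; first by rewrite mulr0; exact: lspan_0.
by rewrite mulZD; exact: lspan_lin.
Qed.

Section Character.
Variables (M : zmodType) (mon : M -> U).
Hypothesis mon0 : mon 0 = 1.
Hypothesis monD : forall a b, mon (a + b) = mon a * mon b.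
Implicit Types (K F : seq M) (a b m : M).

(** The exponents range over a group, so that monomials are units and a translation of the exponents
    preserves the rank. *)
Definition mset K : set U := [set mon m | m in [set m | m \in K]].

Lemma mset_mem K m : m \in K -> mset K (mon m).
Proof. by exists m. Qed.

Lemma finrk_mset K : finrk (mset K).
Proof.
by exists (map mon K) => _ [m mK <-]; apply: lspan_mem; exact: map_f.
Qed.

Lemma monMn m n : mon (m *+ n) = mon m ^+ n.
Proof. by elim: n => [|n IH]; rewrite ?mulr0n ?mon0 // mulrS monD IH exprS. Qed.

Lemma mon_regular m : regular (mon m).
Proof.
by move=> v h; rewrite -[v]mul1r -mon0 -(addNr m) monD -mulrA h mulr0.
Qed.

Lemma rk_mset_le K K' : {subset K <= K'} -> (rk (mset K) <= rk (mset K'))%N.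
Proof.
move=> KK'; apply: rk_le; first exact: finrk_mset.
by move=> _ [m /KK' mK <-]; apply: lspan_mem; exists m.
Qed.

Lemma rk_mset_size K : (rk (mset K) <= size K)%N.
Proof.
rewrite -(size_map mon); apply: rk_size => _ [m mK <-].
by apply: lspan_mem; exact: map_f.
Qed.

Lemma rk_mset_shift K c : (rk (mset K) <= rk (mset [seq (c + m)%R | m <- K]))%N.
Proof.
apply: leq_trans (rk_regular_image (finrk_mset K) (mon_regular (m := c))) _.
apply: rk_le; first exact: finrk_mset.
move=> _ [_ [m mK <-] <-]; apply: lspan_mem; exists (c + m); last exact: monD.
exact: map_f.
Qed.

Lemma lspan_mset_mul K K' L u v :
  (forall a b, a \in K -> b \in K' -> a + b \in L) ->
  lspan (mset K) u -> lspan (mset K') v -> lspan (mset L) (u * v).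
Proof.
move=> h hu; apply: lspanMl => _ [b bK <-]; rewrite mulrC; move: hu.
apply: lspanMl => _ [a aK <-]; rewrite mulrC -monD.
by apply: lspan_mem; exists (a + b) => //=; apply: h.
Qed.

End Character.
End Monomials.

Lemma count_ltn (T : eqType) (p q : pred T) (s : seq T) x : x \in s ->
  (forall y, p y -> q y) -> q x -> ~~ p x -> (count p s < count q s)%N.
Proof.
move=> xs pq qx px; elim: s xs => //= y s IH; rewrite inE => /orP[/eqP <-|/IH].
  by rewrite qx (negbTE px) add0n add1n ltnS; apply: sub_count.
have : (p y <= q y)%N by case: (p y) (@pq y) => // ->.
lia.
Qed.

Notation Z2 := (int * int)%type.

Definition lexlt (a b : Z2) := (a.1 < b.1) || ((a.1 == b.1) && (a.2 < b.2)).

Lemma lexlt_trans : transitive lexlt.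
Proof. by move=> [b1 b2] [a1 a2] [c1 c2]; rewrite /lexlt /=; lia. Qed.

Lemma lexlt_irr : irreflexive lexlt.
Proof. by move=> [a1 a2]; rewrite /lexlt /=; lia. Qed.

Lemma lexlt_add (m a b : Z2) : lexlt a b -> lexlt (a + m) (b + m).
Proof. by case: a b m => [a1 a2] [b1 b2] [m1 m2]; rewrite /lexlt /=; lia. Qed.

Lemma lexlt_total (a b : Z2) : a != b -> ~~ lexlt a b -> lexlt b a.
Proof.
by case: a b => [a1 a2] [b1 b2]; rewrite /lexlt xpair_eqE /=; lia.
Qed.

Lemma lex_max (A : seq Z2) : A != [::] ->
  exists2 mu, mu \in A & forall a, a \in A -> a != mu -> lexlt a mu.
Proof.
elim: A => // a A IH _; have [->|/IH[mu muA mumax]] := eqVneq A [::].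
  by exists a; rewrite ?inE // => b; rewrite inE => ->.
have [amu|amu] := boolP (lexlt a mu).
  exists mu; first by rewrite inE muA orbT.
  by move=> b; rewrite inE => /orP[/eqP -> //|]; exact: mumax.
have [e|ne] := eqVneq a mu.
  exists mu; first by rewrite inE muA orbT.
  by move=> b; rewrite inE => /orP[/eqP -> /eqP //|]; exact: mumax.
have mua := lexlt_total ne amu.
exists a; first exact: mem_head.
move=> b; rewrite inE => /orP[/eqP -> /eqP //|bA _].
have [-> //|/(mumax _ bA) bmu] := eqVneq b mu.
exact: lexlt_trans mua.
Qed.

(** The Minkowski sum of [j] copies of [A] and one of [F]; duplicates are removed so that [size]
    counts lattice points. *)
Fixpoint dilate (A F : seq Z2) (j : nat) : seq Z2 :=
  if j is i.+1 then undup [seq a + m | a <- A, m <- dilate A F i]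
  else undup F.

Lemma dilate_uniq A F j : uniq (dilate A F j).
Proof. by case: j => [|j]; exact: undup_uniq. Qed.

Lemma dilateS A F j a m : a \in A -> m \in dilate A F j ->
  a + m \in dilate A F j.+1.
Proof. by move=> aA mK; rewrite mem_undup; apply: allpairs_f. Qed.

Lemma dilate_shift A F j a m : a \in A -> m \in F -> a *+ j + m \in dilate A F j.
Proof.
move=> aA mF; elim: j => [|j IH]; first by rewrite mulr0n add0r mem_undup.
by rewrite mulrS -addrA; exact: dilateS.
Qed.

Section HilbertCurve.
Variables (k : fieldType) (U : comAlgType k) (mon : Z2 -> U).
Hypothesis mon0 : mon 0 = 1.
Hypothesis monD : forall a b, mon (a + b) = mon a * mon b.
Variables (A : seq Z2) (f : Z2 -> k).
Hypothesis A0 : A != [::].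
Hypothesis fA : forall a, a \in A -> f a != 0.
Hypothesis Auniq : uniq A.
Hypothesis feq : \sum_(a <- A) f a *: mon a = 0.

(* Every monomial divisible by the lexicographically largest monomial of [f]
   can be rewritten into smaller ones. *)
Lemma rk_hypersurface (K K' : seq Z2) : uniq K -> uniq K' ->
  (forall a m, a \in A -> m \in K' -> a + m \in K) ->
  (rk (mset mon K) + size K' <= size K)%N.
Proof.
move=> uK uK' AK'; have [mu muA mumax] := lex_max A0.
pose L := [seq mu + m | m <- K'].
have LK : {subset L <= K} by move=> _ /mapP[m mK ->]; exact: AK'.
have uL : uniq L by rewrite map_inj_uniq //; exact: addrI.
(* The order is not well founded on Z^2. The induction is on the number of smaller elements in the
   finite set [K], which contains all the rewritten monomials. *)
have red n m : m \in K -> (count (lexlt^~ m) K < n)%N ->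
    lspan (mset mon [seq m <- K | m \notin L]) (mon m).
  elim: n m => // n IH m mK mn.
  have [mL|mL] := boolP (m \in L); last first.
    by apply: lspan_mem; apply: mset_mem; rewrite mem_filter mL.
  have /mapP[m' m'K em] := mL; rewrite em monD.
  have -> : mon mu = - (f mu)^-1 *: \sum_(a <- A | a != mu) f a *: mon a.
    move: feq; rewrite (bigD1_seq mu) //= => /eqP; rewrite addr_eq0 => /eqP h.
    apply: (scalerI (fA muA)); rewrite h scalerA mulrN divff ?fA //.
    by rewrite scaleN1r.
  rewrite -scalerAl; apply: lspanZ; rewrite mulr_suml big_seq_cond.
  apply: lspan_sum => a /andP[aA amu].
  rewrite -scalerAl -monD; apply: lspanZ.
  have aK : a + m' \in K by exact: AK'.
  apply: IH => //; apply: leq_trans (_ : (count (lexlt^~ m) K <= n)%N) => //.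
  have am : lexlt (a + m') m by rewrite em; apply: lexlt_add; exact: mumax.
  by apply: (@count_ltn _ _ _ _ (a + m')) => // [y /lexlt_trans|]; [apply|rewrite lexlt_irr].
have : (rk (mset mon K) <= size [seq m <- K | m \notin L])%N.
  rewrite -(size_map mon); apply: rk_size => _ [m mK <-].
  by apply: lspanS (red _ m mK (ltnSn _)) => _ [a aK <-]; exact: map_f.
rewrite -(count_predC (mem L) K) -!size_filter -(size_map (+%R mu) K').
have : (size L <= size [seq m <- K | m \in L])%N.
  by apply: uniq_leq_size => // m mL; rewrite mem_filter mL LK.
by move=> hL hK; rewrite addnC; exact: leq_add.
Qed.

(** By [rk_hypersurface], each rank is at most the increment in the size of the dilates, and these
    increments telescope. *)
Lemma sum_rk_dilate F J :
  (\sum_(j < J.+1) rk (mset mon (dilate A F j)) <= size (dilate A F J))%N.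
Proof.
elim: J => [|J IH]; first by rewrite big_ord1; exact: rk_mset_size.
rewrite big_ord_recr /= addnC.
have := @rk_hypersurface (dilate A F J.+1) (dilate A F J)
  (dilate_uniq _ _ _) (dilate_uniq _ _ _) (@dilateS A F J).
by apply: leq_trans; rewrite leq_add2l.
Qed.

End HilbertCurve.

(** The J-th dilate has about [Area * J ^ 2] points, and [F] affects only lower order terms: a form
    of [2 * Area < n0 + 1] by counting alone. *)
Definition area_bound (A : seq Z2) (n0 : nat) := forall F : seq Z2,
  exists J, (2 * size (dilate A F J) < n0.+1 * J ^ 2)%N.

(** If all increments exceeded [n0], then [y j] would be at least [n0.+1 * j], with a sum of at
    least half of [n0.+1 * J ^ 2]. *)
Lemma small_increment (y : nat -> nat) (c n0 J : nat) :
  (\sum_(j < J.+1) y j <= c)%N -> (2 * c < n0.+1 * J ^ 2)%N ->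
  exists j, (y j.+1 <= y j + n0)%N.
Proof.
move=> yc cJ; apply: contrapT => /forallNP h.
have hy j : (n0.+1 * j <= y j)%N.
  elim: j => [|j IH]; first by rewrite muln0.
  by have /negP := h j; rewrite -ltnNge; lia.
have : (n0.+1 * \sum_(j < J.+1) j <= \sum_(j < J.+1) y j)%N.
  by rewrite big_distrr; apply: leq_sum => j _; exact: hy.
have hJ : (J * J <= 2 * \sum_(j < J.+1) j)%N.
  elim: (J) => // i; rewrite [in X in _ -> X]big_ord_recr /=; nia.
have : (n0.+1 * (J * J) <= n0.+1 * (2 * \sum_(j < J.+1) j))%N by rewrite leq_mul2l hJ orbT.
move: yc cJ; rewrite expnS expn1; lia.
Qed.

(** * Functions of bounded degree *)

Section Degree.
Variables (k : fieldType) (U : comAlgType k) (M : zmodType) (mon : M -> U).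
Hypothesis mon0 : mon 0 = 1.
Hypothesis monD : forall a b, mon (a + b) = mon a * mon b.
Implicit Types (F E : seq M) (x y m : M).

Definition ray x a F := [seq x *+ i + m | i <- iota 0 a.+1, m <- F].

(* [deg_le x d] says that the function [mon x] has at most [d] poles: the
   dimension of the span of [1, mon x, .., mon x ^ a] times any fixed finite set
   of monomials grows at most like [a * d]. *)
Definition deg_le x d := forall F, exists C, forall a,
  (rk (mset mon (ray x a F)) <= a * d + C)%N.

Lemma rayP x a F m :
  reflect (exists i m', [/\ (i <= a)%N, m' \in F & m = x *+ i + m'])
          (m \in ray x a F).
Proof.
apply: (iffP allpairsP) => [[[i m'] /= [ia mF ->]]|[i [m' [ia mF ->]]]].
  by exists i, m'; split => //; move: ia; rewrite -[0%N :: iota 1 a]/(iota 0 a.+1) mem_iota add0n ltnS.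
have ii : i \in iota 0 a.+1 by rewrite mem_iota add0n ltnS.
by exists (i, m').
Qed.

Lemma raySl x a a' F F' : (a <= a')%N -> {subset F <= F'} ->
  {subset ray x a F <= ray x a' F'}.
Proof.
move=> aa' FF' _ /rayP[i [m [ia mF ->]]]; apply/rayP; exists i, m; split => //.
  exact: leq_trans aa'.
exact: FF'.
Qed.

(** The span for [a.+2] is the sum of the span for [a.+1] and of its translate by [x], and both
    contain the translate of the span for [a]. *)
Lemma ray_concave x F a :
  (rk (mset mon (ray x a.+2 F)) + rk (mset mon (ray x a F)) <=
   rk (mset mon (ray x a.+1 F)) + rk (mset mon (ray x a.+1 F)))%N.
Proof.
pose sh L := [seq x + m | m <- L].
have shP i m' n : (i <= n)%N -> m' \in F -> x *+ i.+1 + m' \in sh (ray x n F).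
  move=> i_n mF; apply/mapP; exists (x *+ i + m'); last by rewrite addrA mulrS.
  by apply/rayP; exists i, m'.
have le2 : (rk (mset mon (sh (ray x a.+1 F))) <= rk (mset mon (ray x a.+1 F)))%N.
  apply: leq_trans (rk_mset_shift mon0 monD _ (- x)) _; apply: rk_mset_le => m.
  by rewrite -map_comp => /mapP[m' m'r ->] /=; rewrite addrA addNr add0r.
have le0 := rk_mset_shift mon0 monD (ray x a F) x.
have le1 : (rk (mset mon (ray x a.+2 F)) <=
    rk (mset mon (ray x a.+1 F) `|` mset mon (sh (ray x a.+1 F))))%N.
  apply: rk_le; first by apply: finrkU; exact: finrk_mset.
  move=> _ [m /rayP[i [m' [ia mF ->]]] <-]; apply: lspan_mem.
  case: i ia => [|i] ia; [left|right]; apply: mset_mem; last exact: shP.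
  by apply/rayP; exists 0%N, m'.
have := leq_add le1 le0; move/leq_trans; apply.
apply: leq_trans (leq_add (leqnn _) le2).
apply: rk_modular; try exact: finrk_mset.
  move=> _ [_ /mapP[m mr ->] <-]; apply: lspan_mem; apply: mset_mem.
  move: mr => /rayP[i [m' [ia mF ->]]]; rewrite addrA -mulrS.
  by apply/rayP; exists i.+1, m'.
move=> _ [_ /mapP[m mr ->] <-]; apply: lspan_mem; apply: mset_mem.
by apply: map_f; move: mr; apply: raySl.
Qed.

(** By concavity, the increments after [j] are at most [n0] as well. *)
Lemma ray_increment x F n0 j :
  (rk (mset mon (ray x j.+1 F)) <= rk (mset mon (ray x j F)) + n0)%N ->
  exists C, forall a, (rk (mset mon (ray x a F)) <= a * n0 + C)%N.
Proof.
move=> hj; exists (rk (mset mon (ray x j F))).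
have hi i : (rk (mset mon (ray x (j + i).+1 F)) <=
             rk (mset mon (ray x (j + i) F)) + n0)%N.
  elim: i => [|i IH]; first by rewrite addn0.
  by have := ray_concave x F (j + i); rewrite addnS; lia.
have h i : (rk (mset mon (ray x (j + i) F)) <=
            i * n0 + rk (mset mon (ray x j F)))%N.
  elim: i => [|i IH]; first by rewrite addn0.
  by have := hi i; rewrite addnS; lia.
move=> a; apply: leq_trans (_ : (rk (mset mon (ray x (j + a) F)) <= _)%N) => //.
by apply: rk_mset_le; apply: raySl => //; exact: leq_addl.
Qed.

Definition grid x y a b F := ray x a (ray y b F).

Lemma gridP x y a b F m :
  reflect (exists i j m', [/\ (i <= a)%N, (j <= b)%N, m' \in F &
             m = x *+ i + (y *+ j + m')]) (m \in grid x y a b F).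
Proof.
apply: (iffP (rayP _ _ _ _)) => [[i [_ [ia /rayP[j [m' [jb mF ->]]] ->]]]|].
  by exists i, j, m'.
case=> i [j [m' [ia jb mF ->]]]; exists i, (y *+ j + m'); split => //.
by apply/rayP; exists j, m'.
Qed.

Lemma gridS x y a a' b b' F F' : (a <= a')%N -> (b <= b')%N ->
  {subset F <= F'} -> {subset grid x y a b F <= grid x y a' b' F'}.
Proof. by move=> aa' bb' FF'; apply: raySl => //; exact: raySl. Qed.

End Degree.

(** * Polynomials in two functions *)

Lemma free_family (k : fieldType) (V : lmodType k) (P : set V) (T : finType)
    (v : T -> V) : finrk P -> (forall t, lspan P (v t)) ->
  (forall c : T -> k, \sum_t c t *: v t = 0 -> forall t, c t = 0) ->
  (#|T| <= rk P)%N.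
Proof.
move=> fP vP vfree; apply: (rkP fP).2; exists [seq v t | t <- enum T]; split.
- move=> c; rewrite size_map -cardE => h i iT.
  pose t := enum_val (Ordinal iT).
  have := vfree (fun t => c (enum_rank t)) _ t; rewrite enum_valK; apply.
  rewrite -[RHS]h big_enum_val /=; apply: eq_bigr => j _.
  rewrite enum_valK (nth_map (enum_val j)) -?cardE //; congr (_ *: v _).
  exact: enum_val_nth.
- by rewrite size_map -cardE.
- by move=> _ /mapP[t _ ->].
Qed.

Lemma nat_avoid (k : numDomainType) (s : seq k) : exists n : nat, n%:R \notin s.
Proof.
apply: contrapT => /forallNP h.
have : (size [seq n%:R : k | n <- iota 0 (size s).+1] <= size s)%N.
  apply: uniq_leq_size => [|_ /mapP[n _ ->]]; last exact/negPn/negP.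
  by rewrite map_inj_uniq ?iota_uniq // => a b /eqP; rewrite eqr_nat => /eqP.
by rewrite size_map size_iota ltnn.
Qed.

Lemma poly_nonroot (k : numClosedFieldType) (s : seq k) (p : {poly k}) :
  p != 0 -> exists2 c, c \notin s & p.[c] != 0.
Proof.
move=> p0; have [r pr] := closed_field_poly_normal p.
have [n] := nat_avoid (s ++ r); rewrite mem_cat negb_or => /andP[ns nr].
exists n%:R => //; apply: contra nr; rewrite {1}pr hornerZ mulf_eq0.
by rewrite lead_coef_eq0 (negbTE p0) /= -/(root _ _) root_prod_XsubC.
Qed.

Section TwoFunctions.
Variables (k : numClosedFieldType) (U : comAlgType k).

(** The inner variable goes to [x] and the outer one to [y]: [size] measures the degree in [y], and
    [sizeY] that in [x]. *)
Definition ev2 (x y : U) (P : {poly {poly k}}) : U :=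
  (map_poly (horner_alg x) P).[y].

Lemma ev2E x y (P : {poly {poly k}}) n : (size P <= n)%N ->
  ev2 x y P = \sum_(j < n) horner_alg x P`_j * y ^+ j.
Proof.
move=> Pn; rewrite /ev2 (horner_coef_wide _ (leq_trans (size_poly _ _) Pn)).
by apply: eq_bigr => j _; rewrite coef_map.
Qed.

Lemma horner_algE (x : U) (p : {poly k}) n : (size p <= n)%N ->
  horner_alg x p = \sum_(i < n) p`_i *: x ^+ i.
Proof.
move=> pn; rewrite /horner_alg /horner_morph.
rewrite (horner_coef_wide _ (leq_trans (size_poly _ _) pn)).
by apply: eq_bigr => i _; rewrite coef_map mulr_algl.
Qed.

Lemma horner_algX_XsubC (x : U) c : horner_alg x ('X - c%:P) = x - c%:A.
Proof. by rewrite rmorphB /= horner_algX horner_algC. Qed.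

Lemma ev2D x y : {morph ev2 x y : P Q / P + Q}.
Proof. by move=> P Q; rewrite /ev2 rmorphD hornerD. Qed.

Lemma ev2M x y : {morph ev2 x y : P Q / P * Q}.
Proof. by move=> P Q; rewrite /ev2 rmorphM hornerM. Qed.

Lemma ev2C x y p : ev2 x y p%:P = horner_alg x p.
Proof. by rewrite /ev2 map_polyC hornerC. Qed.

Lemma ev20 x y : ev2 x y 0 = 0.
Proof. by rewrite /ev2 rmorph0 horner0. Qed.

Variables (M : zmodType) (mon : M -> U).
Implicit Types x y : M.
Hypothesis mon0 : mon 0 = 1.
Hypothesis monD : forall a b, mon (a + b) = mon a * mon b.

Lemma relation_exists x y a b :
  (rk (mset mon (grid x y a b [:: 0%R : M])) < a.+1 * b.+1)%N ->
  exists P : {poly {poly k}}, [/\ P != 0, ev2 (mon x) (mon y) P = 0,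
    (size P <= b.+1)%N & forall j, (size (P`_j)%R <= a.+1)%N].
Proof.
move=> h.
pose v (t : 'I_a.+1 * 'I_b.+1) := mon x ^+ t.1 * mon y ^+ t.2.
have [|] := pselect (forall c : 'I_a.+1 * 'I_b.+1 -> k,
    \sum_t c t *: v t = 0 -> forall t, c t = 0).
  move=> /(@free_family _ _ (mset mon (grid x y a b [:: 0%R : M])) _ v (finrk_mset mon _)).
  rewrite card_prod !card_ord leqNgt h => /(_ _) H; exfalso.
  suff : false by []; apply: H => t; apply: lspan_mem.
  exists (x *+ t.1 + (y *+ t.2 + 0)).
    by apply/gridP; exists t.1, t.2, 0; split; rewrite ?inE // -ltnS ltn_ord.
  by rewrite addr0 monD !(monMn mon0 monD).
move=> /existsNP[c /not_implyP[c0 /existsNP[[i j] cij]]].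
pose P : {poly {poly k}} := \poly_(j < b.+1) \poly_(i < a.+1) c (inord i, inord j).
exists P; split.
- apply/negP => /eqP P0; apply: cij.
  have : P`_j`_i = 0 by rewrite P0 !coef0.
  by rewrite coef_poly ltn_ord coef_poly ltn_ord !inord_val.
- rewrite (ev2E _ _ (size_poly _ _)) -[RHS]c0.
  transitivity (\sum_i \sum_j c (i, j) *: v (i, j)); last first.
    by rewrite pair_bigA; apply: eq_bigr => -[].
  rewrite exchange_big; apply: eq_bigr => l _ /=.
  rewrite coef_poly ltn_ord (horner_algE _ (size_poly _ _)) mulr_suml.
  by apply: eq_bigr => n _; rewrite coef_poly ltn_ord !inord_val scalerAl.
- exact: size_poly.
- by move=> l; rewrite coef_poly; case: ifP; rewrite ?size_poly ?size_poly0.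
Qed.

Lemma lspan_horner (S : set U) (x w : U) (p : {poly k}) n : (size p <= n)%N ->
  (forall i, (i < n)%N -> lspan S (x ^+ i * w)) -> lspan S (horner_alg x p * w).
Proof.
move=> pn h; rewrite (horner_algE _ pn) mulr_suml; apply: lspan_sum => i _.
by rewrite -scalerAl; apply: lspanZ; apply: h.
Qed.

(** [deg_le] controls each function only by itself. The mixed second difference of the rank of the
    grid is at most zero far out, so that the rank is bounded by the sum of the growths along two
    sides of the grid. *)
Lemma grid_rank x y d1 d2 (sx : seq k) :
  (forall c, c \notin sx -> regular (mon x - c%:A)) ->
  deg_le mon x d1 -> deg_le mon y d2 -> forall E, exists C, forall a b,
  (rk (mset mon (grid x y a b E)) <= a * d1 + b * d2 + C)%N.
Proof.
move=> xreg dx dy E.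
pose S a b := rk (mset mon (grid x y a b E)).
(* The grid with sides [C0] and [d1] has rank at most [C0 * d1 + C0], less than its [C0.+1 * d1.+1]
   monomials, which gives a relation. *)
have [C0 hC0] := dx (ray y d1 [:: 0%R : M]).
have [P [P0 evP _ sP]] : exists P : {poly {poly k}}, [/\ P != 0,
    ev2 (mon x) (mon y) P = 0, (size P <= d1.+1)%N &
    forall j, (size (P`_j)%R <= C0.+1)%N].
  by apply: relation_exists; apply: leq_ltn_trans (hC0 C0) _; lia.
pose q := (size P).-1; pose p := lead_coef P.
have p0 : p != 0 by rewrite lead_coef_eq0.
(* Modulo [X - c], the leading coefficient of [P] in [Y] becomes a nonzero constant. *)
have [c /xreg creg pc] := poly_nonroot sx p0.
set X := mon x; set Y := mon y.
(* The multiples of [X - c] in [T1] and the lower powers of [Y] in [T2] together span the grid for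
   [a.+1] and [b.+1]; they share [X - c] times the grid for [a] and [b]. *)
have key a b : (C0 <= a)%N -> (q <= b)%N ->
    (S a.+1 b.+1 + S a b <= S a b.+1 + S a.+1 b)%N.
  move=> ca qb.
  pose T1 := *%R (X - c%:A) @` mset mon (grid x y a b.+1 E).
  pose T2 := mset mon (grid x y a.+1 b E).
  have fT1 : finrk T1 by apply: finrk_image => [d u v|]; [exact: mulZD|exact: finrk_mset].
  have fT2 : finrk T2 by exact: finrk_mset.
  have le1 : (S a b <= rk ( *%R (X - c%:A) @` mset mon (grid x y a b E)))%N.
    by apply: rk_regular_image => //; exact: finrk_mset.
  have le2 : (rk T1 <= S a b.+1)%N.
    by apply: rk_image_le => [d u v|]; [exact: mulZD|exact: finrk_mset].
  apply: leq_trans (leq_add le2 (leqnn (rk T2))).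
  apply: leq_trans (rk_modular fT1 fT2 (R := *%R (X - c%:A) @` mset mon (grid x y a b E)) _ _).
  - apply: leq_add le1; apply: rk_le; first exact: finrkU.
    have Tlow i j e : (i <= a.+1)%N -> (j <= b)%N -> e \in E ->
        lspan (T1 `|` T2) (X ^+ i * (Y ^+ j * mon e)).
      move=> ia jb eE; apply: lspan_mem; right; exists (x *+ i + (y *+ j + e)).
        by apply/gridP; exists i, j, e.
      by rewrite !monD !(monMn mon0 monD).
    (* Modulo [X - c], a polynomial in [X] acts as its value at [c]. *)
    have Tred (r : {poly k}) j e : (size r <= a.+2)%N -> (j <= b.+1)%N -> e \in E ->
        lspan (T1 `|` T2) (horner_alg X r * (Y ^+ j * mon e) -
                           r.[c] *: (Y ^+ j * mon e)).
      move=> sr jb eE.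
      have : root (r - r.[c]%:P) c by rewrite /root hornerD hornerN hornerC subrr.
      move=> /factor_theorem[r' er'].
      have sr' : (size r' <= a.+1)%N.
        have [->|r'0] := eqVneq r' 0; first by rewrite size_poly0.
        have : size (r - r.[c]%:P) = (size r').+1.
          by rewrite er' size_Mmonic ?monicXsubC // size_XsubC addn2.
        have : (size (r - r.[c]%:P)%R <= a.+2)%N.
          apply: leq_trans (size_polyD _ _) _; rewrite size_polyN geq_max sr.
          by apply: leq_trans (size_polyC_leq1 _) _.
        lia.
      have -> : horner_alg X r * (Y ^+ j * mon e) - r.[c] *: (Y ^+ j * mon e) =
          (X - c%:A) * (horner_alg X r' * (Y ^+ j * mon e)).
        transitivity (horner_alg X (r' * ('X - c%:P)) * (Y ^+ j * mon e)).
          by rewrite -er' rmorphB /= horner_algC mulrBl mulr_algl.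
        by rewrite rmorphM /= horner_algX_XsubC -mulrA mulrCA.
      apply: (@lspanS _ _ T1); first by move=> u; left.
      apply: (@lspan_image _ _ _ ( *%R (X - c%:A)) (fun d u v => mulZD _ d u v)).
      apply: (lspan_horner sr') => i ia; apply: lspan_mem.
      exists (x *+ i + (y *+ j + e)); first by apply/gridP; exists i, j, e.
      by rewrite !monD !(monMn mon0 monD).
    (* The relation times [Y ^+ (b.+1 - q)] expresses the top power of [Y], with coefficient [p.[c]]
       modulo [X - c], by lower powers. *)
    have Ttop e : e \in E -> lspan (T1 `|` T2) (Y ^+ b.+1 * mon e).
      move=> eE.
      have eq0 : \sum_(j < q.+1) horner_alg X P`_j * (Y ^+ (j + (b.+1 - q)) * mon e) = 0.
        transitivity (ev2 X Y P * (Y ^+ (b.+1 - q) * mon e)); last by rewrite evP mul0r.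
        rewrite (@ev2E _ _ _ q.+1); last by rewrite /q; case: (size P).
        rewrite mulr_suml; apply: eq_bigr => j _; rewrite exprD.
        by rewrite -!mulrA.
      move: eq0; rewrite big_ord_recr /= subnKC; last by rewrite (leq_trans qb).
      rewrite -[P`_q]/p addrC => /eqP; rewrite addr_eq0 => /eqP eq0.
      rewrite -[_ * _]scale1r -(mulVf pc) -scalerA; apply: lspanZ.
      rewrite -[_ *: _](subKr (horner_alg X p * (Y ^+ b.+1 * mon e))).
      apply: lspanB; last first.
        apply: Tred => //; apply: leq_trans (_ : (C0.+1 <= _)%N); first exact: sP.
        by rewrite ltnS leqW.
      rewrite eq0; apply: lspanN; apply: lspan_sum => j _.
      apply: (lspan_horner (sP j)) => i ia; apply: Tlow => //.
        by rewrite ltnW // (leq_trans ia).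
      by have := ltn_ord j; move: qb; lia.
    move=> _ [m /gridP[i [j [e [ia jb eE ->]]]] <-].
    rewrite !monD !(monMn mon0 monD) -/X -/Y.
    move: jb; rewrite leq_eqVlt ltnS => /orP[/eqP ->|jb]; last exact: Tlow.
    have := @Tred 'X^i b.+1 e; rewrite rmorphXn /= horner_algX size_polyXn hornerXn.
    move=> /(_ _ _ eE) h.
    rewrite -[_ * _](subrK (c ^+ i *: (Y ^+ b.+1 * mon e))); apply: lspanD.
      exact: h.
    by apply: lspanZ; exact: Ttop.
  - move=> _ [_ [m mg <-] <-]; apply: lspan_mem; exists (mon m) => //.
    by apply: mset_mem; move: mg; apply: gridS.
  - move=> _ [_ [m /gridP[i [j [e [ia jb eE ->]]]] <-] <-].
    rewrite mulrBl mulr_algl; apply: lspanB; last (apply: lspanZ); apply: lspan_mem.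
      exists (x *+ i.+1 + (y *+ j + e)); last by rewrite mulrS -addrA monD.
      by apply/gridP; exists i.+1, j, e.
    by apply: mset_mem; apply/gridP; exists i, j, e; split => //; rewrite leqW.
have key1 a j : (C0 <= a)%N ->
    (S a.+1 (q + j) + S a q <= S a (q + j) + S a.+1 q)%N.
  move=> ca; elim: j => [|j IH]; first by rewrite addn0 addnC.
  by have := key a (q + j)%N ca (leq_addr _ _); rewrite addnS; lia.
have key2 i j : (S (C0 + i) (q + j) + S C0 q <= S (C0 + i) q + S C0 (q + j))%N.
  elim: i => [|i IH]; first by rewrite addn0 addnC.
  by have := key1 (C0 + i)%N j (leq_addr _ _); rewrite addnS; lia.
have [C1 hC1] := dx (ray y q E).
have [C2 hC2] := dy (ray x C0 E).
exists (C0 * d1 + q * d2 + C1 + C2)%N => a b.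
have hS1 : (S (C0 + a) q <= (C0 + a) * d1 + C1)%N by exact: hC1.
have hS2 : (S C0 (q + b) <= (q + b) * d2 + C2)%N.
  apply: leq_trans (hC2 _); apply: rk_mset_le => m /gridP[i [j [e [ia jb eE ->]]]].
  apply/gridP; exists j, i, e; split => //; exact: addrCA.
have : (rk (mset mon (grid x y a b E)) <= S (C0 + a) (q + b))%N.
  by apply: rk_mset_le; apply: gridS => //; exact: leq_addl.
have := key2 a b; rewrite -/(S a b); lia.
Qed.

End TwoFunctions.

(** * Degrees of monomials on a plane curve *)

Notation e1 := ((1%R, 0%R) : Z2).
Notation e2 := ((0%R, 1%R) : Z2).

Lemma pair_mulrn (V W : zmodType) (a : V) (b : W) i :
  (a, b) *+ i = (a *+ i, b *+ i).
Proof. by elim: i => [|i IH]; rewrite ?mulr0n // !mulrS IH. Qed.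

Definition rect (p q : int) (n m : nat) : seq Z2 :=
  [seq (p + i%:Z, q + j%:Z) | i <- iota 0 n, j <- iota 0 m].

Lemma mem_rect p q n m (a : Z2) : (a \in rect p q n m) =
  [&& p <= a.1, a.1 < p + n%:Z, q <= a.2 & a.2 < q + m%:Z].
Proof.
apply/allpairsP/idP => [[[i j]] /= [] |/and4P[h1 h2 h3 h4]].
  by rewrite !mem_iota => hi hj ->; rewrite /=; lia.
exists (absz (a.1 - p), absz (a.2 - q)); rewrite !mem_iota /=; split; try lia.
case: a h1 h2 h3 h4 => a1 a2 /= h1 h2 h3 h4; apply/eqP.
by rewrite xpair_eqE; lia.
Qed.

Lemma rect_uniq p q n m : uniq (rect p q n m).
Proof.
apply: allpairs_uniq; rewrite ?iota_uniq // => -[i j] [i' j'] _ _ /= [].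
by move=> hi hj; apply/eqP; rewrite xpair_eqE; lia.
Qed.

Lemma size_rect p q n m : size (rect p q n m) = (n * m)%N.
Proof. by rewrite size_allpairs !size_iota. Qed.

Lemma mem_bound (F : seq Z2) : exists r : nat, forall m : Z2, m \in F ->
  [&& - r%:Z <= m.1, m.1 <= r%:Z, - r%:Z <= m.2 & m.2 <= r%:Z].
Proof.
elim: F => [|a F [r hr]]; first by exists 0%N.
exists (r + absz a.1 + absz a.2)%N => m; rewrite inE => /orP[/eqP ->|/hr]; lia.
Qed.

Section CurveDegrees.
Variables (k : fieldType) (U : comAlgType k) (mon : Z2 -> U).
Hypothesis mon0 : mon 0 = 1.
Hypothesis monD : forall a b, mon (a + b) = mon a * mon b.
Variables (A : seq Z2) (f : Z2 -> k).
Hypothesis A0 : A != [::].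
Hypothesis fA : forall a, a \in A -> f a != 0.
Hypothesis Auniq : uniq A.
Hypothesis feq : \sum_(a <- A) f a *: mon a = 0.

Section Box.
Variables (al be : int) (h1 h2 : nat).
Hypothesis Abox : forall a, a \in A ->
  [&& al <= a.1, a.1 <= al + h1%:Z, be <= a.2 & a.2 <= be + h2%:Z].

(** The rank is thus at most [n * h2 + m * h1 + h1 * h2]: a further column of the rectangle costs
    [h2], and a further row costs [h1]. *)
Lemma rk_rect p q n m :
  (rk (mset mon (rect p q (n + h1) (m + h2))) + n * m <= (n + h1) * (m + h2))%N.
Proof.
rewrite -[X in (_ <= X)%N](size_rect p q) -(size_rect (p - al) (q - be)).
apply: (rk_hypersurface monD A0 fA Auniq feq); try exact: rect_uniq.
move=> a b /Abox; rewrite !mem_rect /=; lia.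
Qed.

Lemma deg_fst : deg_le mon e1 h2.
Proof.
move=> F; have [r hr] := mem_bound F.
pose N := (2 * r + 1)%N; exists (N * h2 + h1 * (N + h2))%N => a.
have := rk_rect (- r%:Z) (- r%:Z) (a + N) N.
have : (rk (mset mon (ray e1 a F)) <=
   rk (mset mon (rect (- r%:Z) (- r%:Z) (a + N + h1) (N + h2))))%N.
  apply: rk_mset_le => _ /rayP[i [m [ia /hr mF ->]]].
  by rewrite mem_rect pair_mulrn /= mul0rn /N; lia.
lia.
Qed.

Lemma deg_snd : deg_le mon e2 h1.
Proof.
move=> F; have [r hr] := mem_bound F.
pose N := (2 * r + 1)%N; exists (N * h1 + h2 * (N + h1))%N => a.
have := rk_rect (- r%:Z) (- r%:Z) N (a + N).
have : (rk (mset mon (ray e2 a F)) <=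
   rk (mset mon (rect (- r%:Z) (- r%:Z) (N + h1) (a + N + h2))))%N.
  apply: rk_mset_le => _ /rayP[i [m [ia /hr mF ->]]].
  by rewrite mem_rect pair_mulrn /= mul0rn /N; lia.
lia.
Qed.

End Box.

(** Translated by [m0 *+ a], the ray of length [a] lies in the a-th dilate, because
    [m0 *+ a + (m1 - m0) *+ i] is a sum of [a] points of [A]. The count of points then yields one
    increment of at most [n0]. *)
Lemma deg_edge n0 m0 m1 : area_bound A n0 -> m0 \in A -> m1 \in A ->
  deg_le mon (m1 - m0) n0.
Proof.
move=> hA m0A m1A F; have [J hJ] := hA F.
have [|j hj] := @small_increment (fun a => rk (mset mon (ray (m1 - m0) a F))) _ _ _ _ hJ.
  apply: leq_trans (sum_rk_dilate monD A0 fA Auniq feq F J).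
  apply: leq_sum => a _.
  apply: leq_trans (rk_mset_shift mon0 monD _ (m0 *+ a)) _; apply: rk_mset_le.
  move=> _ /mapP[_ /rayP[i [m [ia mF ->]]] ->].
  have -> : m0 *+ a + ((m1 - m0) *+ i + m) = m0 *+ (a - i) + (m1 *+ i + m).
    rewrite -{1}(subnK ia) mulrnDr mulrnBl -addrA; congr (_ + _).
    by rewrite addrA [m0 *+ i + _]addrC subrK.
  rewrite -{2}(subnK ia); elim: (a - i)%N => [|l IH].
    by rewrite mulr0n add0r add0n; exact: dilate_shift.
  by rewrite mulrS -addrA addSn; exact: dilateS.
exact: ray_increment hj.
Qed.

End CurveDegrees.

(** * Degrees on the fiber product of two curves *)

Definition mulset (k : fieldType) (U : comAlgType k) (s : seq U) (P : set U) :
    set U := [set t * p | t in [set t | t \in s] & p in P].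

Lemma rk_prod (k : fieldType) (U : comAlgType k) (s : seq U) (P : set U) :
  finrk P -> finrk (mulset s P) /\ (rk (mulset s P) <= size s * rk P)%N.
Proof.
move=> fP; have [b [_ <- _ Pb]] := rk_basis fP.
have h : mulset s P `<=` spanned [seq t * p | t <- s, p <- b].
  move=> _ [t ts [p /Pb pb <-]]; move: pb; apply: lspanMl => q qb.
  by apply: lspan_mem; apply: allpairs_f.
by split; [exists [seq t * p | t <- s, p <- b]|rewrite -(size_allpairs *%R); exact: rk_size].
Qed.

Section Tower.
Variables (k : numClosedFieldType) (U : comAlgType k) (mon mons : Z2 -> U).
Hypothesis mon0 : mon 0 = 1.
Hypothesis monD : forall a b, mon (a + b) = mon a * mon b.
Hypothesis mons0 : mons 0 = 1.
Hypothesis monsD : forall a b, mons (a + b) = mons a * mons b.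
Variables (A : seq Z2) (g : Z2 -> k) (n0 : nat).
Hypothesis A0 : A != [::].
Hypothesis gA : forall a, a \in A -> g a != 0.
Hypothesis Auniq : uniq A.
Hypothesis geq : \sum_(a <- A) g a *: mons a = 0.
Hypothesis hA : area_bound A n0.
Variables (x0 x1 y0 y1 lam : U).
Hypothesis x0A : lspan (mset mon A) x0.
Hypothesis x1A : lspan (mset mon A) x1.
Hypothesis y0A : lspan (mset mons A) y0.
Hypothesis y1A : lspan (mset mons A) y1.
Hypothesis x1E : x1 = lam * x0.
Hypothesis y1E : y1 = lam * y0.
Hypothesis x0_reg : regular x0.
Hypothesis y0_reg : regular y0.
Hypothesis lam_reg : forall p, p != 0 -> regular (horner_alg lam p).

Definition mon4 (m : Z2 * Z2) : U := mon m.1 * mons m.2.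

Lemma mon40 : mon4 0 = 1. Proof. by rewrite /mon4 mon0 mons0 mul1r. Qed.

Lemma mon4D a b : mon4 (a + b) = mon4 a * mon4 b.
Proof. by rewrite /mon4 monD monsD mulrACA. Qed.

(** This is the binary form of degree [r] in [x0] and [x1] obtained by homogenizing [p], since [lam]
    is [x1 / x0]. *)
Lemma form_span (p : {poly k}) r : (size p <= r.+1)%N ->
  lspan (mset mon (dilate A [:: 0%R] r)) (x0 ^+ r * horner_alg lam p).
Proof.
have powD (v : U) i j w : lspan (mset mon A) v ->
    lspan (mset mon (dilate A [:: 0%R] j)) w ->
    lspan (mset mon (dilate A [:: 0%R] (i + j))) (v ^+ i * w).
  move=> vA wj; elim: i => [|i IH]; first by rewrite expr0 mul1r.
  rewrite exprS -mulrA addSn; apply: (lspan_mset_mul monD _ vA IH).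
  by move=> a m; exact: dilateS.
move=> pr; rewrite (horner_algE _ pr) mulr_sumr; apply: lspan_sum => i _.
rewrite -scalerAr; apply: lspanZ.
have ir : (i <= r)%N by rewrite -ltnS ltn_ord.
rewrite -{2}(subnK ir) exprD -mulrA -exprMn_comm; last exact: mulrC.
rewrite [x0 * lam]mulrC -x1E.
have -> : dilate A [:: 0%R] r = dilate A [:: 0%R] ((r - i) + (i + 0)).
  by rewrite addn0 subnK.
apply: (powD _ _ _ _ x0A); rewrite -[x1 ^+ i]mulr1; apply: (powD _ _ _ _ x1A).
by apply: lspan_mem; exists 0 => //=; rewrite mem_undup inE.
Qed.

(* The monomials [mons m] satisfy [y1 = lam y0] with [y0] and [y1] supported on
   [A]. Multiplication by [y1] and [y0] is thus a pencil between the spans of two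
   consecutive dilates, of ranks differing by at most [n0], so that its adjugate
   expresses every [mons m] through at most [n0] of them, with coefficients that
   are polynomials in [lam], hence in the functions of the first curve. *)
Lemma deg_tower u d : deg_le mon u d -> deg_le mon4 (u, 0) (n0 * d).
Proof.
move=> du F.
pose F2 := [seq m.2 | m <- F].
have [J hJ] := hA F2.
have [j hj] := @small_increment (fun j => rk (mset mons (dilate A F2 j))) _ _ _
  (sum_rk_dilate monsD A0 gA Auniq geq F2 J) hJ.
set Y0 := mset mons (dilate A F2 j) in hj; set Y1 := mset mons _ in hj.
have [su [suf su_size suY Ysu]] := rk_basis (finrk_mset mons (dilate A F2 j)).
have YA y v : lspan (mset mons A) y -> lspan Y0 v -> lspan Y1 (y * v).
  by move=> yA; apply: (lspan_mset_mul monsD _ yA) => a b; exact: dilateS.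
have y1_reg : regular y1.
  rewrite y1E; apply: regularM => //.
  have : ('X : {poly k}) != 0 by rewrite polyX_eq0.
  by move=> /lam_reg; rewrite horner_algX.
pose sv := [seq y1 * v | v <- su].
have svf : lfree sv.
  move=> c; rewrite size_map => h; apply: suf; apply: y1_reg.
  rewrite -[RHS]h mulr_sumr; apply: eq_bigr => i _.
  by rewrite (nth_map 0) // scalerAr.
have [v /mapP[w wu ->]|t [_ st tY Yt]] := basis_ext (finrk_mset mons (dilate A F2 j.+1)) svf.
  by apply: YA => //; exact: suY.
have tn0 : (size t <= n0)%N.
  by move: st; rewrite size_cat size_map su_size -/Y0 -/Y1; move: hj; lia.
set al := size su; set be := size t.
have /choice[c hc] : forall i : 'I_al, exists c : nat -> k, y0 * su`_i =
    \sum_(l < be) c l *: t`_l + \sum_(m < al) c (be + m)%N *: (y1 * su`_m).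
  move=> i; have : lspan Y1 (y0 * su`_i) by apply: YA => //; apply: suY; exact: mem_nth.
  move=> /(lspan_sub Yt)/spannedP[c ->]; exists c.
  rewrite size_cat size_map big_split_ord /=; congr (_ + _).
    by apply: eq_bigr => l _; rewrite nth_cat ltn_ord.
  apply: eq_bigr => m _; rewrite nth_cat ltnNge leq_addr addKn /=.
  by rewrite (nth_map 0).
(* Multiplication by [lam] turns [y0] into [y1], so that [hc] becomes a square linear system for the
   [y1 * su_i] over k[lam]. Its determinant is nonzero because it equals 1 at 0. *)
pose N : 'M[{poly k}]_al :=
  1%:M - 'X *: \matrix_(i, m) (c i (be + m)%N)%:P.
pose h := horner_alg lam.
have Nv (i : 'I_al) : \sum_m h (N i m) * (y1 * su`_m) = lam * \sum_(l < be) c i l *: t`_l.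
  have -> : \sum_(l < be) c i l *: t`_l =
      y0 * su`_i - \sum_(m < al) c i (be + m)%N *: (y1 * su`_m).
    by rewrite hc addrK.
  rewrite mulrBr mulrA -y1E mulr_sumr (bigD1 i) //= [X in _ = _ - X](bigD1 i) //=.
  rewrite opprD addrA; congr (_ + _).
    rewrite !mxE eqxx /h rmorphB rmorph1 rmorphM /= horner_algX horner_algC.
    by rewrite mulrBl mul1r -mulrA mulr_algl.
  rewrite -sumrN; apply: eq_bigr => m mi.
  rewrite !mxE eq_sym (negbTE mi) sub0r /h rmorphN rmorphM /= horner_algX.
  by rewrite horner_algC mulNr -mulrA mulr_algl.
pose kap (i : 'I_al) (l : nat) : {poly k} := \sum_m \adj N i m * 'X * (c m l)%:P.
have hkap (i : 'I_al) : h (\det N) * (y1 * su`_i) = \sum_(l < be) h (kap i l) * t`_l.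
  have -> : h (\det N) * (y1 * su`_i) = \sum_m h ((\adj N *m N) i m) * (y1 * su`_m).
    rewrite mul_adj_mx (bigD1 i) //= mxE eqxx big1 ?addr0 // => m mi.
    by rewrite mxE eq_sym (negbTE mi) mulr0n /h rmorph0 mul0r.
  transitivity (\sum_l h (\adj N i l) * (lam * \sum_(m < be) c l m *: t`_m)).
    under [RHS]eq_bigr => l _ do rewrite -Nv mulr_sumr.
    rewrite exchange_big; apply: eq_bigr => m _ /=.
    rewrite mxE /h rmorph_sum mulr_suml; apply: eq_bigr => l _.
    by rewrite rmorphM /= mulrA.
  under eq_bigr => l _ do rewrite mulrA mulr_sumr.
  rewrite exchange_big; apply: eq_bigr => l _ /=.
  rewrite /kap /h rmorph_sum mulr_suml; apply: eq_bigr => m _.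
  rewrite !rmorphM /= horner_algX horner_algC -[RHS]mulrA.
  by rewrite mulr_algl.
have det0 : \det N != 0.
  apply/eqP => /(congr1 (horner_eval 0)); rewrite -det_map_mx.
  have -> : map_mx (horner_eval 0) N = 1%:M.
    apply/matrixP => i m; rewrite !mxE /horner_eval hornerD hornerN hornerM hornerX.
    by rewrite mul0r subr0 -polyC_natr hornerC.
  by rewrite det1 /horner_eval horner0; apply/eqP; exact: oner_neq0.
(* [r] exceeds the degrees of the determinant and of all numerators, so that [x0 ^+ r] turns them
   into combinations of monomials of the first curve. *)
pose r := (size (\det N) + \sum_i \sum_(l < be) size (kap i l))%N.
pose th := x0 ^+ r * h (\det N).
have th_reg : regular th by apply: regularM; [exact: regularX|exact: lam_reg].
pose D := dilate A [:: 0%R] r.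
pose T := mulset t.
have thY1 v : lspan Y1 v -> lspan (T (mset mon D)) (th * v).
  move=> /(lspan_sub Yt); apply: lspanMl => w; rewrite /= mem_cat => /orP[wt|/mapP].
    rewrite mulrC; apply: lspanMl (_ : lspan (mset mon D) th).
      by move=> p pD; apply: lspan_mem; exists w => //; exists p.
    by apply: form_span; apply: leq_trans (leqnSn _); exact: leq_addr.
  case=> w' /(nthP 0)[i iu <-] ->; rewrite /th -mulrA (hkap (Ordinal iu)) mulr_sumr.
  apply: lspan_sum => l _; rewrite mulrA [_ * t`_l]mulrC.
  apply: lspanMl (_ : lspan (mset mon D) _).
    by move=> p pD; apply: lspan_mem; exists t`_l; [exact: mem_nth|exists p].
  apply: form_span; apply: leq_trans (leqnSn _); apply: leq_trans (leq_addl _ _).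
  rewrite (bigD1 (Ordinal iu)) //= (bigD1 l) //= -addnA; exact: leq_addr.
pose G := [seq m.1 + e | m <- F, e <- D].
have [C hC] := du G.
exists (n0 * C)%N => a.
have [a0 a0A] : exists a0, a0 \in A by case: (A) A0 => // a0 ? _; exists a0; rewrite mem_head.
(* The translation brings the second exponents into the dilate that spans [Y1]. Multiplication by
   [th] then leaves only elements of [t] times monomials of the first curve. *)
apply: leq_trans (rk_mset_shift mon40 mon4D _ (0, a0 *+ j.+1)) _.
apply: leq_trans (rk_regular_image (finrk_mset _ _) th_reg) _.
have [fT rkT] := rk_prod t (finrk_mset mon (ray u a G)).
apply: leq_trans (_ : (rk (T (mset mon (ray u a G))) <= _)%N); last first.
  apply: leq_trans rkT _; apply: leq_trans (leq_mul tn0 (hC a)) _.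
  by rewrite mulnDr mulnCA.
apply: rk_le => // _ [_ [_ /mapP[_ /rayP[i [m [ia mF ->]]] ->] <-] <-].
rewrite pair_mulrn mul0rn /mon4 /= !add0r mulrCA.
apply: lspanMl (thY1 (mons (a0 *+ j.+1 + m.2)) _); last first.
  by apply: lspan_mem; apply: mset_mem; apply: dilate_shift => //; exact: map_f.
move=> _ [v vt [_ [e eD <-] <-]]; apply: lspan_mem; rewrite mulrCA.
exists v => //; exists (mon (u *+ i + (m.1 + e))); last by rewrite addrA monD.
apply: mset_mem; apply/rayP; exists i, (m.1 + e); split => //.
exact: allpairs_f.
Qed.

End Tower.

(** * Germs *)

(* [germ k i0] is the ring of families, indexed by [I], of formal power series
   with coefficients in [k], multiplied pointwise; the point [i0] only ensures
   that the ring is nontrivial. *)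
Definition germ (k : fieldType) (I : Type) (i0 : I) : Type := I -> nat -> k.

Section GermRing.
Variables (k : fieldType) (I : Type) (i0 : I).
Notation G := (@germ k I i0).
Implicit Types u v w : G.

HB.instance Definition _ := gen_eqMixin G.
HB.instance Definition _ := gen_choiceMixin G.

Definition germ_zero : G := fun _ _ => 0.
Definition germ_opp u : G := fun i n => - u i n.
Definition germ_add u v : G := fun i n => u i n + v i n.
Definition germ_one : G := fun _ n => (n == 0%N)%:R.
Definition germ_mul u v : G := fun i n => \sum_(j < n.+1) u i j * v i (n - j)%N.
Definition germ_scale (c : k) u : G := fun i n => c * u i n.

Lemma germP u v : (forall i n, u i n = v i n) -> u = v.
Proof. by move=> h; apply: funext => i; apply: funext => n. Qed.

Fact germ_addA : associative germ_add.
Proof. by move=> u v w; apply: germP => i n; exact: addrA. Qed.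
Fact germ_addC : commutative germ_add.
Proof. by move=> u v; apply: germP => i n; exact: addrC. Qed.
Fact germ_add0 : left_id germ_zero germ_add.
Proof. by move=> u; apply: germP => i n; exact: add0r. Qed.
Fact germ_addN : left_inverse germ_zero germ_opp germ_add.
Proof. by move=> u; apply: germP => i n; exact: addNr. Qed.

HB.instance Definition _ :=
  GRing.isZmodule.Build G germ_addA germ_addC germ_add0 germ_addN.

(** The identities between products of series are checked on truncations, where they are identities
    between polynomials. *)
Definition trunc_poly N (a : nat -> k) : {poly k} := \poly_(j < N) a j.

Lemma germ_mulE N u v i n : (n < N)%N ->
  germ_mul u v i n = (trunc_poly N (u i) * trunc_poly N (v i))`_n.
Proof.
move=> nN; rewrite coefM; apply: eq_bigr => j _.
by rewrite !coef_poly (leq_ltn_trans (leq_subr _ _) nN) (leq_ltn_trans _ nN) // -ltnS.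
Qed.

Lemma coef_truncM N u v (w : nat -> k) i n : (n < N)%N ->
  \sum_(j < n.+1) germ_mul u v i j * w (n - j)%N =
  (trunc_poly N (u i) * trunc_poly N (v i) * trunc_poly N w)`_n.
Proof.
move=> nN; rewrite coefM; apply: eq_bigr => j _.
have jN : (j < N)%N by rewrite (leq_ltn_trans _ nN) // -ltnS.
by rewrite (germ_mulE _ _ _ jN) coef_poly (leq_ltn_trans (leq_subr _ _) nN).
Qed.

Fact germ_mulC : commutative germ_mul.
Proof.
by move=> u v; apply: germP => i n; rewrite !(germ_mulE _ _ _ (ltnSn n)) mulrC.
Qed.

Fact germ_mulA : associative germ_mul.
Proof.
move=> u v w; rewrite [germ_mul u _]germ_mulC; apply: germP => i n.
rewrite /germ_mul -/(germ_mul v w) !(coef_truncM _ _ _ _ (ltnSn n)).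
by rewrite mulrC mulrA.
Qed.

Fact germ_mul1 : left_id germ_one germ_mul.
Proof.
move=> u; apply: germP => i n; rewrite /germ_mul big_ord_recl subn0 mul1r.
by rewrite big1 ?addr0 // => j _; rewrite mul0r.
Qed.

Fact germ_mulDl : left_distributive germ_mul germ_add.
Proof.
move=> u v w; apply: germP => i n; rewrite /germ_mul /germ_add -big_split /=.
by apply: eq_bigr => j _; rewrite mulrDl.
Qed.

Fact germ_one_neq0 : germ_one != 0.
Proof.
apply/eqP => /(congr1 (fun u : G => u i0 0%N)) /eqP.
by rewrite /germ_one eqxx oner_eq0.
Qed.

HB.instance Definition _ := GRing.Zmodule_isComNzRing.Build G
  germ_mulA germ_mulC germ_mul1 germ_mulDl germ_one_neq0.

Fact germ_scaleA a b u : germ_scale a (germ_scale b u) = germ_scale (a * b) u.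
Proof. by apply: germP => i n; exact: mulrA. Qed.
Fact germ_scale1 : left_id 1 germ_scale.
Proof. by move=> u; apply: germP => i n; exact: mul1r. Qed.
Fact germ_scaleDr : right_distributive germ_scale +%R.
Proof. by move=> c u v; apply: germP => i n; exact: mulrDr. Qed.
Fact germ_scaleDl u : {morph germ_scale^~ u : a b / a + b}.
Proof. by move=> a b; apply: germP => i n; exact: mulrDl. Qed.

HB.instance Definition _ := GRing.Zmodule_isLmodule.Build k G
  germ_scaleA germ_scale1 germ_scaleDr germ_scaleDl.

Fact germ_scaleAl (c : k) u v : c *: (u * v) = (c *: u) * v.
Proof.
apply: germP => i n; rewrite [LHS]mulr_sumr; apply: eq_bigr => j _.
exact: mulrA.
Qed.

HB.instance Definition _ := GRing.Lmodule_isLalgebra.Build k G germ_scaleAl.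
HB.instance Definition _ := GRing.Lalgebra_isComAlgebra.Build k G.

Lemma germD u v i n : (u + v) i n = u i n + v i n. Proof. by []. Qed.
Lemma germN u i n : (- u) i n = - u i n. Proof. by []. Qed.
Lemma germZ (c : k) u i n : (c *: u) i n = c * u i n. Proof. by []. Qed.
Lemma germ0 i n : (0 : G) i n = 0. Proof. by []. Qed.
Lemma germ1 i n : (1 : G) i n = (n == 0%N)%:R. Proof. by []. Qed.
Lemma germC (c : k) i n : (c%:A : G) i n = if n == 0%N then c else 0.
Proof. by rewrite germZ germ1; case: eqP; rewrite ?mulr1 ?mulr0. Qed.

Lemma germ_sum (T : Type) (r : seq T) (P : pred T) (F : T -> G) i n :
  (\sum_(t <- r | P t) F t) i n = \sum_(t <- r | P t) F t i n.
Proof. by elim/big_rec2: _ => // t x y _ <-. Qed.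

Lemma germM u v i n : (u * v) i n = \sum_(j < n.+1) u i j * v i (n - j)%N.
Proof. by []. Qed.

Lemma germM_trunc u v i n :
  (u * v) i n = (trunc_poly n.+1 (u i) * trunc_poly n.+1 (v i))`_n.
Proof. exact: germ_mulE. Qed.

Lemma germM0 u v i : (u * v) i 0%N = u i 0%N * v i 0%N.
Proof. by rewrite germM big_ord1 subn0. Qed.

Lemma germM1 u v i : (u * v) i 1%N = u i 0%N * v i 1%N + u i 1%N * v i 0%N.
Proof. by rewrite germM !big_ord_recl big_ord0 addr0. Qed.

Definition vanish u i p := forall n, (n < p)%N -> u i n = 0.

Lemma vanishM u v i p q : vanish u i p -> vanish v i q ->
  vanish (u * v) i (p + q) /\ (u * v) i (p + q)%N = u i p * v i q.
Proof.
move=> up vq; split=> [n npq|].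
  rewrite germM big1 // => j _; have [jp|pj] := ltnP j p.
    by rewrite up ?mul0r.
  by rewrite vq ?mulr0 //; have := ltn_ord j; lia.
have pq : (p < (p + q).+1)%N by rewrite ltnS leq_addr.
rewrite germM (bigD1 (Ordinal pq)) //= addKn big1 ?addr0 // => j.
rewrite -val_eqE /= neq_ltn => /orP[jp|pj]; first by rewrite up ?mul0r.
by rewrite vq ?mulr0 //; have := ltn_ord j; lia.
Qed.

Lemma vanishMl u v i p : vanish v i p -> vanish (u * v) i p.
Proof.
move=> vp n np; rewrite germM big1 // => j _.
by rewrite vp ?mulr0 // (leq_ltn_trans (leq_subr _ _)).
Qed.

Lemma vanishX u i e : u i 0%N = 0 ->
  vanish (u ^+ e) i e /\ (u ^+ e) i e = u i 1%N ^+ e.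
Proof.
move=> u0; elim: e => [|e [IH1 IH2]]; first by split; rewrite ?expr0.
have u1 : vanish u i 1 by case.
by rewrite !exprS; have [h1 h2] := vanishM u1 IH1; rewrite -IH2.
Qed.

Lemma germ_order u i : u i <> (fun=> 0) ->
  exists2 p, vanish u i p & u i p != 0.
Proof.
move=> ui; have ex : exists p, u i p != 0.
  apply: contrapT => /forallNP h; apply: ui; apply: funext => n.
  by apply/eqP/negPn/negP; exact: h.
have [p up pmin] := ex_minnP ex; exists p => // n np; apply/eqP.
by apply: contraLR np => /pmin; rewrite -leqNgt.
Qed.

Lemma germ_integral u v i : (u * v) i = (fun=> 0) ->
  u i = (fun=> 0) \/ v i = (fun=> 0).
Proof.
move=> uv0; apply: contrapT => /not_orP[/germ_order[p up up0] /germ_order[q vq vq0]].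
have [_] := vanishM up vq; rewrite uv0 => /esym/eqP.
by rewrite mulf_eq0 (negbTE up0) (negbTE vq0).
Qed.

Lemma germ_regular u : (forall i, u i <> (fun=> 0)) -> regular u.
Proof.
move=> ui v uv; apply: germP => i n.
have : (u * v) i = (fun=> 0) by rewrite uv.
by case/germ_integral => [/ui//|->].
Qed.

Definition germ_deriv u : G := fun i n => n.+1%:R * u i n.+1.

Lemma germ_derivM u v :
  germ_deriv (u * v) = germ_deriv u * v + u * germ_deriv v.
Proof.
apply: germP => i n; pose N := n.+2.
have tE w : (trunc_poly N (w i))^`() = trunc_poly n.+1 (germ_deriv w i).
  apply/polyP => j; rewrite coef_deriv !coef_poly /N [(j.+1 < _)%N]ltnS.
  by case: ifP => _; rewrite ?mul0rn // /germ_deriv mulr_natl.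
have tr (w : nat -> k) m : (m <= n)%N -> (trunc_poly N w)`_m = (trunc_poly n.+1 w)`_m.
  by move=> mn; rewrite !coef_poly !ltnS mn leqW.
have -> : germ_deriv (u * v) i n =
    ((trunc_poly N (u i) * trunc_poly N (v i))^`())`_n.
  by rewrite coef_deriv -(germ_mulE u v i (ltnSn n.+1)) /germ_deriv mulr_natl.
rewrite derivM coefD !tE germD; congr (_ + _).
  rewrite germM_trunc !coefM; apply: eq_bigr => j _.
  by rewrite tr // leq_subr.
rewrite germM_trunc !coefM; apply: eq_bigr => j _.
by rewrite tr // -ltnS.
Qed.

Lemma germ_derivD u v : germ_deriv (u + v) = germ_deriv u + germ_deriv v.
Proof. by apply: germP => i n; exact: mulrDr. Qed.

Lemma germ_derivZ (c : k) u : germ_deriv (c *: u) = c *: germ_deriv u.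
Proof. by apply: germP => i n; exact: mulrCA. Qed.

Lemma germ_deriv_sum (T : Type) (r : seq T) (F : T -> G) :
  germ_deriv (\sum_(t <- r) F t) = \sum_(t <- r) germ_deriv (F t).
Proof.
apply: (big_morph germ_deriv germ_derivD).
by apply: germP => i n; exact: mulr0.
Qed.

(** Each coefficient of the inverse series depends on all the previous ones, so the recursion
    carries their list. *)
Fixpoint inv_coefs (a : nat -> k) n : seq k :=
  if n is m.+1 then
    let s := inv_coefs a m in
    rcons s (- (a 0%N)^-1 * \sum_(j < m.+1) a j.+1 * s`_(m - j))
  else [:: (a 0%N)^-1].

Lemma size_inv_coefs a n : size (inv_coefs a n) = n.+1.
Proof. by elim: n => //= n IH; rewrite size_rcons IH. Qed.

Lemma nth_inv_coefs a n j : (j <= n)%N -> (inv_coefs a n)`_j = (inv_coefs a j)`_j.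
Proof.
elim: n => [|n IH]; first by case: j.
rewrite leq_eqVlt => /orP[/eqP -> //|jn].
by rewrite /= nth_rcons size_inv_coefs jn; exact: IH.
Qed.

Lemma germ_inverse u : (forall i, u i 0%N != 0) -> exists v, u * v = 1.
Proof.
move=> u0; exists (fun i n => (inv_coefs (u i) n)`_n); apply: germP => i [|n].
  by rewrite germM0 /= divff.
rewrite germM big_ord_recl /= subn0 nth_rcons size_inv_coefs ltnn eqxx.
rewrite mulrA mulrN divff // mulN1r germ1 /=; apply/eqP; rewrite addrC subr_eq0.
apply/eqP; apply: eq_bigr => j _; rewrite /bump /= add1n subSS.
by rewrite (nth_inv_coefs _ (leq_subr j n)).
Qed.

End GermRing.

(** * Minimal relation between two functions *)

Section MinimalRelation.
Variables (k : numClosedFieldType) (U : comAlgType k) (Z W : U).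
Hypothesis Zreg : forall c : k, regular (Z - c%:A).

Lemma regular_horner (p : {poly k}) : p != 0 -> regular (horner_alg Z p).
Proof.
move=> p0; have [r ->] := closed_field_poly_normal p.
have lp : lead_coef p != 0 by rewrite lead_coef_eq0.
move=> v; rewrite -mul_polyC rmorphM /= horner_algC mulr_algl -scalerAl => /eqP.
rewrite scaler_eq0 (negbTE lp) /= => /eqP.
elim: r => [|c r IH]; first by rewrite big_nil rmorph1 mul1r.
by rewrite big_cons rmorphM /= horner_algX_XsubC -mulrA => /Zreg.
Qed.

(** [Rel] will be the set of relations on all germs, or of those on a single germ. *)
Lemma min_relation (Rel : set {poly {poly k}}) F : Rel F -> F != 0 ->
  exists2 P, Rel P /\ P != 0 &
    forall F', Rel F' -> F' != 0 -> (size P <= size F')%N.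
Proof.
move=> RF F0; have ex : exists n, `[< exists P, [/\ Rel P, P != 0 & size P = n] >].
  by exists (size F); apply/asboolP; exists F.
have [n /asboolP[P [RP P0 sP]] nmin] := ex_minnP ex.
exists P => // F' RF' F'0; rewrite sP; apply: nmin; apply/asboolP; by exists F'.
Qed.

(** Pseudo-division: [c] is a power of the leading coefficient of [P], and a nonzero remainder would
    be a relation of smaller degree. *)
Lemma min_relation_div (Rel : set {poly {poly k}}) P F :
  Rel F -> P != 0 -> Rel P ->
  (forall F', Rel F' -> F' != 0 -> (size P <= size F')%N) ->
  (forall c S F', Rel F' -> Rel (c *: F' - S * P)) ->
  exists c S, c != 0 /\ c *: F = S * P.
Proof.
move=> RF P0 RP Pmin Rlin.
have := Pdiv.Idomain.divp_eq F P; set c := _ ^+ _ => e.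
exists c, (F %/ P); split; first by rewrite expf_neq0 // lead_coef_eq0.
have [r0|r0] := eqVneq (F %% P) 0; first by rewrite e r0 addr0.
have : Rel (F %% P).
  have -> : F %% P = c *: F - (F %/ P) * P by rewrite e addrC addKr.
  exact: Rlin.
by move=> /Pmin /(_ r0); rewrite leqNgt Pdiv.Idomain.ltn_modpN0.
Qed.

Lemma XsubC_dvd (r : k) (S : {poly {poly k}}) :
  map_poly (horner_eval r) S = 0 -> exists S', S = ('X - r%:P)%:P * S'.
Proof.
move=> Sr; exists (map_poly (fun p => p %/ ('X - r%:P)) S); apply/polyP => i.
rewrite coefCM coef_map_id0 ?div0p // mulrC divpK // dvdp_XsubCl /root.
by have /(congr1 (fun p : {poly k} => p`_i)) := Sr; rewrite coef_map coef0 => /eqP.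
Qed.

(** Gauss's lemma, one root at a time: at a root [r] of [c] the product [S * P] vanishes but [P]
    does not, so that [X - r] cancels between [c] and [S]. Once [c] is constant, degrees in the
    inner variable add up. *)
Lemma sizeY_primitive (P S F : {poly {poly k}}) c : c != 0 -> F != 0 -> P != 0 ->
  (forall r : k, map_poly (horner_eval r) P != 0) ->
  c *: F = S * P -> (sizeY P <= sizeY F)%N.
Proof.
move=> c0 F0 P0 Pprim; move e: (size c) => n.
elim: n c c0 e S => [c c0 /eqP|n IH c c0 sc S]; first by rewrite size_poly_eq0 (negbTE c0).
have [n0|n0] := posnP n.
  move: sc; rewrite n0 => /eqP/size_poly1P[d d0 ->] eS.
  have S0 : S != 0.
    apply: contra_eq_neq eS => ->; rewrite mul0r scale_poly_eq0 negb_or F0.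
    by rewrite polyC_eq0 d0.
  have : sizeY (d%:P *: F) = sizeY (S * P) by rewrite eS.
  rewrite !sizeYE -mul_polyC !rmorphM /= swapXY_polyC map_polyC /=.
  rewrite size_Cmul ?polyC_eq0 // => ->.
  rewrite size_mul -?size_poly_eq0 -?sizeYE ?sizeY_eq0 //.
  by have := S0; rewrite -sizeY_eq0; case: (sizeY S) => // m _; rewrite addSn leq_addl.
have [r /eqP cr] : exists r, root c r by apply/closed_rootP; rewrite sc; lia.
move=> eS.
have : map_poly (horner_eval r) S = 0.
  apply/eqP; have /eqP := congr1 (map_poly (horner_eval r)) eS.
  rewrite -mul_polyC !rmorphM /= map_polyC /= {1}/horner_eval cr mul0r eq_sym.
  by rewrite mulf_eq0 (negbTE (Pprim r)) orbF.
move=> Sr.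
have [S' eS'] := XsubC_dvd Sr.
have /factor_theorem[c' ec] : root c r by rewrite /root cr.
have c'0 : c' != 0 by apply: contra_eq_neq ec => ->; rewrite mul0r.
apply: (IH c' c'0 _ S').
  by move: sc; rewrite ec size_Mmonic ?monicXsubC // size_XsubC addn2 => -[].
have x0 : ('X - r%:P)%:P != 0 :> {poly {poly k}} by rewrite polyC_eq0 polyXsubC_eq0.
apply: (mulfI x0); rewrite mulrA -eS' -eS ec -!mul_polyC mulrA -polyCM.
by rewrite [_ * c']mulrC.
Qed.

(** [P] is minimal in the outer degree, then in the inner one. A factor [X - r] of [P] could be
    removed, since [Z - r] is regular, which would contradict the second choice. *)
Lemma primitive_relation F0 : F0 != 0 -> ev2 Z W F0 = 0 ->
  exists P, [/\ P != 0, ev2 Z W P = 0,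
    forall F, ev2 Z W F = 0 -> F != 0 -> (size P <= size F)%N,
    forall F, ev2 Z W F = 0 -> exists c S, c != 0 /\ c *: F = S * P &
    forall r : k, map_poly (horner_eval r) P != 0].
Proof.
move=> F00 evF0.
pose Rel F := ev2 Z W F = 0.
have [P0 [RP0 P00] P0min] := @min_relation Rel F0 evF0 F00.
pose Rel' F := Rel F /\ size F = size P0.
have ex : exists n, `[< exists P, [/\ Rel' P, P != 0 & sizeY P = n] >].
  by exists (sizeY P0); apply/asboolP; exists P0.
have [n /asboolP[P [[RP sP] Pn0 sYP]] nmin] := ex_minnP ex.
have Pmin F : ev2 Z W F = 0 -> F != 0 -> (size P <= size F)%N.
  by move=> evF Fn0; rewrite sP; apply: P0min.
exists P; split => // [F evF|r].
  apply: (@min_relation_div Rel P F evF Pn0 RP Pmin).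
  move=> c S F' RF'; rewrite /Rel -mul_polyC -mulNr ev2D !ev2M RF' RP.
  by rewrite !mulr0 addr0.
apply/eqP => Pr.
have [P' eP] := XsubC_dvd Pr.
have x0 : ('X - r%:P)%:P != 0 :> {poly {poly k}} by rewrite polyC_eq0 polyXsubC_eq0.
have P'0 : P' != 0 by apply: contra_neq Pn0 => P'0; rewrite eP P'0 mulr0.
have RP' : ev2 Z W P' = 0.
  move: RP; rewrite /Rel eP ev2M ev2C horner_algX_XsubC => /Zreg.
  exact.
have sP' : size P' = size P by rewrite eP size_Cmul // polyXsubC_eq0.
have : (n <= sizeY P')%N.
  by apply: nmin; apply/asboolP; exists P'; split => //; split => //; rewrite sP'.
rewrite -sYP eP !sizeYE rmorphM /= swapXY_polyC size_mul; last 2 first.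
- by rewrite map_poly_eq0 polyXsubC_eq0.
- by rewrite -size_poly_eq0 -sizeYE sizeY_eq0.
rewrite map_polyXsubC size_XsubC -sizeYE; move: P'0; rewrite -sizeY_eq0; lia.
Qed.

(** Two relations, each small in one variable, are merged into one that is small in both: minimality
    bounds the degree in [W], and primitivity that in [Z]. *)
Lemma bidegree_relation (F1 F2 : {poly {poly k}}) :
  F1 != 0 -> ev2 Z W F1 = 0 -> F2 != 0 -> ev2 Z W F2 = 0 ->
  exists P, [/\ P != 0, ev2 Z W P = 0, (size P <= size F1)%N,
    (sizeY P <= sizeY F2)%N &
    forall F, ev2 Z W F = 0 -> F != 0 -> (size P <= size F)%N].
Proof.
move=> F10 evF1 F20 evF2.
have [P [P0 evP Pmin Pdiv Pprim]] := primitive_relation F10 evF1.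
exists P; split => //; first exact: Pmin.
by have [c [S [c0 eS]]] := Pdiv F2 evF2; exact: sizeY_primitive c0 F20 P0 Pprim eS.
Qed.

End MinimalRelation.

(** * Orders of vanishing along germs *)

Section Translation.
Variables (k : numClosedFieldType) (U : comAlgType k).
Implicit Types (Z W : U) (P : {poly {poly k}}).

(** P(X + a, Y + b), whose coefficients show the multiplicity of [P] at (a, b). *)
Definition translate (a b : k) P : {poly {poly k}} :=
  map_poly (comp_poly ('X + a%:P)) P \Po ('X + (b%:P)%:P).

Lemma ev2_translate Z W a b P :
  ev2 (Z - a%:A) (W - b%:A) (translate a b P) = ev2 Z W P.
Proof.
rewrite /ev2 /translate map_comp_poly horner_comp rmorphD /= map_polyX map_polyC /=.
rewrite hornerD hornerX hornerC horner_algC subrK -map_poly_comp.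
congr (_.[_]); apply: eq_map_poly => p /=.
rewrite comp_polyE rmorph_sum (horner_algE _ (leqnn (size p))).
apply: eq_bigr => i _; rewrite -mul_polyC rmorphM rmorphXn rmorphD /=.
by rewrite horner_algX !horner_algC subrK mulr_algl.
Qed.

End Translation.

Section GermEvaluation.
Variables (k : numClosedFieldType) (I : Type) (i0 : I).
Notation G := (@germ k I i0).
Implicit Types (u v Z W : G) (P F : {poly {poly k}}).

Lemma deriv_neq0 F : (1 < size F)%N -> F^`() != 0.
Proof.
move=> sF; have [n en] : exists n, size F = n.+2 by exists (size F).-2; lia.
apply/eqP => /(congr1 (fun p : {poly {poly k}} => p`_n)).
rewrite coef_deriv coef0 => /eqP; rewrite -mulr_natr mulf_eq0.
have -> : F`_n.+1 = lead_coef F by rewrite /lead_coef en.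
rewrite lead_coef_eq0 -size_poly_eq0 en /= -polyC_natr polyC_eq0.
by rewrite pnatr_eq0.
Qed.

(* If the derivative vanished on one branch, the minimal equation [F] of that
   branch would divide [P] twice, up to coefficients in [k[Z]]. *)
Lemma deriv_relation_regular Z W P : (forall i c, (Z - c%:A) i <> (fun=> 0)) ->
  P != 0 -> ev2 Z W P = 0 ->
  (forall F, ev2 Z W F = 0 -> F != 0 -> (size P <= size F)%N) ->
  regular (ev2 Z W P^`()).
Proof.
move=> Znc P0 evP Pmin; apply: germ_regular => i evQ.
have Zreg c : regular (Z - c%:A) by apply: germ_regular => j; exact: Znc.
have hreg := regular_horner Zreg.
pose Rel F := ev2 Z W F i = (fun=> 0).
have RelM F F' : Rel F' -> Rel (F * F').
  move=> h; rewrite /Rel ev2M; apply: funext => n.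
  rewrite germM big1 // => j _; by rewrite h mulr0.
have RelD F F' : Rel F -> Rel F' -> Rel (F + F').
  move=> h h'; rewrite /Rel ev2D; apply: funext => n.
  by rewrite germD h h' addr0.
have [F [RF F0] Fmin] := @min_relation _ Rel P (congr1 (fun u : G => u i) evP) P0.
have Rlin c S F' : Rel F' -> Rel (c *: F' - S * F).
  move=> h; apply: RelD; first by rewrite -mul_polyC; apply: RelM.
  by rewrite -mulNr; exact: RelM.
have [c [S [c0 eS]]] := min_relation_div (congr1 (fun u : G => u i) evP) F0 RF Fmin Rlin.
have hcn p : p != 0 -> horner_alg Z p i <> (fun=> 0).
  (* [e] is the idempotent of the germ [i], which [p(Z)] would annihilate. *)
  move=> p0 pi0; pose e : G := fun j n => if `[< j = i >] && (n == 0%N) then 1 else 0.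
  have pe0 : horner_alg Z p * e = 0.
    apply: germP => j n; rewrite germM big1 // => l _.
    have [->|ji] := pselect (j = i); first by rewrite pi0 mul0r.
    by rewrite /e asboolF // mulr0.
  have := congr1 (fun u : G => u i 0%N) (hreg p p0 e pe0) => /eqP.
  by rewrite /e asboolT //= oner_eq0.
have sF : (1 < size F)%N.
  rewrite ltnNge; apply/negP => sF1; have eF := size1_polyC sF1.
  move: RF; rewrite /Rel eF ev2C; apply: hcn; rewrite -polyC_eq0 -eF.
  exact: F0.
have dF0 := deriv_neq0 sF.
have ndF : ~ Rel F^`().
  by move=> /Fmin /(_ dF0); rewrite leqNgt lt_size_deriv.
(* In the derivative of [c *: P = S * F], the terms with the derivative of [P] and with [F] vanish
   on this germ. The derivative of [F] does not, as its degree is lower than that of [F]. *)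
have RS : Rel S.
  have e2 : c *: P^`() = S^`() * F + S * F^`() by rewrite -derivZ eS derivM.
  have : Rel (S * F^`()).
    have -> : S * F^`() = c *: P^`() - S^`() * F by rewrite e2 addrC addKr.
    exact: Rlin.
  by rewrite /Rel ev2M => h; case: (germ_integral h).
have [c2 [S2 [c20 eS2]]] := min_relation_div RS F0 RF Fmin Rlin.
have P0' : c2 * c *: P = S2 * F * F.
  by rewrite -scalerA eS scalerAl eS2.
(* The square of [S2 * F] is a multiple of [P], so [S2 * F] vanishes on every germ, although its
   degree is lower than that of [P]. *)
have FS2 : ev2 Z W (S2 * F) = 0.
  have : ev2 Z W (S2 * F) * ev2 Z W (S2 * F) = 0.
    rewrite -ev2M mulrACA [S2 * S2 * _]mulrC mulrA -[F * F * S2]mulrC mulrA -P0'.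
    by rewrite -mul_polyC -mulrA ev2M ev2M evP mul0r mulr0.
  move=> sq; apply: germP => j n.
  have : (ev2 Z W (S2 * F) * ev2 Z W (S2 * F)) j = (fun=> 0) by rewrite sq.
  by move=> h; case: (germ_integral h) => ->.
have FS2n0 : S2 * F != 0.
  apply: contra_eq_neq P0' => ->; rewrite mul0r scale_poly_eq0 negb_or P0.
  by rewrite mulf_neq0.
have := Pmin _ FS2 FS2n0.
have -> : size P = size (S2 * F * F) by rewrite -P0' size_scale // mulf_neq0.
rewrite (size_mul FS2n0 F0); move: FS2n0; rewrite -size_poly_gt0.
by move: sF; case: (size F) => [|[|m]] // _; case: (size (S2 * F)) => // m' _; lia.
Qed.

(** Along a germ through the origin, only the lowest form of [R] contributes to order [p], through
    the velocity of the germ. *)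
Lemma ev2_order u v i (R : {poly {poly k}}) p : u i 0%N = 0 -> v i 0%N = 0 ->
  (forall j l, (j + l < p)%N -> R`_l`_j = 0) ->
  vanish (ev2 u v R) i p /\ ev2 u v R i p =
    \sum_(l < p.+1) R`_l`_(p - l) * (u i 1%N ^+ (p - l) * v i 1%N ^+ l).
Proof.
move=> u0 v0 Rp.
pose N := maxn (size R) p.+1.
have evE n : ev2 u v R i n =
    \sum_(l < N) \sum_(j < maxn (size (R`_l)%R) p.+1) R`_l`_j * (u ^+ j * v ^+ l) i n.
  rewrite (@ev2E _ _ _ _ _ N) ?leq_maxl // germ_sum; apply: eq_bigr => l _.
  rewrite (@horner_algE _ _ _ _ (maxn (size (R`_l)%R) p.+1)) ?leq_maxl //.
  rewrite mulr_suml germ_sum; apply: eq_bigr => j _.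
  by rewrite -scalerAl germZ.
have term j l : vanish (u ^+ j * v ^+ l) i (j + l) /\
    (u ^+ j * v ^+ l) i (j + l)%N = u i 1%N ^+ j * v i 1%N ^+ l.
  have [h1 <-] := vanishX j u0; have [h2 <-] := vanishX l v0.
  exact: vanishM.
split=> [n np|].
  rewrite evE big1 // => l _; rewrite big1 // => j _.
  have [jl|jl] := ltnP (j + l) p; first by rewrite Rp ?mul0r.
  by rewrite (term j l).1 ?mulr0 // (leq_trans np).
rewrite evE (big_ord_widen N (fun l => R`_l`_(p - l) *
  (u i 1%N ^+ (p - l) * v i 1%N ^+ l))) ?leq_maxr // [RHS]big_mkcond /=.
apply: eq_bigr => l _; case: ifP => lp; last first.
  rewrite big1 // => j _; rewrite (term j l).1 ?mulr0 //; lia.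
have pl : (p - l < maxn (size (R`_l)%R) p.+1)%N by lia.
rewrite (bigD1 (Ordinal pl)) //= big1 ?addr0 => [|j].
  by have := (term (p - l)%N l).2; rewrite subnK // => ->.
rewrite -val_eqE /= => jp; have [jl|jl] := ltnP (j + l) p.
  by rewrite Rp ?mul0r.
by rewrite (term j l).1 ?mulr0 //; lia.
Qed.

End GermEvaluation.

(** * Counting nodes *)

(** Independent vectors are distinct points of the projective line, and a nonzero form of degree [m]
    has at most [m] zeros there. The polynomial [q] is the form in an affine chart. *)
Lemma binary_form_eq0 (k : fieldType) (s m : nat) (c : nat -> k) (al be : 'I_s -> k) :
  (m < s)%N -> (forall i j, i != j -> al i * be j != al j * be i) ->
  (forall i, \sum_(l < m.+1) c l * (al i ^+ (m - l) * be i ^+ l) = 0) ->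
  forall l, (l <= m)%N -> c l = 0.
Proof.
move=> ms ind csum.
pose q := \poly_(l < m.+1) c l.
suff q0 : q = 0.
  move=> l lm; have : q`_l = 0 by rewrite q0 coef0.
  by rewrite coef_poly ltnS lm.
have qroot i : al i != 0 -> root q (be i / al i).
  move=> ai; rewrite /root horner_poly.
  have am : al i ^+ m != 0 by rewrite expf_neq0.
  rewrite -(mulIr_eq0 _ (mulIf am)) mulr_suml; apply/eqP; rewrite -[RHS](csum i).
  apply: eq_bigr => l _; rewrite -mulrA; congr (_ * _).
  have lm : (l <= m)%N by rewrite -ltnS.
  have -> : al i ^+ m = al i ^+ (m - l) * al i ^+ l by rewrite -exprD subnK.
  by rewrite expr_div_n mulrCA mulfVK ?expf_neq0.
pose rs := [seq be i / al i | i <- enum 'I_s & al i != 0].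
have urs : uniq rs.
  rewrite map_inj_in_uniq; first by apply: filter_uniq; exact: enum_uniq.
  move=> i j.
  rewrite !mem_filter => /andP[ai _] /andP[aj _] e; apply/eqP.
  apply: contraT => /ind.
  have -> : be j = be i / al i * al j by rewrite e mulfVK.
  by rewrite mulrA [al i * _]mulrC mulfVK // mulrC eqxx.
have rsq : all (root q) rs.
  apply/allP => y; rewrite /rs => /mapP[i + ->].
  by rewrite mem_filter => /andP[ai _]; exact: qroot.
apply/eqP; apply: contraT => qn0; have := max_poly_roots qn0 rsq urs.
(* One vector may be the point at infinity. It gives no root of [q], but its equation kills the
   coefficient of degree [m], so that the number of roots and the degree drop together. *)
have [[i1 ai1]|an0] := pselect (exists i, al i = 0); last first.
  have -> : size rs = s.
    rewrite size_map (_ : [seq i <- _ | _] = enum 'I_s) ?size_enum_ord //.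
    by apply/all_filterP/allP => i _; apply/eqP => ai; apply: an0; exists i.
  by move=> /leq_trans/(_ (size_poly _ _)); rewrite ltnS leqNgt ms.
have sz : (s.-1 <= size rs)%N.
  rewrite size_map size_filter -[X in (X.-1 <= _)%N]card_ord (cardD1 i1) /=.
  rewrite -size_filter -sum1_size -sum1_card big_filter big_enum_cond /=.
  rewrite [X in (_ <= X)%N](eq_bigl (fun i => (i \in predT) && (al i != 0))) //.
  rewrite big_mkcond [X in (_ <= X)%N]big_mkcond; apply: leq_sum => i _.
  case: ifP => //; rewrite inE => /andP[ii1 _]; case: ifP => // /negbT.
  rewrite negbK => /eqP ai.
  by have := ind _ _ ii1; rewrite ai ai1 !mul0r eqxx.
have m0 : c m = 0.
  have [m0|mpos] := posnP m.
    by have := csum i1; rewrite m0 big_ord1 subn0 !expr0 !mulr1.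
  have [j ji1] : exists j, j != i1.
    have : (0 < #|predC1 i1|)%N by rewrite cardC1 card_ord; lia.
    by case/card_gt0P => j; exists j.
  have bi1 : be i1 != 0.
    by have := ind _ _ ji1; rewrite ai1 mul0r mulf_eq0 negb_or => /andP[].
  have := csum i1; rewrite big_ord_recr /= subnn expr0 mul1r big1 => [|l _].
    by rewrite add0r => /eqP; rewrite mulf_eq0 expf_eq0 (negbTE bi1) andbF orbF => /eqP.
  by rewrite ai1 expr0n subn_eq0 leqNgt ltn_ord mul0r mulr0.
have : (size q <= m)%N.
  apply/leq_sizeP => j mj; rewrite coef_poly; case: ifP => // jm.
  by have -> : j = m by apply/eqP; rewrite eqn_leq mj -ltnS jm.
by move=> h1 h2; have := leq_trans (leq_ltn_trans sz h2) h1; move: ms; clear; lia.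
Qed.

Section NodeCount.
Variables (k : numClosedFieldType) (K : finType) (s : nat) (i0 : K * 'I_s).
Notation G := (@germ k (K * 'I_s)%type i0).
Variables (M : zmodType) (mon : M -> G).
Hypothesis mon0 : mon 0 = 1.
Hypothesis monD : forall a b, mon (a + b) = mon a * mon b.
Variables (z1 z2 : M) (dZ dW : nat).
Let Z := mon z1.
Let W := mon z2.
Hypothesis degZ : deg_le mon z1 dZ.
Hypothesis degW : deg_le mon z2 dW.
Hypothesis Znc : forall i c, (Z - c%:A) i <> (fun=> 0).
Hypothesis Z0 : forall n j j', Z (n, j) 0%N = Z (n, j') 0%N.
Hypothesis W0 : forall n j j', W (n, j) 0%N = W (n, j') 0%N.
Hypothesis ZW1 : forall n j j', j != j' ->
  Z (n, j) 1%N * W (n, j') 1%N != Z (n, j') 1%N * W (n, j) 1%N.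
Variables (E1 : seq M) (l : G).
Hypothesis lE : lspan (mset mon E1) l.
Hypothesis l0 : forall i i', i != i' -> l i 0%N != l i' 0%N.
Hypothesis l1 : forall i, l i 1%N != 0.

Let Zreg c : regular (Z - c%:A).
Proof. by apply: germ_regular => i; exact: Znc. Qed.

(** By induction on the order [m]: once the lower terms at the node vanish, the form of degree [m]
    vanishes at the [s] velocities, hence is zero as long as [m < s]. *)
Lemma multiplicity_at_node P n j : ev2 Z W P = 0 -> forall a b,
  (a + b < s)%N ->
  (translate (Z (n, j) 0%N) (W (n, j) 0%N) P)`_b`_a = 0.
Proof.
move=> evP; set P' := translate _ _ P.
have trunc c i m : (0 < m)%N -> (c%:A : G) i m = 0 by case: m => // m _; rewrite germC.
suff h m : (m <= s)%N -> forall a b, (a + b < m)%N -> P'`_b`_a = 0 by exact: h.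
elim: m => // m IH ms a b; rewrite ltnS leq_eqVlt => /orP[/eqP abm|]; last first.
  exact: (IH (ltnW ms)).
pose u := Z - (Z (n, j) 0%N)%:A; pose v := W - (W (n, j) 0%N)%:A.
have := @binary_form_eq0 _ s m (fun b => P'`_b`_(m - b))
  (fun j' => Z (n, j') 1%N) (fun j' => W (n, j') 1%N) ms (ZW1 n).
have -> : P'`_b`_a = P'`_b`_(m - b) by rewrite -abm addnK.
move=> /(_ _ b); apply; last by rewrite -abm leq_addl.
move=> j'.
have u0 : u (n, j') 0%N = 0 by rewrite /u germD germN germC /= (Z0 n j' j) subrr.
have v0 : v (n, j') 0%N = 0 by rewrite /v germD germN germC /= (W0 n j' j) subrr.
have [_] := ev2_order u0 v0 (IH (ltnW ms)).
rewrite ev2_translate evP germ0 => e; rewrite -[RHS]/(0 : k) [RHS]e.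
by apply: eq_bigr => b' _; rewrite /u /v !germD !germN !germC !subr0.
Qed.

Lemma deriv_order P i : ev2 Z W P = 0 -> vanish (ev2 Z W P^`()) i s.-1.
Proof.
case: i => n j evP.
rewrite -(ev2_translate _ _ (Z (n, j) 0%N) (W (n, j) 0%N)).
set a := Z (n, j) 0%N; set b := W (n, j) 0%N.
have -> : translate a b P^`() = (translate a b P)^`().
  by rewrite /translate deriv_comp derivD derivX derivC addr0 mulr1 deriv_map.
apply: (ev2_order _ _ _).1 => [||p q pq].
- by rewrite germD germN germC /= subrr.
- by rewrite germD germN germC /= subrr.
rewrite coef_deriv coefMn multiplicity_at_node ?mul0rn //; lia.
Qed.

(** It provides the fixed set of exponents that makes room for the powers of [l] in every grid
    space. *)
Lemma powers_span n : exists E, forall e, (e < n)%N -> lspan (mset mon E) (l ^+ e).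
Proof.
elim: n => [|n [E hE]]; first by exists [::].
have [E' hE'] : exists E', lspan (mset mon E') (l ^+ n).
  elim: (n) => [|m [E' hE']].
    by exists [:: 0]; rewrite expr0 -mon0; apply: lspan_mem; exists 0; rewrite //= inE.
  exists [seq a + b | a <- E1, b <- E']; rewrite exprS.
  by apply: (lspan_mset_mul monD _ lE hE') => a b; exact: allpairs_f.
exists (E ++ E') => e; rewrite ltnS leq_eqVlt => /orP[/eqP ->|/hE].
  by apply: lspanS hE' => _ [m mE <-]; apply: mset_mem; rewrite mem_cat mE orbT.
by apply: lspanS => _ [m mE <-]; apply: mset_mem; rewrite mem_cat mE.
Qed.

(* Hermite interpolation at the distinct values of [l]. *)
Lemma jets_free t (p : {poly k}) : (size p <= #|K| * s * t)%N ->
  (forall i, vanish (horner_alg l p) i t) -> p = 0.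
Proof.
move=> sp pt; apply/eqP; apply: contraT => p0.
have dv i : ('X - (l i 0%N)%:P) ^+ t %| p.
  have [e [q]] := multiplicity_XsubC p (l i 0%N).
  rewrite p0 /= => qc ep.
  have [te|et] := leqP t e; first by rewrite ep dvdp_mull // dvdp_exp2l.
  pose c := l i 0%N.
  have lc0 : (l - c%:A) i 0%N = 0 by rewrite germD germN germC /= subrr.
  have [h1 h2] := vanishX e lc0.
  have hq : horner_alg l q i 0%N = q.[c].
    rewrite (horner_algE _ (leqnn _)) germ_sum horner_coef; apply: eq_bigr => j _.
    rewrite germZ; congr (_ * _); elim: (j : nat) => [|m IH]; first by rewrite !expr0.
    by rewrite !exprS germM0 IH.
  have : (horner_alg l p) i e != 0.
    rewrite ep rmorphM rmorphXn /= horner_algX_XsubC mulrC.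
    have q0 : vanish (horner_alg l q) i 0 by [].
    have [_] := vanishM h1 q0; rewrite addn0 => ->.
    rewrite h2 hq mulf_neq0 // expf_neq0 // germD germN germC subr0.
    exact: l1.
  by rewrite pt ?eqxx.
pose xs := enum {: K * 'I_s}.
have dvr r : uniq r -> \prod_(i <- r) ('X - (l i 0%N)%:P) ^+ t %| p.
  elim: r => [|i r IH]; first by rewrite big_nil dvd1p.
  move=> /= /andP[ir ur]; rewrite big_cons Gauss_dvdp ?dv ?IH //.
  apply: coprimep_expl; rewrite coprimep_sym coprimep_XsubC rootE horner_prod.
  rewrite prodf_seq_neq0; apply/allP => i' i'r /=.
  rewrite horner_exp hornerXsubC expf_neq0 // subr_eq0.
  by apply: l0; apply: contraNneq ir => ->.
have := dvdp_leq p0 (dvr _ (enum_uniq {: K * 'I_s})).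
have -> : size (\prod_(i <- enum {: K * 'I_s}) ('X - (l i 0%N)%:P) ^+ t) =
    (#|K| * s * t).+1.
  have -> : (#|K| * s)%N = size (enum {: K * 'I_s}) by rewrite -cardE card_prod card_ord.
  elim: (enum _) => [|i r IH]; first by rewrite big_nil size_poly1.
  have h1 : ('X - (l i 0%N)%:P) ^+ t != 0 by rewrite expf_neq0 // polyXsubC_eq0.
  have h2 : \prod_(i <- r) ('X - (l i 0%N)%:P) ^+ t \is monic.
    by apply: monic_prod => i' _; rewrite monic_exp // monicXsubC.
  rewrite big_cons (size_Mmonic h1 h2) size_exp_XsubC IH /=.
  by rewrite mulSn ?addSn ?addnS.
by rewrite ltnNge sp.
Qed.

(* The order of vanishing of [ev2 Z W P^`()] is at least [s - 1] at each of the
   [#|K| * s] germs; it is compared with the degree of this function through the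
   increments of the ranks of the multiples of the grid monomials. *)
Lemma node_count_rank : (#|K| * (s * s.-1) <= 2 * (dZ * dW))%N.
Proof.
(* A degree of at most [dZ] for [Z] yields a relation of degree at most [dZ] in [W], and
   symmetrically for [F2], as in [grid_rank]. *)
have [CZ hCZ] := degZ (ray z2 dZ [:: 0]).
have [F1 [F10 evF1 sF1 _]] : exists P : {poly {poly k}}, [/\ P != 0, ev2 Z W P = 0,
    (size P <= dZ.+1)%N & forall j, (size (P`_j)%R <= CZ.+1)%N].
  by apply: relation_exists => //; apply: leq_ltn_trans (hCZ CZ) _; lia.
have [CW hCW] := degW (ray z1 dW [:: 0]).
have [F2 [F20 evF2 _ sF2]] : exists P : {poly {poly k}}, [/\ P != 0, ev2 Z W P = 0,
    (size P <= CW.+1)%N & forall j, (size (P`_j)%R <= dW.+1)%N].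
  apply: relation_exists => //.
  apply: leq_ltn_trans (_ : (rk (mset mon (grid z2 z1 CW dW [:: 0%R])) < _)%N).
    apply: rk_mset_le => m /gridP[i [j [e [ia jb eE ->]]]].
    by apply/gridP; exists j, i, e; split => //; exact: addrCA.
  by apply: leq_ltn_trans (hCW CW) _; lia.
have sYF2 : (sizeY F2 <= dW.+1)%N by apply/bigmax_leqP => j _; exact: sF2.
have [P [P0 evP sP sYP Pmin]] := bidegree_relation Zreg F10 evF1 F20 evF2.
have Qreg := deriv_relation_regular Znc P0 evP Pmin.
have Qord i := deriv_order i evP.
pose q := ev2 Z W P^`().
have sQ : (size P^`() <= dZ.+1)%N.
  exact: leq_trans (ltnW (lt_size_deriv P0)) (leq_trans sP sF1).
have sYQ (j : nat) : (size (P^`()`_j)%R <= dW.+1)%N.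
  rewrite coef_deriv; apply: leq_trans (leq_trans sYP sYF2).
  by rewrite -scaler_nat; apply: leq_trans (size_scale_leq _ _) (max_size_coefXY _ _).
have [E0 hE0] := powers_span (#|K| * s * s.-1).
(* [P] has degree at most [dW] in [Z] and at most [dZ] in [W], so that multiplication by [q] maps
   the span of [X n] into that of [X n.+1]. *)
pose X n := mset mon (grid z1 z2 (n * dW) (n * dZ) E0).
have qX n v : X n v -> lspan (X n.+1) (q * v).
  case=> _ /gridP[i [j [e [ia jb eE ->]]]] <-.
  rewrite /q (ev2E _ _ sQ) mulr_suml; apply: lspan_sum => b _.
  rewrite -mulrA; apply: (lspan_horner (sYQ b)) => a adW; apply: lspan_mem.
  exists (z1 *+ (a + i) + (z2 *+ (b + j) + e)).
    apply/gridP; exists (a + i)%N, (b + j)%N, e; split => //.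
      by rewrite mulSn; apply: leq_add.
    by rewrite mulSn; apply: leq_add => //; rewrite -ltnS.
  rewrite !mulrnDr !monD !(monMn mon0 monD) -/Z -/W.
  ring.
(* All multiples of [q] vanish to order [s.-1] on every germ. By [jets_free], the powers of [l] with
   exponent below [#|K| * s * s.-1] are independent modulo them. *)
have step n : (rk (X n) + #|K| * s * s.-1 <= rk (X n.+1))%N.
  pose ls := [seq l ^+ e | e <- iota 0 (#|K| * s * s.-1)].
  have lsz : size ls = (#|K| * s * s.-1)%N by rewrite size_map size_iota.
  rewrite -{1}lsz; apply: leq_trans (leq_add (rk_regular_image (finrk_mset _ _) Qreg) (leqnn _)) _.
  apply: rk_free_mod; first exact: finrk_mset.
  - by move=> _ [v Xv <-]; exact: qX.
  - move=> _ /mapP[e + ->]; rewrite mem_iota add0n => /hE0 he.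
    move: he; apply: lspanS => _ [m mE <-]; apply: mset_mem.
    by apply/gridP; exists 0%N, 0%N, m; rewrite !mulr0n !add0r.
  - move=> c hc.
    have vR v : lspan ( *%R q @` X n) v -> forall i, vanish v i s.-1.
      elim=> [_ [w _ <-] i||d u w _ hu _ hw i] n' n's.
      + by rewrite mulrC; apply: vanishMl n's; exact: Qord.
      + by [].
      + by rewrite germD germZ hu // hw // mulr0 addr0.
    pose p := \poly_(e < #|K| * s * s.-1) c e.
    have p0 : p = 0.
      apply: (@jets_free s.-1); first exact: size_poly.
      suff -> : horner_alg l p = \sum_(i < size ls) c i *: ls`_i by exact: vR.
      rewrite (horner_algE _ (size_poly _ _)) lsz; apply: eq_bigr => i _.
      rewrite coef_poly ltn_ord (nth_map 0%N) ?size_iota // nth_iota ?add0n //.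
    move=> i; rewrite lsz => il.
    have : p`_i = 0 by rewrite p0 coef0.
    by rewrite coef_poly il.
have grow n : (n * (#|K| * s * s.-1) <= rk (X n))%N.
  elim: n => // n IH; rewrite mulSn; apply: leq_trans (step n).
  by rewrite addnC leq_add2r.
have [C hC] := grid_rank mon0 monD (sx := [::]) (fun c _ => @Zreg c) degZ degW E0.
(* An excess of one at each of [C.+1] steps would outgrow the constant [C]. *)
have := leq_trans (grow C.+1) (hC (C.+1 * dW)%N (C.+1 * dZ)%N).
have -> : (C.+1 * dW * dZ + C.+1 * dZ * dW = C.+1 * (2 * (dZ * dW)))%N.
  by rewrite -!mulnA [(dW * dZ)%N]mulnC mul2n -addnn mulnDr.
rewrite -mulnA; set T := (#|K| * _)%N; set D := (2 * _)%N => h.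
rewrite leqNgt; apply/negP => DT; move: h; rewrite leqNgt => /negP; apply.
apply: leq_trans (_ : (C.+1 * D.+1 <= _)%N); last by rewrite leq_mul2l DT orbT.
by rewrite mulnS addnC ltn_add2r.
Qed.

End NodeCount.

(** * Logarithmic derivatives of monomials *)

Lemma Z2_additive (V : zmodType) (phi : Z2 -> V) :
  (forall a b, phi (a + b) = phi a + phi b) ->
  forall u : Z2, phi u = phi e1 *~ u.1 + phi e2 *~ u.2.
Proof.
move=> phiD.
have phi0 : phi 0 = 0 by apply: (addrI (phi 0)); rewrite -phiD !addr0.
have phiN a : phi (- a) = - phi a.
  by apply: (addrI (phi a)); rewrite -phiD !subrr.
have phin a n : phi (a *+ n) = phi a *+ n.
  by elim: n => [|n IH]; rewrite ?mulr0n // !mulrS phiD IH.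
have phiz (a : Z2) (n : int) : phi (a *~ n) = phi a *~ n.
  case: n => n; first by rewrite -!pmulrn phin.
  by rewrite NegzE !mulrNz phiN -!pmulrn phin.
move=> u; rewrite -!phiz -phiD; congr phi.
case: u => u1 u2; rewrite /=.
have pz (a b n : int) : (a, b) *~ n = (a *~ n, b *~ n) :> Z2.
  case: n => n; first by rewrite -!pmulrn pair_mulrn.
  by rewrite NegzE !mulrNz -!pmulrn pair_mulrn.
by rewrite !pz !mul0rz; apply/eqP; rewrite xpair_eqE /=; apply/andP; split;
  rewrite ?addr0 ?add0r intz.
Qed.

Section LogDerivative.
Variables (k : fieldType) (I : Type) (i0 : I).
Notation G := (@germ k I i0).
Variable chi : Z2 -> G.
Hypothesis chi0 : chi 0 = 1.
Hypothesis chiD : forall a b, chi (a + b) = chi a * chi b.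

Definition dlog (u : Z2) : G := germ_deriv (chi u) * chi (- u).

Lemma chiVr u : chi u * chi (- u) = 1. Proof. by rewrite -chiD subrr. Qed.

Lemma germ_deriv_chi u : germ_deriv (chi u) = dlog u * chi u.
Proof. by rewrite /dlog -mulrA [chi (- u) * _]mulrC chiVr mulr1. Qed.

Lemma dlogE u : dlog u = dlog e1 *~ u.1 + dlog e2 *~ u.2.
Proof.
apply: Z2_additive => a b; rewrite /dlog chiD germ_derivM opprD chiD.
rewrite mulrDl; congr (_ + _).
  by rewrite mulrACA chiVr mulr1.
by rewrite mulrACA chiVr mul1r.
Qed.

Lemma chi_neq0 u i : chi u i 0%N != 0.
Proof.
apply/eqP => c0; have := congr1 (fun v : G => v i 0%N) (chiVr u).
by rewrite germM0 c0 mul0r germ1 => /eqP; rewrite eq_sym oner_eq0.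
Qed.

Lemma chi1E u i : chi u i 1%N = dlog u i 0%N * chi u i 0%N.
Proof.
by rewrite -germM0 -germ_deriv_chi /germ_deriv mul1r.
Qed.

Lemma germMz (v : G) (n : int) i m : (v *~ n) i m = n%:~R * v i m.
Proof.
have nat (p : nat) : (v *+ p) i m = p%:R * v i m.
  by elim: p => [|p IH]; rewrite ?mulr0n ?mul0r // !mulrS germD IH mulrDl mul1r.
case: n => n; first by rewrite -!pmulrn nat.
by rewrite NegzE !mulrNz germN -!pmulrn nat mulNr.
Qed.

Lemma germ_mulrz (v : G) (n : int) : v *~ n = n%:~R *: v.
Proof. by apply: germP => i m; rewrite germMz germZ. Qed.

(** The chain rule for [f] in logarithmic form: the two sums are [z * f_z] and [w * f_w], the
    components of the logarithmic Gauss map. *)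
Lemma dlog_relation (A : seq Z2) (f : Z2 -> k) :
  \sum_(a <- A) f a *: chi a = 0 ->
  dlog e1 * (\sum_(a <- A) (a.1%:~R * f a) *: chi a) +
  dlog e2 * (\sum_(a <- A) (a.2%:~R * f a) *: chi a) = 0.
Proof.
move/(congr1 (@germ_deriv _ _ _)); rewrite germ_deriv_sum => e.
have d0 : germ_deriv (0 : G) = 0 by apply: germP => i n; exact: mulr0.
rewrite d0 in e; rewrite -[RHS]e !mulr_sumr -big_split; apply: eq_bigr => a _ /=.
rewrite germ_derivZ germ_deriv_chi (dlogE a) !germ_mulrz mulrDl -!scalerAl scalerDr.
by rewrite -!scalerAr !scalerA ![f a * _]mulrC.
Qed.

End LogDerivative.

(** The powers up to [a] of the product lie in the a by a grid of the two factors, to which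
    [grid_rank] applies. The second factor is treated by exchanging the curves. *)
Lemma deg_diagonal (k : numClosedFieldType) (U : comAlgType k)
    (mon mons : Z2 -> U) (u : Z2) d (sx : seq k) :
  mon 0 = 1 -> (forall a b, mon (a + b) = mon a * mon b) ->
  mons 0 = 1 -> (forall a b, mons (a + b) = mons a * mons b) ->
  (forall c, c \notin sx -> regular (mon u - c%:A)) ->
  deg_le (mon4 mon mons) (u, 0) d -> deg_le (mon4 mons mon) (u, 0) d ->
  deg_le (mon4 mon mons) (u, u) (d + d).
Proof.
move=> mon0 monD mons0 monsD reg d1 d2 F.
have d2' : deg_le (mon4 mon mons) (0, u) d.
  move=> F'; pose sw (m : Z2 * Z2) := (m.2, m.1).
  have [C hC] := d2 (map sw F'); exists C => a; apply: leq_trans (hC a).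
  apply: rk_le; first exact: finrk_mset.
  move=> _ [_ /rayP[i [m [ia mF ->]]] <-]; apply: lspan_mem.
  exists ((u, 0) *+ i + sw m).
    by apply/rayP; exists i, (sw m); split => //; exact: map_f.
  by rewrite !pair_mulrn /mon4 /= mulrC.
have reg' c : c \notin sx -> regular (mon4 mon mons (u, 0) - c%:A).
  by rewrite /mon4 mons0 mulr1; exact: reg.
have [C hC] := grid_rank (mon40 mon0 mons0) (mon4D monD monsD) reg' d1 d2' F.
exists C => a; apply: leq_trans (_ : (a * d + a * d + C <= _)%N); last first.
  by rewrite mulnDr.
apply: leq_trans (hC a a); apply: rk_mset_le => m /rayP[i [m' [ia mF ->]]].
apply/gridP; exists i, i, m'; split => //.
by rewrite addrA -mulrnDl; congr (_ *+ _ + _); apply/eqP; rewrite xpair_eqE /= addr0 add0r !eqxx.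
Qed.

(** * The bound for a family of germs *)

Section AlgebraicBound.
Variables (k : numClosedFieldType) (K : finType) (s : nat) (i0 : K * 'I_s).
Notation G := (@germ k (K * 'I_s)%type i0).
Variables (mon mons : Z2 -> G).
Hypothesis mon0 : mon 0 = 1.
Hypothesis monD : forall a b, mon (a + b) = mon a * mon b.
Hypothesis mons0 : mons 0 = 1.
Hypothesis monsD : forall a b, mons (a + b) = mons a * mons b.
Variables (A : seq Z2) (f g : Z2 -> k) (n0 : nat).
Hypothesis A0 : A != [::].
Hypothesis fA : forall a, a \in A -> f a != 0.
Hypothesis gA : forall a, a \in A -> g a != 0.
Hypothesis Auniq : uniq A.
Hypothesis feq : \sum_(a <- A) f a *: mon a = 0.
Hypothesis geq : \sum_(a <- A) g a *: mons a = 0.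
Hypothesis hA : area_bound A n0.

(** The Gauss maps are [X1 : X0] and [Y1 : Y0]. They are equated through [lam], their common value
    in the coordinate [X1 / (X0 + th X1)], in which no germ has its value at infinity when [th] is
    suitable. *)
Let X1 := \sum_(a <- A) (a.1%:~R * f a) *: mon a.
Let X0 := \sum_(a <- A) (a.2%:~R * f a) *: mon a.
Let Y1 := \sum_(a <- A) (a.1%:~R * g a) *: mons a.
Let Y0 := \sum_(a <- A) (a.2%:~R * g a) *: mons a.

Variables (th : k) (lam : G).
Hypothesis X_reg : regular (X0 + th *: X1).
Hypothesis Y_reg : regular (Y0 + th *: Y1).
Hypothesis X1E : X1 = lam * (X0 + th *: X1).
Hypothesis Y1E : Y1 = lam * (Y0 + th *: Y1).
Hypothesis lam_nc : forall i c, (lam - c%:A) i <> (fun=> 0).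

Let ZZ (u : Z2) : G := mon u * mons u.
Hypothesis s2 : (2 <= s)%N.
Hypothesis ZZ0 : forall u n j j', ZZ u (n, j) 0%N = ZZ u (n, j') 0%N.
Hypothesis ZZ1 : forall n j j', j != j' ->
  ZZ e1 (n, j) 1%N * ZZ e2 (n, j') 1%N != ZZ e1 (n, j') 1%N * ZZ e2 (n, j) 1%N.
Variables (E1 : seq (Z2 * Z2)) (l : G).
Hypothesis lE : lspan (mset (mon4 mon mons) E1) l.
Hypothesis l0 : forall i i', i != i' -> l i 0%N != l i' 0%N.
Hypothesis l1 : forall i, l i 1%N != 0.
Variables (u1 u2 : Z2) (d1 d2 : nat).
Hypothesis u12 : u1.1 * u2.2 - u1.2 * u2.1 != 0.
Hypothesis du1 : deg_le mon u1 d1.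
Hypothesis du2 : deg_le mon u2 d2.
Hypothesis dus1 : deg_le mons u1 d1.
Hypothesis dus2 : deg_le mons u2 d2.

Let ZZ_0 : ZZ 0 = 1. Proof. by rewrite /ZZ mon0 mons0 mulr1. Qed.

Let ZZD a b : ZZ (a + b) = ZZ a * ZZ b.
Proof. by rewrite /ZZ monD monsD mulrACA. Qed.

Let dlogZZ u : dlog ZZ u = dlog mon u + dlog mons u.
Proof.
rewrite /dlog /ZZ germ_derivM mulrDl.
rewrite mulrACA chiVr // mulr1; congr (_ + _).
by rewrite mulrACA chiVr // mul1r.
Qed.

Let chi1ZZ u i : ZZ u i 1%N =
  (u.1%:~R * dlog ZZ e1 i 0%N + u.2%:~R * dlog ZZ e2 i 0%N) * ZZ u i 0%N.
Proof. by rewrite chi1E // dlogE // germD !germMz. Qed.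

Lemma log_direction_det n j j' : j != j' ->
  dlog ZZ e1 (n, j) 0%N * dlog ZZ e2 (n, j') 0%N -
  dlog ZZ e1 (n, j') 0%N * dlog ZZ e2 (n, j) 0%N != 0.
Proof.
move=> /(ZZ1 n); apply: contra_neq => /eqP; rewrite subr_eq0 => /eqP e.
rewrite !(chi1E ZZ_0 ZZD) (ZZ0 e1 n j' j) (ZZ0 e2 n j' j).
by rewrite mulrACA e mulrACA.
Qed.

(** If [ZZ u] were constant, its logarithmic derivative [(u.1 - c0 lam) * S] would vanish, hence [S]
    would, as [lam] is not constant. Then both logarithmic velocities are zero, against their
    independence from those of another germ at the same node. *)
Lemma monomial_nonconstant u i c : u != 0 -> (ZZ u - c%:A) i <> (fun=> 0).
Proof.
move=> u0 Zi; have dZ : dlog ZZ u i = (fun=> 0).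
  have : (dlog ZZ u * ZZ u) i = (fun=> 0).
    rewrite -germ_deriv_chi //; apply: funext => n; rewrite /germ_deriv.
    have := congr1 (fun v => v n.+1) Zi; rewrite germD germN germC subr0 => ->.
    by rewrite mulr0.
  move=> h; case: (germ_integral h) => // z.
  by have := chi_neq0 ZZ_0 ZZD u i; rewrite z eqxx.
pose P := dlog ZZ e1; pose Q := dlog ZZ e2.
pose S := P - th *: Q.
(* The chain rule on each curve, divided by the denominator of [lam], is a linear equation with the
   same coefficients on both; the two equations add up to one for [ZZ]. *)
have lamS : lam * S + Q = 0.
  have rel X0' X1' D1 D2 : regular (X0' + th *: X1') ->
      X1' = lam * (X0' + th *: X1') -> D1 * X1' + D2 * X0' = 0 ->
      lam * (D1 - th *: D2) + D2 = 0.
    move=> reg e h; apply: reg; rewrite mulrDr mulrA [_ * lam]mulrC -e.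
    rewrite -[RHS]h mulrBr mulrDl -!scalerAl -!scalerAr.
    by rewrite [X1' * D1]mulrC [X1' * D2]mulrC [X0' * D2]mulrC addrAC -addrA addrK addrC; ring.
  have r1 := rel _ _ _ _ X_reg X1E (dlog_relation mon0 monD feq).
  have r2 := rel _ _ _ _ Y_reg Y1E (dlog_relation mons0 monsD geq).
  rewrite /S /P /Q !dlogZZ scalerDr opprD addrACA mulrDr addrACA.
  by rewrite r1 r2 addr0.
have QE : Q = - (lam * S) by apply/eqP; rewrite -addr_eq0 addrC lamS.
have PE : P = S + th *: Q by rewrite /S subrK.
have Si : S i = (fun=> 0).
  pose c0 : k := u.1%:~R * th + u.2%:~R.
  have e : dlog ZZ u = (u.1%:~R%:A - c0 *: lam) * S.
    rewrite dlogE // -/P -/Q PE QE.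
    rewrite !germ_mulrz mulrBl mulr_algl -scalerAl /c0 scalerDl scalerDr scalerA.
    by rewrite !scalerN opprD addrA.
  have : ((u.1%:~R%:A - c0 *: lam) * S) i = (fun=> 0) by rewrite -e.
  move=> h; case: (germ_integral h) => // h'; exfalso.
  have [c00|c00] := eqVneq c0 0.
    have u10 : u.1 = 0.
      have := congr1 (fun v => v 0%N) h'; rewrite c00 scale0r subr0 germC /=.
      by move/eqP; rewrite intr_eq0 => /eqP.
    move: c00; rewrite /c0 u10 mul0r add0r => /eqP; rewrite intr_eq0 => /eqP u20.
    by move/eqP: u0; apply; apply/eqP; rewrite [u]surjective_pairing xpair_eqE u10 u20 eqxx.
  apply: (lam_nc (i := i) (c := c0^-1 * u.1%:~R)); apply: funext => n.
  have := congr1 (fun v => v n) h'; rewrite !germD !germN !germC germZ /= => h1.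
  apply: (mulfI c00); rewrite mulr0 mulrBr; move: h1; case: eqP => _ /eqP.
    by rewrite mulVKf // subr_eq0 eq_sym -subr_eq0 => /eqP.
  by rewrite sub0r oppr_eq0 mulr0 subr0 => /eqP.
have Qi : Q i 0%N = 0 by rewrite QE germN germM0 Si mulr0 oppr0.
have Pi : P i 0%N = 0 by rewrite PE germD germZ Qi Si mulr0 addr0.
case: i Qi Pi {Zi dZ Si} => n j Qi Pi.
have [j' jj'] : exists j', j != j'.
  have : (0 < #|predC1 j|)%N by rewrite cardC1 card_ord; lia.
  by case/card_gt0P => j' ?; exists j'; rewrite eq_sym.
by have := log_direction_det n jj'; rewrite -/P -/Q Qi Pi !mul0r mulr0 subrr eqxx.
Qed.

Lemma regular_off_values (v : G) : exists sx : seq k,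
  forall c, c \notin sx -> regular (v - c%:A).
Proof.
exists [seq v i 0%N | i <- enum {: K * 'I_s}] => c cv; apply: germ_regular => i.
move/(congr1 (fun v => v 0%N)) => /eqP; rewrite germD germN germC /= subr_eq0.
by move=> /eqP e; move/negP: cv; apply; rewrite -e; apply: map_f; rewrite mem_enum.
Qed.

Lemma diag_deg u d : deg_le mon u d -> deg_le mons u d ->
  deg_le (mon4 mon mons) (u, u) (n0 * d + n0 * d).
Proof.
have span (chi : Z2 -> G) (h : Z2 -> k) t :
    lspan (mset chi A) (\sum_(a <- A) (a.2%:~R * h a) *: chi a +
      t *: \sum_(a <- A) (a.1%:~R * h a) *: chi a).
  apply: lspanD; last apply: lspanZ; rewrite big_seq; apply: lspan_sum => a aA;
    by apply: lspanZ; apply: lspan_mem; apply: mset_mem.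
have span1 (chi : Z2 -> G) (h : Z2 -> k) :
    lspan (mset chi A) (\sum_(a <- A) (a.1%:~R * h a) *: chi a).
  rewrite big_seq; apply: lspan_sum => a aA.
  by apply: lspanZ; apply: lspan_mem; apply: mset_mem.
have lam_reg p : p != 0 -> regular (horner_alg lam p).
  by apply: regular_horner => c; apply: germ_regular => i; exact: lam_nc.
move=> du dus; have [sx hsx] := regular_off_values (mon u).
apply: (deg_diagonal mon0 monD mons0 monsD hsx).
  exact: (deg_tower mon0 monD mons0 monsD A0 gA Auniq geq hA (span _ _ _) (span1 _ _)
    (span _ _ _) (span1 _ _) X1E Y1E X_reg Y_reg lam_reg du).
exact: (deg_tower mons0 monsD mon0 monD A0 fA Auniq feq hA (span _ _ _) (span1 _ _)
    (span _ _ _) (span1 _ _) Y1E X1E Y_reg X_reg lam_reg dus).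
Qed.

Lemma algebraic_bound :
  (#|K| * (s * s.-1) <= 2 * ((2 * n0 * d1) * (2 * n0 * d2)))%N.
Proof.
have dd n d : (2 * n * d = n * d + n * d)%N by rewrite mul2n -addnn mulnDl.
rewrite !dd.
have u10 : u1 != 0 by apply: contra_neq u12 => ->; rewrite !mul0r subrr.
have ZZE u : mon4 mon mons (u, u) = ZZ u by [].
apply: (node_count_rank (mon40 mon0 mons0) (mon4D monD monsD)
  (diag_deg du1 dus1) (diag_deg du2 dus2) _ _ _ _ lE l0 l1) => //.
- by move=> i c; rewrite ZZE; exact: monomial_nonconstant.
- by move=> n j j'; rewrite !ZZE; exact: ZZ0.
- by move=> n j j'; rewrite !ZZE; exact: ZZ0.
(* Passing from [e1], [e2] to [u1], [u2] multiplies the determinant of the logarithmic velocities by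
   that of [u1], [u2]. *)
move=> n j j' jj'; rewrite !ZZE !chi1ZZ (ZZ0 u1 n j' j) (ZZ0 u2 n j' j).
rewrite -subr_eq0 mulrACA [X in _ - X]mulrACA -mulrBl mulf_neq0 //; last first.
  by rewrite mulf_neq0 // chi_neq0.
move: (log_direction_det n jj').
set p := dlog ZZ e1 (n, j) 0%N; set q := dlog ZZ e2 (n, j) 0%N.
set p' := dlog ZZ e1 (n, j') 0%N; set q' := dlog ZZ e2 (n, j') 0%N => pq.
have -> : (u1.1%:~R * p + u1.2%:~R * q) * (u2.1%:~R * p' + u2.2%:~R * q') -
    (u1.1%:~R * p' + u1.2%:~R * q') * (u2.1%:~R * p + u2.2%:~R * q) =
    (u1.1%:~R * u2.2%:~R - u1.2%:~R * u2.1%:~R) * (p * q' - p' * q) by ring.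
by rewrite mulf_neq0 // -!intrM -intrB intr_eq0.
Qed.

End AlgebraicBound.

(** * Convex hulls and areas *)

Section Hull.
Variable R : realType.
Implicit Types (S C : set (R * R)) (t : R).

Lemma hull_sub S : S `<=` hull S.
Proof. exact: sub_gen_smallest. Qed.

Lemma hull_conv S x y t : 0 <= t -> t <= 1 -> hull S x -> hull S y ->
  hull S (t *: x + (1 - t) *: y).
Proof.
move=> t0 t1 hx hy C [Cc SC].
have xC : x \in C by apply/mem_set; apply: hx.
have yC : y \in C by apply/mem_set; apply: hy.
have := Cc x y (Itv01 t0 t1) xC yC.
by move=> /set_mem.
Qed.

Lemma hull_min S C : (forall x y t, 0 <= t -> t <= 1 -> C x -> C y ->
  C (t *: x + (1 - t) *: y)) -> S `<=` C -> hull S `<=` C.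
Proof.
move=> Cc; apply: smallest_sub => x y t /set_mem xC /set_mem yC; apply/mem_set.
exact: Cc.
Qed.

Lemma hull_halfplane S (a b c : R) :
  (forall u, S u -> a * u.1 + b * u.2 <= c) ->
  forall u, hull S u -> a * u.1 + b * u.2 <= c.
Proof.
move=> h; apply: (hull_min (C := [set u | a * u.1 + b * u.2 <= c])) => //.
move=> x y t t0 t1 /= hx hy.
have t1' : 0 <= 1 - t by rewrite subr_ge0.
have := lerD (ler_wpM2l t0 hx) (ler_wpM2l t1' hy).
rewrite -mulrDl [t + _]addrC subrK mul1r; apply: le_trans; rewrite le_eqVlt; apply/orP; left.
by apply/eqP; rewrite /GRing.scale /=; ring.
Qed.

Lemma hull_sum S n (c : nat -> R) (p : nat -> R * R) :
  (forall i, (i < n)%N -> 0 <= c i) -> (forall i, (i < n)%N -> hull S (p i)) ->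
  0 < \sum_(i < n) c i ->
  hull S ((\sum_(i < n) c i)^-1 *: \sum_(i < n) c i *: p i).
Proof.
elim: n => [|n IH] c0 Sp; first by rewrite big_ord0 ltxx.
rewrite !big_ord_recr /=; set W := \sum_(i < n) c i; set T := \sum_(i < n) _ *: _.
have W0 : 0 <= W by apply: sumr_ge0 => i _; apply: c0; rewrite ltnS ltnW.
have cn := c0 n (ltnSn n); have pn := Sp n (ltnSn n).
have [We|Wn] := eqVneq W 0.
  move=> cpos; have -> : T = 0.
    rewrite /T big1 // => i _; have /eqP := We; rewrite psumr_eq0 => [|j _].
      by move/allP/(_ i (mem_index_enum _)) => /eqP ->; rewrite scale0r.
    by apply: c0; rewrite ltnS ltnW.
  rewrite We !add0r scalerA mulVf ?scale1r //.
  by move: cpos; rewrite We add0r => /gt_eqF ->.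
have Wpos : 0 < W by rewrite lt_neqAle eq_sym Wn.
move=> cpos.
have -> : (W + c n)^-1 *: (T + c n *: p n) =
    (W / (W + c n)) *: (W^-1 *: T) + (1 - W / (W + c n)) *: p n.
  rewrite scalerDr !scalerA; congr (_ *: _ + _ *: _).
    by rewrite mulrC mulrA mulVf // mul1r.
  by field; rewrite gt_eqF.
apply: hull_conv => //.
- by rewrite divr_ge0 // ltW.
- by rewrite ler_pdivrMr // mul1r lerDl.
- by apply: IH => // i i_n; [apply: c0|apply: Sp]; rewrite ltnS ltnW.
Qed.

(** The hull is the image of the standard simplex, which is compact, under barycentric
    coordinates. *)
Lemma closed_hull_seq (s : seq (R * R)) : closed (hull [set p | p \in s]).
Proof.
pose n := size s.
pose F (v : 'rV[R]_n) : R * R := \sum_(i < n) v ord0 i *: s`_i.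
pose D := [set v : 'rV[R]_n | (forall i, `[0, 1]%classic (v ord0 i)) /\
                              \sum_(i < n) v ord0 i = 1].
have -> : hull [set p | p \in s] = F @` D.
  apply/seteqP; split.
    apply: hull_min => [x y t t0 t1 [v [v01 v1] <-] [w [w01 w1] <-]|p /= ps].
      exists (t *: v + (1 - t) *: w); first split.
      + move=> i; move: (v01 i) (w01 i); rewrite /= !in_itv /= !mxE.
        move=> /andP[v0 v1'] /andP[w0 w1']; apply/andP; split; nra.
      + under eq_bigr => i _ do rewrite !mxE.
        by rewrite big_split -!mulr_sumr v1 w1 !mulr1 /= [t + _]addrC subrK.
      + rewrite /F !scaler_sumr -big_split; apply: eq_bigr => i _.
        by rewrite !mxE [LHS]scalerDl -!scalerA.
    have ip : (index p s < n)%N by rewrite index_mem.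
    exists (delta_mx ord0 (Ordinal ip)); first split.
    + move=> i; rewrite /= in_itv /= mxE eqxx /=.
      by case: eqP; rewrite ?lexx ler01.
    + rewrite (bigD1 (Ordinal ip)) //= mxE !eqxx big1 ?addr0 // => i /negbTE ii.
      by rewrite mxE ii andbF.
    + rewrite /F (bigD1 (Ordinal ip)) //= mxE !eqxx scale1r nth_index //.
      rewrite big1 ?addr0 // => i /negbTE ii.
      by rewrite mxE ii andbF scale0r.
  move=> _ [v [v01 v1] <-].
  pose c i := if insub i is Some j then v ord0 (j : 'I_n) else 0.
  have cE (i : 'I_n) : c i = v ord0 i by rewrite /c valK.
  have -> : F v = (\sum_(i < n) c i)^-1 *: \sum_(i < n) c i *: s`_i.
    under eq_bigr => i _ do rewrite cE.
    under [X in _ *: X]eq_bigr => i _ do rewrite cE.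
    by rewrite v1 invr1 scale1r.
  apply: (hull_sum (n := n)).
  - move=> i i_n; rewrite (cE (Ordinal i_n)).
    by move: (v01 (Ordinal i_n)); rewrite /= in_itv /= => /andP[].
  - by move=> i i_n; apply: hull_sub; rewrite /= mem_nth.
  - by under eq_bigr => i _ do rewrite cE; rewrite v1 ltr01.
apply: compact_closed; first exact: norm_hausdorff.
have Fc : continuous F.
  apply: continuous_big => [|i _ v]; first exact: add_continuous.
  have h := @coord_continuous R 1 n ord0 i v.
  exact: (@cvgZr_tmp _ _ _ _ _ _ _ s`_i h).
apply: continuous_compact; first exact: continuous_subspaceT.
have : compact [set v : 'rV[R]_n | forall i, `[0, 1]%classic (v ord0 i)].
  apply: (@rV_compact R n (fun=> `[0, 1]%classic)) => i.
  exact: segment_compact.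
move=> cK; apply: (subclosed_compact _ cK) => [|v []//].
have -> : D = [set v : 'rV[R]_n | forall i, `[0, 1]%classic (v ord0 i)] `&`
    (fun v : 'rV[R]_n => \sum_(i < n) v ord0 i) @^-1` [set 1].
  by apply/seteqP; split => v.
apply: closedI.
  apply: compact_closed; first exact: norm_hausdorff.
  apply: (@rV_compact R n (fun=> `[0, 1]%classic)) => i.
  exact: segment_compact.
apply: closed_comp; last exact: closed_eq.
move=> v _; apply: continuous_big => [|i _ w]; first exact: add_continuous.
exact: (@coord_continuous R 1 n ord0 i w).
Qed.
End Hull.

(** * Lattice points and area *)

Section LatticeCount.
Variable R : realType.
Variable Delta : set (R * R).
Hypothesis Dclosed : closed Delta.
Variable N : R.
Hypothesis Dbnd : forall v, Delta v -> `|v.1| <= N /\ `|v.2| <= N.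
Variable c : nat.
Hypothesis c1 : (1 <= c)%N.

Let mu2 := ((@lebesgue_measure R \x @lebesgue_measure R)%E).

Definition cell (J : nat) (m : Z2) : set (R * R) :=
  `[m.1%:~R / J%:R, (m.1%:~R + 1) / J%:R[%classic `*`
  `[m.2%:~R / J%:R, (m.2%:~R + 1) / J%:R[%classic.

(** The margin [c / J] absorbs the fixed set [F] of a dilate, which shrinks at this rate when the
    dilate is scaled by [1 / J]. *)
Definition near_cell (J : nat) (m : Z2) := exists2 v, Delta v &
  `|m.1%:~R / J%:R - v.1| <= c%:R / J%:R /\
  `|m.2%:~R / J%:R - v.2| <= c%:R / J%:R.

Definition cells (J : nat) : set (R * R) :=
  [set p | exists2 m, near_cell J m & cell J m p].

(** The sets [cells J] need not decrease with [J], but their tail unions do. These are measurable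
    with intersection [Delta], so that the area of [Delta] is a limit of theirs. *)
Definition tails (n : nat) : set (R * R) :=
  \bigcup_(J in [set J | (n < J)%N]) cells J.

Lemma cell_measurable J m : measurable (cell J m).
Proof. by apply: measurableX; exact: measurable_itv. Qed.

Lemma cell_measure J m : (0 < J)%N -> mu2 (cell J m) = ((J%:R ^+ 2)^-1)%:E.
Proof.
move=> J0; have Jp : (0 : R) < J%:R by rewrite ltr0n.
rewrite /mu2 /cell product_measure1E; try exact: measurable_itv.
rewrite /= !lebesgue_measure_itv /= !lte_fin !ltr_pM2r ?invr_gt0 // !ltrDl ltr01.
rewrite -!EFinD -EFinM; congr (_%:E).
by field; rewrite gt_eqF.
Qed.

Lemma cell_disjoint J m m' p : (0 < J)%N -> cell J m p -> cell J m' p -> m = m'.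
Proof.
move=> J0; have Jp : (0 : R) < J%:R by rewrite ltr0n.
have key (a b : int) (x : R) :
    x \in `[a%:~R / J%:R, (a%:~R + 1) / J%:R[ ->
    x \in `[b%:~R / J%:R, (b%:~R + 1) / J%:R[ -> a = b.
  rewrite !in_itv /= !ler_pdivrMr // !ltr_pdivlMr // => /andP[h1 h2] /andP[h3 h4].
  have h12 : a%:~R < (b + 1)%:~R :> R by rewrite intrD; exact: le_lt_trans h1 h4.
  have h34 : b%:~R < (a + 1)%:~R :> R by rewrite intrD; exact: le_lt_trans h3 h2.
  move: h12 h34; rewrite !ltr_int; lia.
move=> [/= h1 h2] [/= h3 h4].
by case: m m' h1 h2 h3 h4 => [a b] [a' b'] /= h1 h2 h3 h4; congr (_, _); apply: key; eauto.
Qed.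

Lemma cells_measurable J : measurable (cells J).
Proof.
pose F (n : nat) := if choice.unpickle n is Some m then
  if `[< near_cell J m >] then cell J m else set0 else set0.
have -> : cells J = bigcup setT F.
  apply/seteqP; split=> [p [m nm mp]|p [n _]].
    exists (choice.pickle m); first by [].
    by rewrite /F choice.pickleK asboolT.
  by rewrite /F; case: choice.unpickle => // m; case: asboolP => // nm; exists m.
apply: bigcupT_measurable => n; rewrite /F; case: choice.unpickle => // m.
by case: ifP => // _; exact: cell_measurable.
Qed.

Lemma tails_measurable n : measurable (tails n).
Proof. by apply: bigcup_measurable => J _; exact: cells_measurable. Qed.

Lemma cell_close J m p : (0 < J)%N -> cell J m p ->
  `|p.1 - m.1%:~R / J%:R| <= J%:R^-1 /\ `|p.2 - m.2%:~R / J%:R| <= J%:R^-1.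
Proof.
move=> J0; have Jp : (0 : R) < J%:R by rewrite ltr0n.
have key (a : int) (x : R) : x \in `[a%:~R / J%:R, (a%:~R + 1) / J%:R[ ->
    `|x - a%:~R / J%:R| <= J%:R^-1.
  rewrite in_itv /= mulrDl mul1r => /andP[h1 h2].
  by rewrite ger0_norm ?subr_ge0 // lerBlDl ltW.
by move=> [/= h1 h2]; split; apply: key.
Qed.

Lemma tails_close n p : tails n p -> exists2 v, Delta v &
  `|p.1 - v.1| <= (c.+1)%:R / n.+1%:R /\ `|p.2 - v.2| <= (c.+1)%:R / n.+1%:R.
Proof.
move=> [J /= nJ [m [v Dv [h1 h2]] /cell_close[|h3 h4]]]; first exact: leq_ltn_trans nJ.
exists v => //.
have Jn : c.+1%:R / J%:R <= c.+1%:R / n.+1%:R :> R.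
  by rewrite ler_pM2l ?ltr0n // lef_pV2 ?posrE ?ltr0n // ?ler_nat // (leq_ltn_trans _ nJ).
have cJ : c.+1%:R / J%:R = c%:R / J%:R + J%:R^-1 :> R.
  by rewrite -natr1 mulrDl mul1r.
have tri (x y z : R) : x - z = (y - z) + (x - y) by ring.
split; apply: le_trans Jn; rewrite cJ.
  rewrite (tri _ (m.1%:~R / J%:R)); exact: le_trans (ler_normD _ _) (lerD h1 h3).
rewrite (tri _ (m.2%:~R / J%:R)); exact: le_trans (ler_normD _ _) (lerD h2 h4).
Qed.

Lemma Delta_cells J : (0 < J)%N -> Delta `<=` cells J.
Proof.
move=> J0 v Dv; have Jp : (0 : R) < J%:R by rewrite ltr0n.
have key (x : R) : x \in `[(Num.floor (x * J%:R))%:~R / J%:R,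
    ((Num.floor (x * J%:R))%:~R + 1) / J%:R[.
  rewrite in_itv /= ler_pdivrMr // ltr_pdivlMr // ge_floor /=.
  by have := floorD1_gt (x * J%:R); rewrite intrD.
pose m := (Num.floor (v.1 * J%:R), Num.floor (v.2 * J%:R)).
have mv : cell J m v by split; exact: key.
exists m => //; exists v => //; have [h1 h2] := cell_close J0 mv.
have cJ : J%:R^-1 <= c%:R / J%:R :> R.
  by apply: ler_peMl; [rewrite invr_ge0 ltW|rewrite ler1n].
by split; rewrite distrC; apply: le_trans cJ.
Qed.

Lemma bigcap_tails : bigcap setT tails = Delta.
Proof.
apply/seteqP; split=> [p hp|v Dv n _]; last first.
  by exists n.+1 => //=; exact: Delta_cells.
apply: Dclosed => B /nbhs_ballP[e /= e0 eB].
have [n hn] : exists n : nat, c.+1%:R / e < n%:R.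
  by exists (Num.trunc (c.+1%:R / e)).+1; exact: truncnS_gt.
have [v Dv [h1 h2]] := tails_close (hp n I).
have ce : c.+1%:R / n.+1%:R < e.
  rewrite ltr_pdivrMr ?ltr0n // mulrC -ltr_pdivrMr //.
  by apply: lt_trans hn _; rewrite ltr_nat.
exists v; split => //; apply: eB; split; rewrite /ball /=.
  exact: le_lt_trans ce.
exact: le_lt_trans ce.
Qed.

Lemma Delta_measurable : measurable Delta.
Proof.
by rewrite -bigcap_tails; apply: bigcapT_measurable; exact: tails_measurable.
Qed.

Lemma tails_finite : (mu2 (tails 0) < +oo)%E.
Proof.
pose L := N + c.+1%:R.
apply: (@le_lt_trans _ _ (mu2 (`[- L, L]%classic `*` `[- L, L]%classic))).
  apply: le_measure; rewrite ?inE; first exact: tails_measurable.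
    by apply: measurableX; exact: measurable_itv.
  move=> p /tails_close[v /Dbnd[v1 v2] [h1 h2]]; rewrite divr1 in h1 h2.
  have key (x y : R) : `|y| <= N -> `|x - y| <= c.+1%:R -> x \in `[- L, L].
    move=> hy hxy; rewrite in_itv /= -ler_norml /L.
    by apply: le_trans (lerD hy hxy); rewrite -{1}(subrK y x) addrC ler_normD.
  by split; [exact: (key _ v.1)|exact: (key _ v.2)].
rewrite /mu2 product_measure1E; try exact: measurable_itv.
rewrite /= lebesgue_measure_itv /=; case: ifP => _; last by rewrite mule0.
by rewrite -EFinD -EFinM ltry.
Qed.

Lemma tails_homo n m : (n <= m)%N -> tails m `<=` tails n.
Proof. by move=> nm p [J /= mJ Jp]; exists J => //=; exact: leq_ltn_trans mJ. Qed.

Lemma Delta_finite : mu2 Delta \is a fin_num.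
Proof.
rewrite ge0_fin_numE //; apply: le_lt_trans tails_finite.
apply: le_measure; rewrite ?inE; [exact: Delta_measurable|exact: tails_measurable|].
by rewrite -{1}bigcap_tails => p; apply.
Qed.

(** The points of [s] are corners of disjoint cells of area [1 / J ^ 2], contained in a tail whose
    area is less than [area Delta + e]. *)
Lemma lattice_points_le (e : R) : 0 < e -> exists2 J, (0 < J)%N &
  forall s : seq Z2, uniq s -> (forall m, m \in s -> near_cell J m) ->
  (size s)%:R <= J%:R ^+ 2 * (area Delta + e).
Proof.
move=> e0.
have [n hn] : exists n, (mu2 (tails n) < mu2 Delta + e%:E)%E.
  apply: contrapT => /forallNP h.
  have cv := nonincreasing_cvg_mu tails_finite tails_measurable _ _.
  rewrite bigcap_tails in cv.
  have {}cv : mu2 (tails n) @[n --> \oo] --> mu2 Delta.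
    by apply: cv; [exact: Delta_measurable|move=> a b ab; apply/subsetPset; exact: tails_homo].
  have : (mu2 Delta + e%:E <= limn (fun n => mu2 (tails n)))%E.
    apply: lime_ge; first by apply/cvg_ex; exists (mu2 Delta).
    by apply: nearW => m; rewrite leNgt; apply/negP; exact: h.
  rewrite (cvg_lim _ cv) // -(fineK Delta_finite) -EFinD lee_fin.
  by rewrite gerDl leNgt e0.
exists n.+1 => // s us hs.
have Jp : (0 : R) < n.+1%:R by rewrite ltr0n.
have sm : forall s' : seq Z2, measurable (\big[setU/set0]_(m <- s') cell n.+1 m).
  by move=> s'; apply: bigsetU_measurable => m _; exact: cell_measurable.
have mus s' : uniq s' -> mu2 (\big[setU/set0]_(m <- s') cell n.+1 m) =
    ((size s')%:R / n.+1%:R ^+ 2)%:E.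
  elim: s' => [|m s' IH] /=; first by rewrite big_nil /mu2 measure0 mul0r.
  move=> /andP[ms us'].
  have dis : cell n.+1 m `&` \big[setU/set0]_(m <- s') cell n.+1 m = set0.
    rewrite -subset0 => p [mp]; rewrite -bigcup_seq => -[m' /= m's m'p].
    by move/negP: ms; apply; rewrite (cell_disjoint _ mp m'p).
  rewrite big_cons.
  transitivity (mu2 (cell n.+1 m) + mu2 (\big[setU/set0]_(m <- s') cell n.+1 m))%E.
    by apply: measureU => //; [exact: cell_measurable|exact: sm].
  by rewrite IH // cell_measure // -EFinD -(@natr1 R (size s')) mulrDl mul1r addrC.
have : (mu2 (\big[setU/set0]_(m <- s) cell n.+1 m) <= mu2 Delta + e%:E)%E.
  apply: le_trans (ltW hn); apply: le_measure; rewrite ?inE;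
    [exact: sm|exact: tails_measurable|].
  rewrite -bigcup_seq => p [m /= ms mp]; exists n.+1 => //=.
  by exists m => //; exact: hs.
rewrite mus // -(fineK Delta_finite) -EFinD lee_fin ler_pdivrMr ?exprn_gt0 //.
by rewrite mulrC.
Qed.

End LatticeCount.

Lemma dilate_ind (A F : seq Z2) j m : m \in dilate A F j.+1 ->
  exists a m', [/\ a \in A, m' \in dilate A F j & m = a + m'].
Proof. by rewrite mem_undup => /allpairsP[[a m'] /= [aA mF ->]]; exists a, m'. Qed.

Section AreaBound.
Variable R : realType.
Notation lat := (@lat R).

Lemma latD (a b : Z2) : lat (a + b) = lat a + lat b.
Proof. by rewrite /lat /= !intrD. Qed.

Definition polygon (A : seq Z2) : set (R * R) := hull (lat @` [set m | m \in A]).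

Lemma polygon_mem A (m : Z2) : m \in A -> polygon A (lat m).
Proof. by move=> mA; apply: hull_sub; exists m. Qed.

Lemma closed_polygon A : closed (polygon A).
Proof.
rewrite /polygon (_ : _ @` _ = [set p | p \in map lat A]).
  exact: closed_hull_seq.
apply/seteqP; split=> [_ [m mA <-]|p /mapP[m mA ->]]; last by exists m.
exact: map_f.
Qed.

Lemma polygon_bounded A : exists N, forall v, polygon A v ->
  `|v.1| <= N /\ `|v.2| <= N.
Proof.
have [r hr] := mem_bound A; exists r%:R => v Av.
have half (a b : int) : (forall m : Z2, m \in A -> a * m.1 + b * m.2 <= r%:Z) ->
    a%:~R * v.1 + b%:~R * v.2 <= r%:R.
  move=> h; apply: hull_halfplane Av => _ [m /= /h mA <-] /=.
  by rewrite -!intrM -intrD -[r%:R]/(r%:Z%:~R) ler_int.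
split; rewrite ler_norml; apply/andP; split.
- have := half (-1) 0; rewrite mulN1r mul0r addr0 lerNl; apply => m /hr; lia.
- have := half 1 0; rewrite mul1r mul0r addr0; apply => m /hr; lia.
- have := half 0 (-1); rewrite mulN1r mul0r add0r lerNl; apply => m /hr; lia.
- have := half 0 1; rewrite mul1r mul0r add0r; apply => m /hr; lia.
Qed.

(** By convexity, a sum of [j.+1] points of [A] is [j.+1] times a point of the polygon, their
    mean. *)
Lemma dilate_polygon A F j (m : Z2) : m \in dilate A F j.+1 ->
  exists2 v, polygon A v & exists2 e, e \in F & lat m = j.+1%:R *: v + lat e.
Proof.
elim: j m => [|j IH] m /dilate_ind[a [m' [aA m'F ->]]].
  exists (lat a); first exact: polygon_mem.
  by exists m'; [rewrite -mem_undup|rewrite scale1r latD].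
have [v Av [e eF em]] := IH m' m'F.
have j0 : (j.+2%:R : R) != 0 by rewrite pnatr_eq0.
exists (j.+2%:R^-1 *: lat a + (1 - j.+2%:R^-1) *: v).
  have t0 : 0 <= j.+2%:R^-1 :> R by rewrite invr_ge0 ler0n.
  have t1 : j.+2%:R^-1 <= 1 :> R by rewrite invf_le1 ?ltr0n // ler1n.
  exact: (hull_conv t0 t1 (polygon_mem aA) Av).
exists e => //; rewrite latD em scalerDr !scalerA mulfV // scale1r.
rewrite mulrBr mulr1 mulfV // addrA; congr (_ + _ *: _ + _).
by rewrite -[j.+2%:R]natr1 addrK.
Qed.

Lemma area_bound_polygon A n0 : 2 * area (polygon A) < n0.+1%:R -> area_bound A n0.
Proof.
move=> hn F; have [r hr] := mem_bound F; have [N hN] := polygon_bounded A.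
(* With this [e], [2 * (area + e)] lies halfway between [2 * area] and [n0.+1]. *)
pose e := (n0.+1%:R - 2 * area (polygon A)) / 4.
have e0 : 0 < e by rewrite divr_gt0 // subr_gt0.
have [[//|J] _ hJ] := lattice_points_le (closed_polygon (A := A)) hN (ltn0Sn r) e0.
exists J.+1.
have := hJ _ (dilate_uniq A F J.+1).
have Jp : (0 : R) < J.+1%:R by rewrite ltr0n.
have near m : m \in dilate A F J.+1 -> near_cell (polygon A) r.+1 J.+1 m.
  move=> /dilate_polygon[v Av [a /hr aF em]]; exists v => //.
  have key (x y w : R) (b : int) : x = J.+1%:R * y + b%:~R ->
      - r%:Z <= b -> b <= r%:Z -> `|x / J.+1%:R - y| <= r.+1%:R / J.+1%:R.
    move=> -> b1 b2; have -> : (J.+1%:R * y + b%:~R) / J.+1%:R - y = b%:~R / J.+1%:R.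
      by field; rewrite gt_eqF.
    rewrite normrM [X in _ * X]gtr0_norm ?invr_gt0 // ler_pM2r ?invr_gt0 //.
    rewrite -intr_norm -[r.+1%:R]/(r.+1%:Z%:~R) ler_int; lia.
  have := em; rewrite [lat m]surjective_pairing => -[em1 em2].
  case/and4P: aF => h1 h2 h3 h4.
  by split; [apply: (key _ _ 0 a.1)|apply: (key _ _ 0 a.2)].
move=> /(_ near) h.
rewrite -(ltr_nat R) natrM natrM natrX.
apply: le_lt_trans (_ : 2 * (J.+1%:R ^+ 2 * (area (polygon A) + e)) < _).
  by rewrite ler_pM2l.
have J2 : (0 : R) < J.+1%:R ^+ 2 by rewrite exprn_gt0.
rewrite mulrCA [n0.+1%:R * _]mulrC ltr_pM2l // /e; move: hn; lra.
Qed.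

(** A direct count: the dilate fits into a triangle of side [L], and two such triangles, one of them
    reflected, fit disjointly into a rectangle of [L.+2 * L.+1] points. *)
Lemma area_bound_simplex A (v : Z2) d :
  (forall m : Z2, m \in A -> [&& 0 <= m.1 + v.1, 0 <= m.2 + v.2 &
     m.1 + v.1 + (m.2 + v.2) <= d%:Z]) -> area_bound A (d ^ 2).
Proof.
move=> hA F; have [r hr] := mem_bound F.
(* [L.+2] is [J * d + q], and [J] is large enough for [(J * d + q) ^ 2 < (d ^ 2 + 1) * J ^ 2]. *)
pose q := (4 * r + 2)%N; pose J := (2 * d * q + q ^ 2 + 1)%N; exists J.
have loc j (m : Z2) : m \in dilate A F j ->
    [&& - r%:Z <= m.1 + j%:Z * v.1, - r%:Z <= m.2 + j%:Z * v.2 &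
     m.1 + j%:Z * v.1 + (m.2 + j%:Z * v.2) <= (j * d + 2 * r)%N%:Z].
  elim: j m => [m|j IH m /dilate_ind[a [m' [/hA aA /IH m'F ->]]]].
    by rewrite mem_undup => /hr; lia.
  have -> : j.+1%:Z = j%:Z + 1 by lia.
  rewrite /= !mulrDl !mul1r mulSn; move: aA m'F; lia.
pose L := (J * d + 4 * r)%N.
pose s := [seq (m.1 + J%:Z * v.1 + r%:Z, m.2 + J%:Z * v.2 + r%:Z) | m <- dilate A F J].
have us : uniq s.
  rewrite map_inj_uniq ?dilate_uniq // => -[a b] [a' b'] /= [h1 h2].
  by apply/eqP; rewrite xpair_eqE; lia.
have hs (x : Z2) : x \in s -> [&& 0 <= x.1, 0 <= x.2 & x.1 + x.2 <= L%:Z].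
  move=> /mapP[m /loc mK ->] /=; rewrite /L; lia.
pose s' := [seq (L.+1%:Z - x.1, L%:Z - x.2) | x <- s].
have us' : uniq (s ++ s').
  rewrite cat_uniq us /= map_inj_uniq ?us ?andbT; last first.
    by move=> [a b] [a' b'] /= [h1 h2]; apply/eqP; rewrite xpair_eqE; lia.
  apply/hasPn => x /mapP[y /hs ys ->]; apply/negP => /hs /=; lia.
have sub : {subset s ++ s' <= rect 0 0 L.+2 L.+1}.
  move=> x; rewrite mem_cat mem_rect => /orP[/hs|/mapP[y /hs ys ->]] /=; lia.
have := uniq_leq_size us' sub.
rewrite size_cat !size_map size_rect addnn -mul2n => h.
apply: leq_ltn_trans h _.
have -> : (L.+2 * L.+1 = (J * d + q) * (J * d + q).-1)%N by rewrite /L /q; congr (_ * _)%N; lia.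
apply: leq_ltn_trans (_ : ((J * d + q) * (J * d + q) < _)%N).
  by rewrite leq_mul2l leq_pred orbT.
have Je : J = (2 * d * q + q ^ 2 + 1)%N by [].
move: J Je {loc L s us hs s' us' sub} => J Je.
have : (2 * d * q * J + q ^ 2 < J * J)%N by rewrite {2}Je; nia.
rewrite !expnS !expn0 !muln1; nia.
Qed.

End AreaBound.

Lemma seq_range (A : seq Z2) (phi : Z2 -> int) : A != [::] ->
  exists a b (h : nat), [/\ a \in A, b \in A, phi b = phi a + h%:Z &
    forall m : Z2, m \in A -> phi a <= phi m <= phi a + h%:Z].
Proof.
move=> A0; suff [a [b [aA bA hab]]] : exists a b, [/\ a \in A, b \in A &
    forall m, m \in A -> phi a <= phi m <= phi b].
  exists a, b, (absz (phi b - phi a)); have := hab a aA; split => // [|m /hab]; lia.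
elim: A A0 => // x A IH _; have [->|/IH[a [b [aA bA hab]]]] := eqVneq A [::].
  by exists x, x; split; rewrite ?mem_head // => m; rewrite inE => /eqP ->; rewrite !lexx.
exists (if phi x <= phi a then x else a), (if phi b <= phi x then x else b).
split=> [||m]; [by case: ifP; rewrite inE ?eqxx ?aA ?orbT|
  by case: ifP; rewrite inE ?eqxx ?bA ?orbT|].
rewrite inE => /orP[/eqP ->|/hab]; have := hab a aA; have := hab b bA;
  case: ifP; case: ifP; lia.
Qed.

(** * Widths and noncollinear points of a lattice polygon *)

Section PolygonShape.
Variable R : realType.
Notation lat := (@lat R).
Notation polygon := (@polygon R).

Lemma coordinate_range (A : seq Z2) (al be : int) (h1 h2 : nat) (a a' b b' : Z2) :
  a \in A -> a' \in A -> b \in A -> b' \in A ->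
  a.1 = al -> a'.1 = al + h1%:Z -> b.2 = be -> b'.2 = be + h2%:Z ->
  h1%:R <= width_w (polygon A) /\ h2%:R <= width_z (polygon A).
Proof.
move=> aA a'A bA b'A ea ea' eb eb'; have [N hN] := @polygon_bounded R A.
have bnd (S : set R) : (forall x, S x -> `|x| <= N) -> has_ubound S /\ has_lbound S.
  by move=> h; split; [exists N|exists (- N)] => x /h; rewrite ler_norml => /andP[].
have key (g : R * R -> R) p q : (forall v, polygon A v -> `|g v| <= N) ->
    p \in A -> q \in A -> g (lat q) - g (lat p) <= sup (g @` polygon A) - inf (g @` polygon A).
  move=> hg pA qA; have [ub lb] : has_ubound (g @` polygon A) /\ has_lbound (g @` polygon A).
    by apply: bnd => _ [v /hg h <-].
  have hq := ub_le_sup ub (imageP g (polygon_mem (R:=R) qA)).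
  have hp := ge_inf lb (imageP g (polygon_mem (R:=R) pA)).
  exact: lerB.
split.
  have := key fst a a' (fun v Av => (hN v Av).1) aA a'A.
  by rewrite /lat /= ea ea' intrD addrAC subrr add0r.
have := key snd b b' (fun v Av => (hN v Av).2) bA b'A.
by rewrite /lat /= eb eb' intrD addrAC subrr add0r.
Qed.

Lemma simplex_bounds d (u : R * R) : simplex d u ->
  [/\ 0 <= u.1, 0 <= u.2 & u.1 + u.2 <= d%:R].
Proof.
move=> Su.
have half (a b c : R) : 0 <= c -> a * d%:R <= c -> b * d%:R <= c ->
    a * u.1 + b * u.2 <= c.
  move=> h0 ha hb; apply: hull_halfplane Su => _ [[->|->]|->] /=.
  - by rewrite !mulr0 addr0.
  - by rewrite mulr0 addr0.
  - by rewrite mulr0 add0r.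
have d0 : 0 <= d%:R :> R by rewrite ler0n.
have := half (-1) 0 0; have := half 0 (-1) 0; have := half 1 1 d%:R.
rewrite !mulN1r !mul1r !mul0r !addr0 !add0r !oppr_le0 !lexx d0.
by move=> h1 h2 h3; split; [exact: h3|exact: h2|exact: h1].
Qed.

Lemma simplex_lattice A d (v : Z2) :
  (forall u, polygon A u -> simplex d (u + lat v)) ->
  forall m : Z2, m \in A -> [&& 0 <= m.1 + v.1, 0 <= m.2 + v.2 &
     m.1 + v.1 + (m.2 + v.2) <= d%:Z].
Proof.
move=> h m mA; have /simplex_bounds[] := h _ (polygon_mem (R:=R) mA).
rewrite -latD /lat /= -[d%:R]/(d%:Z%:~R) -intrD !ler0z ler_int => -> ->.
by rewrite -!addrA => ->.
Qed.

(** A small step [t] from an interior point in the direction (a, b) changes the linear form by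
    [t * (a ^ 2 + b ^ 2)]. *)
Lemma interior_not_line A (a b c : R) : ((polygon A)°)%classic !=set0 ->
  (forall m, m \in A -> a * (lat m).1 + b * (lat m).2 = c) -> a = 0 /\ b = 0.
Proof.
move=> [p pA] h.
have hp u : polygon A u -> a * u.1 + b * u.2 = c.
  move=> Au; apply/eqP; rewrite eq_le; apply/andP; split.
    by apply: hull_halfplane Au => _ [m mA <-]; rewrite h.
  have := @hull_halfplane _ _ (- a) (- b) (- c) _ _ Au.
  rewrite !mulNr -opprD lerN2; apply => _ [m mA <-].
  by rewrite !mulNr -opprD h.
have /nbhs_ballP[e /= e0 eA] := pA.
pose t := e / (2 * (1 + `|a| + `|b|)).
have ab0 : 0 < 1 + `|a| + `|b| by rewrite ltr_pwDl // ltr_pwDl.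
have t0 : 0 < t by rewrite divr_gt0 // mulr_gt0.
have tl (x : R) : `|x| <= `|a| + `|b| -> `|t * x| < e.
  move=> hx; rewrite normrM gtr0_norm // /t mulrAC ltr_pdivrMr ?mulr_gt0 //.
  by rewrite ltr_pM2l //; move: hx (normr_ge0 a) (normr_ge0 b); lra.
have q : polygon A (p.1 + t * a, p.2 + t * b).
  apply: eA; split; rewrite /ball /= opprD addrA subrr sub0r normrN; apply: tl.
    by rewrite lerDl.
  by rewrite lerDr.
have /hp /= := q; have /hp := nbhs_singleton pA => <-.
rewrite !mulrDr addrACA -[X in _ = X]addr0 => /addrI.
rewrite !(mulrCA _ t) -mulrDr => /eqP; rewrite mulf_eq0 gt_eqF //= => /eqP e1.
have : a * a = 0 /\ b * b = 0.
  have := sqr_ge0 a; have := sqr_ge0 b; rewrite !expr2; split; lra.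
by move=> [/eqP + /eqP]; rewrite !mulf_eq0 !orbb => /eqP -> /eqP ->.
Qed.

Lemma noncollinear A : ((polygon A)°)%classic !=set0 ->
  exists m0 m1 m2 : Z2, [/\ m0 \in A, m1 \in A, m2 \in A &
    (m1 - m0).1 * (m2 - m0).2 - (m1 - m0).2 * (m2 - m0).1 != 0].
Proof.
move=> Aint; apply: contrapT => nc.
have col m0 m1 m2 : m0 \in A -> m1 \in A -> m2 \in A ->
    (m1 - m0).1 * (m2 - m0).2 - (m1 - m0).2 * (m2 - m0).1 = 0.
  move=> h0 h1 h2; apply/eqP; apply: contrapT => /negP h; apply: nc.
  by exists m0, m1, m2.
have [m0 m0A] : exists m0, m0 \in A.
  exists (head 0 A); rewrite -nth0 mem_nth // lt0n size_eq0; apply/eqP => A0.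
  move: Aint; rewrite A0; case=> p Ap; have pA := nbhs_singleton Ap.
  suff : (@set0 (R * R)) p by [].
  by apply: (hull_min _ _ pA) => [x y t _ _ []|q [m + _]].
have [[m1 [m1A m01]]|eqm] := pselect (exists m1, m1 \in A /\ m1 != m0).
  pose x : R := (m1 - m0).1%:~R; pose y : R := (m1 - m0).2%:~R.
  have [|y0 x0] := @interior_not_line A (- y) x (- y * (lat m0).1 + x * (lat m0).2) Aint.
    move=> m mA; have := congr1 (fun n : int => n%:~R : R) (col m0 m1 m m0A m1A mA).
    by rewrite /= intrB !intrM /x /y /lat /= !intrB; lra.
  move/eqP: m01; apply; apply/eqP; rewrite -subr_eq0.
  move: x0 y0; rewrite /x /y => /eqP; rewrite intr_eq0 => /eqP x0 /eqP.
  rewrite oppr_eq0 intr_eq0 => /eqP y0.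
  by apply/eqP; rewrite [LHS]surjective_pairing x0 y0.
have [|/eqP + _] := @interior_not_line A 1 0 (lat m0).1 Aint.
  move=> m mA; have -> : m = m0.
    by apply: contrapT => /eqP mm0; apply: eqm; exists m.
  by rewrite mul1r mul0r addr0.
by rewrite oner_eq0.
Qed.

End PolygonShape.

(** * Asymptotic expansions *)

Section Expansions.
Variable R : realType.
Notation C := R[i].
Notation rc := (real_complex R).
Notation nc := (@ComplexField.Normc.normc R).

Lemma normc_ge0 (x : C) : 0 <= nc x.
Proof. by case: x => a b; exact: sqrtr_ge0. Qed.

Lemma normc_real (t : R) : nc (rc t) = `|t|.
Proof. by rewrite /nc /= expr0n addr0 sqrtr_sqr. Qed.

Lemma normcX (x : C) n : nc (x ^+ n) = nc x ^+ n.
Proof.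
elim: n => [|n IH]; first by rewrite !expr0 normc_real normr1.
by rewrite !exprS ComplexField.Normc.normcM IH.
Qed.

Lemma normc_eq0 (x : C) : (nc x == 0) = (x == 0).
Proof.
apply/eqP/eqP => [/ComplexField.Normc.eq0_normc //|->].
by rewrite -[0]/(rc 0) normc_real normr0.
Qed.

Lemma normc_gt0 (x : C) : (0 < nc x) = (x != 0).
Proof. by rewrite lt_def normc_ge0 andbT normc_eq0. Qed.

Lemma normcN (x : C) : nc (- x) = nc x.
Proof. by case: x => a b; rewrite /= !sqrrN. Qed.

Lemma normc_lerB (x y : C) : nc x - nc y <= nc (x + y).
Proof.
rewrite lerBlDr; have := @le_normcD _ (x + y) (- y).
by rewrite addrK normcN.
Qed.

Definition norm1 (p : {poly C}) : R := \sum_(i < size p) nc p`_i.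

Lemma norm1_ge0 p : 0 <= norm1 p.
Proof. by apply: sumr_ge0 => i _; exact: normc_ge0. Qed.

Lemma horner_bound (p : {poly C}) (x : C) : nc x <= 1 -> nc p.[x] <= norm1 p.
Proof.
move=> x1; rewrite horner_coef /norm1; elim/big_rec2: _ => [|i a b _ ab].
  by rewrite -[X in nc X]/(rc 0) normc_real normr0.
apply: le_trans (le_normcD _ _) (lerD _ ab).
rewrite ComplexField.Normc.normcM normcX ler_piMr ?normc_ge0 //.
by rewrite exprn_ile1 ?normc_ge0.
Qed.

Lemma near0_lt (e : R) : 0 < e -> \forall t \near (0 : R), `|t| < e.
Proof. exact: nbhs0_lt. Qed.

(* [u] is the asymptotic expansion of [v] at [0]. *)
Definition expands (u : nat -> C) (v : R -> C) := forall N, exists K : R,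
  \forall t \near (0 : R), exists2 b, nc b <= K &
    v t = (trunc_poly N u).[rc t] + b * rc t ^+ N.

(** Truncation is not multiplicative; any polynomial with the right coefficients below [N] may
    replace it. *)
Lemma expands_poly (u : nat -> C) (v : R -> C) N (p : {poly C}) :
  (forall n, (n < N)%N -> p`_n = u n) ->
  (exists K : R, \forall t \near (0 : R), exists2 b, nc b <= K &
    v t = p.[rc t] + b * rc t ^+ N) ->
  exists K : R, \forall t \near (0 : R), exists2 b, nc b <= K &
    v t = (trunc_poly N u).[rc t] + b * rc t ^+ N.
Proof.
move=> pu [K vK].
have pE : p = trunc_poly N u + drop_poly N p * 'X^N.
  rewrite -[LHS](poly_take_drop N); congr (_ + _); apply/polyP => n.
  by rewrite coef_take_poly coef_poly; case: ifP => // nN; rewrite pu.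
exists (K + norm1 (drop_poly N p)).
near=> t; have [b bK ->] : exists2 b, nc b <= K & v t = p.[rc t] + b * rc t ^+ N.
  by near: t.
exists (b + (drop_poly N p).[rc t]).
  apply: le_trans (le_normcD _ _) (lerD bK (horner_bound _ _)).
  by rewrite normc_real ltW //; near: t; exact: near0_lt.
by rewrite {1}pE hornerD hornerM hornerXn; ring.
Unshelve. all: by end_near. Qed.

Variables (I : Type) (i0 : I).
Notation G := (@germ C I i0).
Implicit Types (u v : G) (f g : R -> C).

Lemma expands0 u i f : expands (u i) f -> f 0 = u i 0%N.
Proof.
move=> /(_ 1%N)[K /nbhs_singleton[b _ ->]].
by rewrite expr1 rmorph0 mulr0 addr0 horner_coef0 coef_poly.
Qed.

Lemma expands_eq u i f g : expands (u i) f -> (\forall t \near (0 : R), f t = g t) ->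
  expands (u i) g.
Proof.
move=> uf fg N; have [K vK] := uf N; exists K; near=> t.
have <- : f t = g t by near: t.
by near: t.
Unshelve. all: by end_near. Qed.

Lemma expandsM u v i f g : expands (u i) f -> expands (v i) g ->
  expands ((u * v) i) (fun t => f t * g t).
Proof.
move=> uf vg N.
apply: (@expands_poly _ _ _ (trunc_poly N (u i) * trunc_poly N (v i))) => [n nN|].
  by rewrite -germ_mulE.
have [K fK] := uf N; have [L gL] := vg N.
set p := trunc_poly N (u i) in fK *; set q := trunc_poly N (v i) in gL *.
exists (norm1 p * L + K * norm1 q + K * L); near=> t.
have [b bK ->] : exists2 b, nc b <= K & f t = p.[rc t] + b * rc t ^+ N by near: t.
have [c cL ->] : exists2 c, nc c <= L & g t = q.[rc t] + c * rc t ^+ N by near: t.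
have t1 : nc (rc t) <= 1.
  by rewrite normc_real ltW //; near: t; exact: near0_lt.
exists (p.[rc t] * c + b * q.[rc t] + b * c * rc t ^+ N); last first.
  by rewrite hornerM; ring.
apply: le_trans (le_normcD _ _) (lerD _ _).
  apply: le_trans (le_normcD _ _) (lerD _ _);
    by rewrite ComplexField.Normc.normcM ler_pM ?normc_ge0 ?horner_bound.
rewrite !ComplexField.Normc.normcM normcX -[leRHS]mulr1.
by rewrite ler_pM ?mulr_ge0 ?exprn_ge0 ?normc_ge0 ?exprn_ile1 ?ler_pM ?normc_ge0.
Unshelve. all: by end_near. Qed.

Lemma expandsD u v i f g : expands (u i) f -> expands (v i) g ->
  expands ((u + v) i) (fun t => f t + g t).
Proof.
move=> uf vg N.
apply: (@expands_poly _ _ _ (trunc_poly N (u i) + trunc_poly N (v i))) => [n nN|].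
  by rewrite coefD !coef_poly nN.
have [K fK] := uf N; have [L gL] := vg N.
set p := trunc_poly N (u i) in fK *; set q := trunc_poly N (v i) in gL *.
exists (K + L); near=> t.
have [b bK ->] : exists2 b, nc b <= K & f t = p.[rc t] + b * rc t ^+ N by near: t.
have [c cL ->] : exists2 c, nc c <= L & g t = q.[rc t] + c * rc t ^+ N by near: t.
exists (b + c); first exact: le_trans (le_normcD _ _) (lerD _ _).
by rewrite hornerD; ring.
Unshelve. all: by end_near. Qed.

Lemma expandsC (c : C) i : expands ((c%:A : G) i) (fun=> c).
Proof.
move=> N; apply: (@expands_poly _ _ _ c%:P) => [n _|].
  by rewrite coefC germC.
exists 0; near=> t; exists 0; first by rewrite -[X in nc X]/(rc 0) normc_real normr0.
by rewrite hornerC mul0r addr0.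
Unshelve. all: by end_near. Qed.

Lemma expandsZ (c : C) u i f : expands (u i) f ->
  expands ((c *: u) i) (fun t => c * f t).
Proof.
by move=> uf; rewrite -[c *: u]mulr_algl; apply: expandsM => //; exact: expandsC.
Qed.

Lemma expands_zero i : expands ((0 : G) i) (fun=> 0).
Proof. by have := @expandsC 0 i; rewrite scale0r. Qed.

Lemma expands_one i : expands ((1 : G) i) (fun=> 1).
Proof. by have := @expandsC 1 i; rewrite scale1r. Qed.

Lemma expandsX u i f n : expands (u i) f -> expands ((u ^+ n) i) (fun t => f t ^+ n).
Proof.
move=> uf; elim: n => [|n IH]; first exact: expands_one.
rewrite exprS; apply: expands_eq (expandsM uf IH) _.
by near=> t; rewrite exprS.
Unshelve. all: by end_near. Qed.

Lemma expands_sum (T : Type) (r : seq T) (F : T -> G) (h : T -> R -> C) i :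
  (forall a, expands (F a i) (h a)) ->
  expands ((\sum_(a <- r) F a) i) (fun t => \sum_(a <- r) h a t).
Proof.
move=> Fh; elim: r => [|a r IH].
  by rewrite big_nil; apply: expands_eq (expands_zero i) _; near=> t; rewrite big_nil.
rewrite big_cons; apply: expands_eq (expandsD (Fh a) IH) _.
by near=> t; rewrite big_cons.
Unshelve. all: by end_near. Qed.

Lemma expandsV u v i f : u * v = 1 -> expands (u i) f -> u i 0%N != 0 ->
  (\forall t \near (0 : R), f t != 0) /\ expands (v i) (fun t => (f t)^-1).
Proof.
move=> uv uf u0; set a := nc (u i 0%N); have a0 : 0 < a by rewrite normc_gt0.
have [B fBn] : exists B : R, \forall t \near (0 : R), f t != 0 /\ nc (f t)^-1 <= B.
  have [K fK] := uf 1%N; exists (2 / a).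
  have K0 : 0 <= K by have [b bK _] := nbhs_singleton fK; exact: le_trans (normc_ge0 b) bK.
  near=> t.
  have [b bK ft] : exists2 b, nc b <= K &
    f t = (trunc_poly 1 (u i)).[rc t] + b * rc t ^+ 1 by near: t.
  have {ft} ft : f t = u i 0%N + b * rc t.
    rewrite ft expr1; congr (_ + _).
    by rewrite /trunc_poly poly_def big_ord1 expr0 alg_polyC hornerC.
  have ta : `|t| < a / (2 * (K + 1)).
    by near: t; apply: near0_lt; rewrite divr_gt0 // mulr_gt0 // ltr_wpDl.
  have ftge : a / 2 <= nc (f t).
    rewrite ft; apply: le_trans (normc_lerB _ _).
    rewrite -/a ComplexField.Normc.normcM normc_real.
    rewrite ltr_pdivlMr ?mulr_gt0 ?ltr_wpDl // in ta.
    have := normr_ge0 t; have := normc_ge0 b; nra.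
  have ft0 : f t != 0 by rewrite -normc_gt0; apply: lt_le_trans ftge; rewrite divr_gt0.
  split=> //; rewrite ComplexField.Normc.normcV -[leRHS]invrK.
  by rewrite lef_pV2 ?posrE ?invf_div ?normc_gt0 // divr_gt0.
split; first by apply: filterS fBn => t [].
move=> N; have [K fK] := uf N.
set p := trunc_poly N (u i) in fK; set q := trunc_poly N (v i).
have pq : p * q = 1 + drop_poly N (p * q - 1) * 'X^N.
  apply/eqP; rewrite addrC -subr_eq -[X in X == _](poly_take_drop N).
  rewrite -subr_eq0 addrK; apply/eqP/polyP => n; rewrite coef_take_poly coef0.
  case: ifP => // nN; rewrite coefB -germ_mulE // -[germ_mul u v]/(u * v) uv.
  by rewrite germ1 coef1 subrr.
set r := drop_poly N _ in pq.
exists ((norm1 r + K * norm1 q) * B); near=> t.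
have [ft0 ftB] : f t != 0 /\ nc (f t)^-1 <= B by near: t.
have [b bK ft] : exists2 b, nc b <= K & f t = p.[rc t] + b * rc t ^+ N by near: t.
have t1 : nc (rc t) <= 1.
  by rewrite normc_real ltW //; near: t; exact: near0_lt.
exists (- ((r.[rc t] + b * q.[rc t]) * (f t)^-1)).
  rewrite normcN ComplexField.Normc.normcM ler_pM ?normc_ge0 //.
  apply: le_trans (le_normcD _ _) (lerD (horner_bound _ t1) _).
  by rewrite ComplexField.Normc.normcM ler_pM ?normc_ge0 ?horner_bound.
have fq : f t * q.[rc t] = 1 + (r.[rc t] + b * q.[rc t]) * rc t ^+ N.
  rewrite {1}ft mulrDl -hornerM pq hornerD hornerM hornerXn hornerC; ring.
apply: (mulfI ft0); rewrite divff // mulrDr fq mulrA mulrN mulrCA divff // mulr1.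
by rewrite mulNr addrK.
Unshelve. all: by end_near. Qed.

(** A leading term of order [n] would dominate the remainder of order [n.+1]. This carries
    identities along the arcs over to germs. *)
Lemma expands_uniq u i : expands (u i) (fun=> 0) -> u i = fun=> 0.
Proof.
move=> u0; apply: contrapT => ui; have [n un un0] := @germ_order _ _ i0 u i ui.
have [K uK] := u0 n.+1.
have pE (t : R) : (trunc_poly n.+1 (u i)).[rc t] = u i n * rc t ^+ n.
  rewrite /trunc_poly poly_def horner_sum big_ord_recr /= big1 ?add0r.
    by rewrite hornerZ hornerXn.
  by move=> j _; rewrite un // scale0r horner0.
have K0 : 0 <= K by have [b bK _] := nbhs_singleton uK; exact: le_trans (normc_ge0 b) bK.
set a := nc (u i n); have a0 : 0 < a by rewrite normc_gt0.
suff : \forall t \near (0 : R)^', False.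
  by move=> /filter_ex[].
near=> t.
have t0 : t != 0 by near: t; exact: nbhs_dnbhs_neq.
have ta : `|t| < a / (K + 1).
  by near: t; apply: nbhs_dnbhs; apply: near0_lt; rewrite divr_gt0 // ltr_wpDl.
have [c cK] : exists2 c, nc c <= K &
    0 = (trunc_poly n.+1 (u i)).[rc t] + c * rc t ^+ n.+1.
  by near: t; apply: nbhs_dnbhs.
rewrite pE exprS mulrA -mulrDl => /esym/eqP; rewrite mulf_eq0 expf_eq0.
rewrite -normc_eq0 -[rc t == 0]normc_eq0 normc_real normr_eq0 (negbTE t0) andbF orbF.
apply/negP/lt0r_neq0; apply: lt_le_trans (normc_lerB _ _).
rewrite -/a ComplexField.Normc.normcM normc_real.
rewrite ltr_pdivlMr ?ltr_wpDl // in ta.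
have := normr_ge0 t; have := normc_ge0 c; nra.
Unshelve. all: by end_near. Qed.

Definition germ_conj u : G := fun i n => (u i n)^*.

Lemma expands_conj u i f : expands (u i) f ->
  expands (germ_conj u i) (fun t => (f t)^*).
Proof.
have rcJ (t : R) : (rc t)^* = rc t := conjc_real t.
move=> uf N; have [K fK] := uf N; exists K; near=> t.
have [b bK ->] : exists2 b, nc b <= K &
  f t = (trunc_poly N (u i)).[rc t] + b * rc t ^+ N by near: t.
exists b^*; first by case: (b) bK => x y /=; rewrite sqrrN.
rewrite rmorphD rmorphM rmorphXn /= rcJ; congr (_ + _).
rewrite /trunc_poly !poly_def !horner_sum rmorph_sum; apply: eq_bigr => j _.
by rewrite !hornerZ !hornerXn rmorphM rmorphXn /= rcJ.
Unshelve. all: by end_near. Qed.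

Lemma germ_conjM u v : germ_conj (u * v) = germ_conj u * germ_conj v.
Proof.
apply: germP => i n; rewrite /germ_conj germM rmorph_sum germM.
by apply: eq_bigr => j _; rewrite rmorphM.
Qed.

Lemma germ_conjD u v : germ_conj (u + v) = germ_conj u + germ_conj v.
Proof. by apply: germP => i n; exact: rmorphD. Qed.

Lemma germ_conj1 : germ_conj 1 = 1.
Proof. by apply: germP => i n; rewrite /germ_conj germ1; exact: rmorph_nat. Qed.

Lemma germ_conjZ c u : germ_conj (c *: u) = c^* *: germ_conj u.
Proof. by apply: germP => i n; exact: rmorphM. Qed.

Lemma germ_conj_sum (T : Type) (r : seq T) (F : T -> G) :
  germ_conj (\sum_(t <- r) F t) = \sum_(t <- r) germ_conj (F t).
Proof.
apply: (big_morph germ_conj germ_conjD).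
by apply: germP => i n; exact: rmorph0.
Qed.

End Expansions.

(** * Taylor expansions of smooth functions *)

Section Taylor.
Variable R : realType.
Notation C := R[i].
Notation rc := (real_complex R).
Notation nc := (@ComplexField.Normc.normc R).

Lemma is_derive_continuous (h h' : R -> R) (delta : R) (a b : R) :
  (forall t : R, `|t| < delta -> is_derive t 1 h (h' t)) ->
  (forall t, t \in `[a, b] -> `|t| < delta) -> {within `[a, b], continuous h}.
Proof.
move=> hd ab; apply: derivable_within_continuous => t tab.
by have [] := hd t (ab t tab).
Qed.

Lemma mean_value_bound (h h' : R -> R) (delta K : R) N :
  (forall t : R, `|t| < delta -> is_derive t 1 h (h' t)) -> h 0 = 0 ->
  (forall t, `|t| < delta -> `|h' t| <= K * `|t| ^+ N) -> 0 <= K ->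
  forall t, `|t| < delta -> `|h t| <= K * `|t| ^+ N.+1.
Proof.
move=> hd h0 hK K0 t td.
have [c [ct ->]] : exists c, `|c| <= `|t| /\ h t = h' c * t.
  have [t0|t0] := leP 0 t.
    have sub x : x \in `[0, t] -> `|x| <= `|t|.
      by rewrite in_itv /= => /andP[x0 xt]; rewrite !ger0_norm.
    have [|c cI] := MVT_segment t0 (f := h) (df := h') _
      (is_derive_continuous hd (fun x xI => le_lt_trans (sub x xI) td)).
      by move=> x /subset_itv_oo_cc /sub xt; apply: hd; exact: le_lt_trans xt td.
    by rewrite h0 !subr0 => ->; exists c; split => //; exact: sub.
  have sub x : x \in `[t, 0] -> `|x| <= `|t|.
    by rewrite in_itv /= => /andP[x0 xt]; rewrite !ler0_norm ?lerN2 // ltW.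
  have [|c cI] := MVT_segment (ltW t0) (f := h) (df := h') _
    (is_derive_continuous hd (fun x xI => le_lt_trans (sub x xI) td)).
    by move=> x /subset_itv_oo_cc /sub xt; apply: hd; exact: le_lt_trans xt td.
  rewrite h0 !sub0r mulrN => /oppr_inj ->; exists c; split => //; exact: sub.
rewrite normrM exprSr mulrA ler_pM //; apply: le_trans (hK c (le_lt_trans ct td)) _.
by rewrite ler_wpM2l // lerXn2r ?nnegrE.
Qed.

(** Here [g n] is the n-th derivative. The bound for the sequence shifted by one is integrated by
    the mean value theorem. *)
Lemma taylor N (g : nat -> R -> R) (delta : R) : 0 < delta ->
  (forall n (t : R), `|t| < delta -> is_derive t 1 (g n) (g n.+1 t)) ->
  exists (K e : R), [/\ 0 < e, 0 <= K & forall t, `|t| < e ->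
    `|g 0%N t - (\poly_(n < N) (g n 0 / n`!%:R)).[t]| <= K * `|t| ^+ N].
Proof.
move=> d0; elim: N g => [|N IH] g gd.
  have g0 : continuous_at (0 : R) (g 0%N).
    apply: differentiable_continuous; apply/derivable1_diffP.
    by have [] := gd 0%N 0; rewrite ?normr0.
  have [e /= e0 he] : \forall t \near (0 : R), `|g 0%N t| < `|g 0%N 0| + 1.
    near=> t; rewrite -[g 0%N t](subrK (g 0%N 0)).
    apply: le_lt_trans (ler_normD _ _) _; rewrite addrC ltrD2l.
    by near: t; move/cvgr_distC_lt : g0; apply.
  exists (`|g 0%N 0| + 1), e; split => // t te.
  rewrite poly_def big_ord0 horner0 subr0 expr0 mulr1 ltW //.
  by apply: he; rewrite /= sub0r normrN.
have [K [e [e0 K0 hK]]] := IH (fun n => g n.+1) (fun n t => @gd n.+1 t).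
pose p := \poly_(n < N.+1) (g n 0 / n`!%:R).
have pd : p^`() = \poly_(n < N) (g n.+1 0 / n`!%:R).
  apply/polyP => n; rewrite coef_deriv !coef_poly ltnS; case: ifP => _; last first.
    by rewrite mul0rn.
  rewrite factS natrM -mulr_natr; field.
  by rewrite addrC natr1 !pnatr_eq0 -lt0n fact_gt0.
exists K, (Num.min e delta); split => //; first by rewrite lt_min e0 d0.
apply: (@mean_value_bound _ (fun t => g 1%N t - (p^`()).[t])) => // [t||t].
- rewrite lt_min => /andP[_ td]; have gt := gd 0%N t td.
  by apply: is_deriveB.
- by rewrite horner_coef0 coef_poly /= fact0 divr1 subrr.
- by rewrite lt_min => /andP[te _]; rewrite pd; exact: hK.
Unshelve. all: by end_near. Qed.

Lemma expands_taylor (g : nat -> R -> R) (delta : R) : 0 < delta ->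
  (forall n (t : R), `|t| < delta -> is_derive t 1 (g n) (g n.+1 t)) ->
  expands (fun n => rc (g n 0 / n`!%:R)) (fun t => rc (g 0%N t)).
Proof.
move=> d0 gd N; have [K [e [e0 K0 hK]]] := taylor N d0 gd.
have tE t : (trunc_poly N (fun n => rc (g n 0 / n`!%:R))).[rc t] =
    rc (\poly_(n < N) (g n 0 / n`!%:R)).[t].
  rewrite /trunc_poly !poly_def !horner_sum rmorph_sum; apply: eq_bigr => n _.
  by rewrite !hornerZ !hornerXn [in RHS]rmorphM rmorphXn.
exists K; near=> t; have := hK t; rewrite tE; set p := (X in X.[t]) => {}hK.
have {}hK : `|g 0%N t - p.[t]| <= K * `|t| ^+ N.
  by apply: hK; near: t; exact: near0_lt.
have [t0|t0] := eqVneq (t ^+ N) 0.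
  exists 0; first by rewrite -[X in nc X]/(rc 0) normc_real normr0.
  rewrite -normrX t0 normr0 mulr0 normr_le0 subr_eq0 in hK.
  by rewrite (eqP hK) mul0r addr0.
exists (rc ((g 0%N t - p.[t]) / t ^+ N)).
  rewrite normc_real normf_div normrX ler_pdivrMr //.
  by rewrite -normrX normr_gt0.
by rewrite -rmorphXn -rmorphM -rmorphD divfK // addrC subrK.
Unshelve. all: by end_near. Qed.

End Taylor.

(** * The differential of Log *)

Section Coordinates.
Variable R : realType.
Notation C := R[i].
Notation rc := (real_complex R).
Notation nc := (@ComplexField.Normc.normc R).

Lemma fst_continuous (V W : normedModType R) : continuous (@fst V W).
Proof. by move=> x; exact: cvg_fst. Qed.

Lemma snd_continuous (V W : normedModType R) : continuous (@snd V W).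
Proof. by move=> x; exact: cvg_snd. Qed.

Lemma is_diff_fst (V W : normedModType R) (x : V * W) : is_diff x (@fst V W) fst.
Proof.
have cfst : continuous (@fst V W) by exact: fst_continuous.
by apply: DiffDef; [exact: linear_differentiable|rewrite diff_lin].
Qed.

Lemma is_diff_snd (V W : normedModType R) (x : V * W) : is_diff x (@snd V W) snd.
Proof.
have csnd : continuous (@snd V W) by exact: snd_continuous.
by apply: DiffDef; [exact: linear_differentiable|rewrite diff_lin].
Qed.

Lemma derive1_fst (V W : normedModType R) (f : R -> V * W) (t : R) :
  derivable f t 1 -> is_derive t 1 (fun t => (f t).1) (derive1 f t).1.
Proof.
move=> fd; have h : h^-1 *: ((f (h *: 1 + t)).1 - (f t).1) @[h --> 0^'] --> ('D_1 f t).1.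
  apply: (@cvg_comp _ _ _ (fun h : R => h^-1 *: (f (h *: 1 + t) - f t)) fst).
    exact: fd.
  exact: fst_continuous.
by rewrite derive1E; apply: DeriveDef; [exact: cvgP h|exact: cvg_lim h].
Qed.

Lemma derive1_snd (V W : normedModType R) (f : R -> V * W) (t : R) :
  derivable f t 1 -> is_derive t 1 (fun t => (f t).2) (derive1 f t).2.
Proof.
move=> fd; have h : h^-1 *: ((f (h *: 1 + t)).2 - (f t).2) @[h --> 0^'] --> ('D_1 f t).2.
  apply: (@cvg_comp _ _ _ (fun h : R => h^-1 *: (f (h *: 1 + t) - f t)) snd).
    exact: fd.
  exact: snd_continuous.
by rewrite derive1E; apply: DeriveDef; [exact: cvgP h|exact: cvg_lim h].
Qed.

Lemma ln_sqrt (x : R) : ln (Num.sqrt x) = 2^-1 * ln x.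
Proof.
have [x0|x0] := leP x 0; first by rewrite (ler0_sqrtr x0) !ln0 ?mulr0.
by rewrite -powR12_sqrt ?ltW // ln_powR.
Qed.

Lemma ln_normc_diff (u : R * R) : u != 0 ->
  is_diff u (fun u => ln (nc (cpx u)))
    (fun v : R * R => (u.1 * v.1 + u.2 * v.2) / (u.1 ^+ 2 + u.2 ^+ 2)).
Proof.
move=> u0; have u_gt0 : 0 < u.1 * u.1 + u.2 * u.2.
  rewrite lt_def addr_ge0 -?expr2 ?sqr_ge0 // andbT; apply: contra u0.
  rewrite paddr_eq0 ?sqr_ge0 // !sqrf_eq0 => /andP[].
  by case: (u) => a b /= /eqP -> /eqP ->.
have -> : (fun u => ln (nc (cpx u))) =
    (2^-1 : R) \*: (@ln R \o ((@fst R R : R * R -> R) * fst + (@snd R R : R * R -> R) * snd)).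
  by apply: funext => v; rewrite /= ln_sqrt -!expr2.
have d1 := is_diff_fst u; have d2 := is_diff_snd u.
have dl : is_diff (u.1 * u.1 + u.2 * u.2) (@ln R) (fun h => h * (u.1 * u.1 + u.2 * u.2)^-1).
  have [dl vl] := is_derive1_ln u_gt0; apply: DiffDef; first exact/derivable1_diffP.
  rewrite diff1E; last exact/derivable1_diffP.
  by apply: funext => h /=; rewrite derive1E vl.
apply: is_diff_eq; apply: funext => v /=.
rewrite !fctE /= /GRing.scale /=; field.
by rewrite lt0r_neq0 //; rewrite -!expr2 in u_gt0; rewrite lt0r_neq0.
Qed.

Lemma cpx_neq0 (u : R * R) : (cpx u != 0) = (u != 0).
Proof. by case: u => a b; rewrite /cpx eq_complex. Qed.

Lemma Re_div (u v : R * R) : u != 0 ->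
  complex.Re (cpx v / cpx u) = (u.1 * v.1 + u.2 * v.2) / (u.1 ^+ 2 + u.2 ^+ 2).
Proof. by case: u v => [a b] [c d] _ /=; ring. Qed.

(** The function log|z| is the real part of log z, whose differential is dz / z. *)
Lemma diff_Log (p v : RR4 R) : cpx p.1 != 0 -> cpx p.2 != 0 ->
  'd (@Log R) p v = (complex.Re (cpx v.1 / cpx p.1), complex.Re (cpx v.2 / cpx p.2)).
Proof.
rewrite !cpx_neq0 => p1 p2; rewrite !Re_div //.
have d1 := is_diff_fst p; have d2 := is_diff_snd p.
have l1 := ln_normc_diff p1; have l2 := ln_normc_diff p2.
have d : is_diff p (@Log R) (fun v : RR4 R =>
    ((p.1.1 * v.1.1 + p.1.2 * v.1.2) / (p.1.1 ^+ 2 + p.1.2 ^+ 2),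
     (p.2.1 * v.2.1 + p.2.2 * v.2.2) / (p.2.1 ^+ 2 + p.2.2 ^+ 2))).
  have c1 := @is_diff_comp _ _ _ _ _ _ _ _ _ d1 l1.
  have c2 := @is_diff_comp _ _ _ _ _ _ _ _ _ d2 l2.
  exact: is_diff_pair c1 c2.
by rewrite diff_val.
Qed.

End Coordinates.

(** * The critical locus *)

Section CriticalLocus.
Variable R : realType.
Notation C := R[i].
Notation rc := (real_complex R).
Implicit Types (f : laurent R) (p : RR4 R).

Definition uncpx (x : C) : R * R := (complex.Re x, complex.Im x).

Lemma uncpxK : cancel uncpx (@cpx R). Proof. by case. Qed.
Lemma cpxK : cancel (@cpx R) uncpx. Proof. by case. Qed.

Definition theta_z f (z w : C) : C :=
  \sum_(m <- finsupp f) m.1%:~R * f m * (z ^ m.1 * w ^ m.2).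
Definition theta_w f (z w : C) : C :=
  \sum_(m <- finsupp f) m.2%:~R * f m * (z ^ m.1 * w ^ m.2).

Lemma theta_zE f z w : z != 0 -> theta_z f z w = z * lder_z f z w.
Proof.
move=> z0; rewrite mulr_sumr; apply: eq_bigr => m _.
by rewrite -[in LHS](subrK 1 m.1) expfzDr // expr1z; ring.
Qed.

Lemma theta_wE f z w : w != 0 -> theta_w f z w = w * lder_w f z w.
Proof.
move=> w0; rewrite mulr_sumr; apply: eq_bigr => m _.
by rewrite -[in LHS](subrK 1 m.2) expfzDr // expr1z; ring.
Qed.

Lemma theta_neq0 f p : smooth_curve f -> curve f p ->
  (theta_z f (cpx p.1) (cpx p.2) != 0) || (theta_w f (cpx p.1) (cpx p.2) != 0).
Proof.
move=> sf fp; have [z0 w0 _] := fp; rewrite theta_zE // theta_wE //.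
rewrite !mulf_eq0 !negb_or z0 w0 /=.
by have [->|->] := sf p fp; rewrite ?orbT.
Qed.

(** In logarithmic coordinates the tangent line consists of the multiples k (-x0, x1). Their real
    parts fill the plane iff [x0] and [x1] are independent over the reals, that is, iff the Gauss
    map is not real. *)
Lemma critical_locusP f p : smooth_curve f -> curve f p ->
  let x1 := theta_z f (cpx p.1) (cpx p.2) in
  let x0 := theta_w f (cpx p.1) (cpx p.2) in
  critical_locus f p <-> x1 * x0^* = x0 * x1^*.
Proof.
move=> sf fp x1 x0; have [z0 w0 _] := fp.
have Im0 (a b : C) : a * b^* = b * a^* <-> complex.Re a * complex.Im b = complex.Re b * complex.Im a.
  case: a b => [a a'] [b b']; split=> [/eqP|/= ab].
    by rewrite eq_complex /= => /andP[_ /eqP]; lra.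
  by apply/eqP; rewrite eq_complex /=; apply/andP; split; apply/eqP; lra.
rewrite Im0; split=> [[_ crit]|x10].
  apply: contrapT => /eqP; rewrite -subr_eq0 => d0; apply: crit.
  apply/seteqP; split=> // -[a b] _.
  set d := _ - _ in d0.
  (* Cramer's rule for Re (-k x0) = a and Re (k x1) = b. *)
  pose k : C := ((b * complex.Im x0 + a * complex.Im x1) / d +i*
    ((b * complex.Re x0 + a * complex.Re x1) / d))%C.
  exists (uncpx (- k * x0 * cpx p.1), uncpx (k * x1 * cpx p.2)).
    rewrite /curve_tangent /= !uncpxK; have := theta_zE f (cpx p.2) z0.
    have := theta_wE f (cpx p.1) w0; rewrite -/x0 -/x1 => -> ->; ring.
  rewrite diff_Log // !uncpxK !mulfK //.
  case: (x0) (x1) @d d0 @k => [a0 b0] [a1 b1] d d0 k.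
  by congr pair; rewrite /k /d /=; field; exact: d0.
split=> // im; have x01 := theta_neq0 sf fp.
have tan v : curve_tangent f p v -> x1 * (cpx v.1 / cpx p.1) + x0 * (cpx v.2 / cpx p.2) = 0.
  move=> fv; rewrite [x1](theta_zE _ _ z0) [x0](theta_wE _ _ w0) -[RHS]fv.
  by field; apply/andP.
have [x00|x00] := eqVneq x0 0.
  have : [set: R * R] (1, 0) by [].
  rewrite -im => -[v /tan]; rewrite x00 mul0r addr0 => /eqP.
  rewrite mulf_eq0 /x1 -[_ == 0]negbK; move: x01; rewrite -/x1 -/x0 x00 eqxx orbF => -> /=.
  by move=> /eqP v0; rewrite diff_Log // v0 => -[] /eqP; rewrite eq_sym oner_eq0.
have [r x1r] : exists r : R, x1 = rc r * x0.
  move: x10 x00; case: (x0) (x1) => [a0 b0] [a1 b1] /= h.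
  rewrite eq_complex /= negb_and => h0; have s0 : a0 ^+ 2 + b0 ^+ 2 != 0.
    by rewrite paddr_eq0 ?sqr_ge0 // !sqrf_eq0 negb_and.
  exists ((a0 * a1 + b0 * b1) / (a0 ^+ 2 + b0 ^+ 2)); apply/eqP.
  rewrite eq_complex /=; apply/andP; split; apply/eqP/(mulIf s0).
    rewrite mul0r subr0 mulrAC divfK //.
    by have := congr1 (fun x => x * b0) h; lra.
  rewrite mul0r addr0 mulrAC divfK //.
  by have := congr1 (fun x => x * a0) h; lra.
have : [set: R * R] (0, 1) by [].
rewrite -im => -[v /tan]; rewrite x1r [rc r * x0]mulrC -mulrA -mulrDr => /eqP.
rewrite mulf_eq0 (negbTE x00) /= diff_Log // => /eqP; case: (cpx v.1 / _) (cpx v.2 / _) => [a a'] [b b'].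
move=> /eqP; rewrite eq_complex /= => /andP[/eqP ab _] [a0 b1].
by move: ab; rewrite a0 b1; lra.
Qed.
End CriticalLocus.

(** * Parametrized arcs and their tangents *)

Section LocalParam.
Variable R : realType.
Notation C := R[i].
Notation rc := (real_complex R).
Implicit Types (S : set (RR4 R)) (p : RR4 R) (phi psi : R -> RR4 R).

Definition coord (b : bool * bool) (p : RR4 R) : R :=
  let u := if b.1 then p.1 else p.2 in if b.2 then u.1 else u.2.

Lemma coord_inj p q : (forall b, coord b p = coord b q) -> p = q.
Proof.
case: p q => [[? ?] [? ?]] [[? ?] [? ?]] h.
have := h (true, true); have := h (true, false).
by have := h (false, true); have := h (false, false); rewrite /coord /= => -> -> -> ->.
Qed.

Lemma coordZ b (c : R) p : coord b (c *: p) = c * coord b p.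
Proof. by case: b => [[] []]. Qed.

Lemma coord_derive b (f : R -> RR4 R) (t : R) : derivable f t 1 ->
  is_derive t 1 (fun t => coord b (f t)) (coord b (derive1 f t)).
Proof.
move=> fd; have d1 := derive1_fst fd; have d2 := derive1_snd fd.
have e1 := @ex_derive _ _ _ _ _ _ _ d1; have e2 := @ex_derive _ _ _ _ _ _ _ d2.
have v1 : derive1 (fun t => (f t).1) t = (derive1 f t).1.
  by rewrite derive1E; exact: (@derive_val _ _ _ _ _ _ _ d1).
have v2 : derive1 (fun t => (f t).2) t = (derive1 f t).2.
  by rewrite derive1E; exact: (@derive_val _ _ _ _ _ _ _ d2).
have := derive1_fst e1; have := derive1_snd e1; have := derive1_fst e2.
by have := derive1_snd e2; rewrite v1 v2; case: b => [[] []].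
Qed.

Lemma local_param_coord S p phi b : local_param S p phi ->
  exists2 delta : R, 0 < delta & forall n (t : R), `|t| < delta ->
    is_derive t 1 (fun t => coord b (derive1n n phi t)) (coord b (derive1n n.+1 phi t)).
Proof.
move=> [_ _ [delta d0 phid] _ _]; exists delta => // n t td.
by rewrite derive1nS; apply: coord_derive; exact: phid.
Qed.

Lemma local_param_expansion S p phi : local_param S p phi ->
  exists a b : nat -> C, [/\ expands a (fun t => cpx (phi t).1),
    expands b (fun t => cpx (phi t).2),
    a 1%N = cpx (derive1 phi 0).1 & b 1%N = cpx (derive1 phi 0).2].
Proof.
move=> pphi.
have h (i : bool) : exists2 a : nat -> C,
    expands a (fun t => rc (coord (i, true) (phi t)) + 'i%C * rc (coord (i, false) (phi t))) &
    a 1%N = rc (coord (i, true) (derive1 phi 0)) + 'i%C * rc (coord (i, false) (derive1 phi 0)).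
  have [d1 d10 phi1] := local_param_coord (i, true) pphi.
  have [d2 d20 phi2] := local_param_coord (i, false) pphi.
  have e1 := expands_taylor d10 phi1; have e2 := expands_taylor d20 phi2.
  pose g j : germ C tt := fun=> fun n => rc (coord (i, j) (derive1n n phi 0) / n`!%:R).
  have e3 := @expandsZ _ unit tt 'i%C (g false) tt _ e2.
  exists ((g true + 'i%C *: g false) tt).
    exact: (@expandsD _ unit tt (g true) _ tt _ _ e1 e3).
  rewrite germD germZ /g /=.
  by rewrite !divr1.
have cE u : rc u.1 + 'i%C * rc u.2 = cpx u by rewrite [RHS]complexE; case: u.
have [a ea a1] := h true; have [b eb b1] := h false.
exists a, b; split.
- by apply: expands_eq ea _; near=> t; rewrite -cE.
- by apply: expands_eq eb _; near=> t; rewrite -cE.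
- by rewrite a1 -cE.
- by rewrite b1 -cE.
Unshelve. all: by end_near. Qed.

Definition first_order p phi b (a : R) := exists (K e : R), [/\ 0 < e, 0 <= K &
  forall t, `|t| < e -> `|coord b (phi t) - coord b p - a * t| <= K * `|t| ^+ 2].

Lemma local_param_first_order S p phi b : local_param S p phi ->
  first_order p phi b (coord b (derive1 phi 0)).
Proof.
move=> pphi; have [delta d0 phid] := local_param_coord b pphi.
have [phi0 _ _ _ _] := pphi.
have [K [e [e0 K0 hK]]] := taylor 2 d0 phid.
exists K, e; split=> // t te; move: (hK t te).
rewrite poly_def !big_ord_recl big_ord0 addr0 /= expr0 expr1 hornerD !hornerZ.
rewrite hornerX hornerC.
by rewrite phi0 /bump /= !divr1 mulr1 opprD addrA.
Qed.

(** Near [p] the points of [psi] lie on [phi], at parameters comparable to [t]. Eliminating the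
    parameter of [phi] leaves a multiple of [t] which is of order [t ^ 2]. *)
Lemma first_order_parallel S p phi psi c d (a b a' b' : R) :
  local_param S p phi -> local_param S p psi ->
  first_order p phi c a -> first_order p phi d b ->
  first_order p psi c a' -> first_order p psi d b' -> a != 0 -> b * a' = a * b'.
Proof.
move=> pphi ppsi fc fd gc gd c0.
have [Kc [ec [ec0 Kc0 hc]]] := fc.
have [Kd [ed [ed0 Kd0 hd]]] := fd.
have [Kc' [ec' [ec'0 Kc'0 hc']]] := gc.
have [Kd' [ed' [ed'0 Kd'0 hd']]] := gd.
have [phi0 _ _ _ phi_onto] := pphi.
have [psi0 Spsi [delta d0 psid] _ _] := ppsi.
have a0 : 0 < `|a| by rewrite normr_gt0.
(* The last bound keeps the quadratic error below half of the linear term, whence [|u| <= M * |t|]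
   below. *)
pose eps := Num.min (Num.min ec ed) (`|a| / (2 * (Kc + 1))).
have eps0 : 0 < eps.
  by rewrite !lt_min ec0 ed0 /= divr_gt0 // mulr_gt0 // ltr_wpDl.
have psi_cont : psi @ (0 : R) --> p.
  rewrite -psi0; apply: differentiable_continuous; apply/derivable1_diffP.
  by have := psid 0%N 0; rewrite normr0; apply.
pose M := 2 * (`|a'| + Kc') / `|a|.
pose B := (`|b| * Kc + `|a| * Kd) * M ^+ 2 + (`|b| * Kc' + `|a| * Kd').
have B0 : 0 <= B.
  by rewrite !addr_ge0 ?mulr_ge0 ?addr_ge0 ?mulr_ge0 ?sqr_ge0.
suff hB : \forall t \near (0 : R)^', `|b * a' - a * b'| <= B * `|t|.
  apply/eqP; rewrite -subr_eq0; apply: contraT => X0.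
  suff : \forall t \near (0 : R)^', False by move=> /filter_ex[].
  near=> t; have : `|b * a' - a * b'| <= B * `|t| by near: t.
  have : `|t| < `|b * a' - a * b'| / (B + 1).
    by near: t; apply: nbhs_dnbhs; apply: near0_lt; rewrite divr_gt0 ?normr_gt0 ?ltr_wpDl.
  rewrite ltr_pdivlMr ?ltr_wpDl // => h1 h2.
  by have := normr_ge0 t; nra.
near=> t.
have t0 : t != 0 by near: t; exact: nbhs_dnbhs_neq.
have tlt (e : R) : 0 < e -> \forall t \near (0 : R)^', `|t| < e.
  by move=> e0; apply: nbhs_dnbhs; exact: near0_lt.
have t1 : `|t| < 1 by near: t; exact: nbhs_dnbhs (near0_lt _).
have tc : `|t| < ec' by near: t; exact: nbhs_dnbhs (near0_lt _).
have td : `|t| < ed' by near: t; exact: nbhs_dnbhs (near0_lt _).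
have [u ueps uE] : exists2 u, `|u| < eps & phi u = psi t.
  have St : S (psi t) by near: t; apply: nbhs_dnbhs.
  have : S (psi t) -> exists2 u, `|u| < eps & phi u = psi t; last by apply.
  near: t; apply: nbhs_dnbhs.
  exact: (psi_cont _ (phi_onto eps eps0)).
move: ueps; rewrite !lt_min => /andP[/andP[uec ued] ua].
have := hc u uec; have := hd u ued; have := hc' t tc; have := hd' t td.
rewrite uE; set y := coord d _ - _; set x := coord c _ - _.
move=> yt xt yu xu.
have uM : `|u| <= M * `|t|.
  have h1 : `|a| * `|u| <= `|x| + Kc * `|u| ^+ 2.
    rewrite -normrM -[a * u](subKr x); apply: le_trans (ler_normB _ _) _.
    by rewrite lerD2l.
  have h2 : `|x| <= `|a'| * `|t| + Kc' * `|t| ^+ 2.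
    rewrite -normrM -[x in `|x|](subrK (a' * t)) addrC.
    by apply: le_trans (ler_normD _ _) _; rewrite lerD2l.
  have h3 : `|u| * (2 * (Kc + 1)) < `|a| by rewrite -ltr_pdivlMr ?mulr_gt0 ?ltr_wpDl.
  rewrite /M mulrAC ler_pdivlMr //.
  have h4 : Kc' * `|t| ^+ 2 <= Kc' * `|t|.
    by rewrite ler_wpM2l // expr2 ler_piMl // ltW.
  by have := normr_ge0 u; nra.
have tp : 0 < `|t| by rewrite normr_gt0.
rewrite -(ler_pM2r tp) -mulrA -expr2 -normrM.
have -> : (b * a' - a * b') * t =
    b * (x - a * u) - a * (y - b * u) - (b * (x - a' * t) - a * (y - b' * t)).
  by ring.
apply: le_trans (ler_normB _ _) _; rewrite /B mulrDl; apply: lerD.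
  apply: le_trans (_ : (`|b| * Kc + `|a| * Kd) * `|u| ^+ 2 <= _).
    apply: le_trans (ler_normB _ _) _; rewrite mulrDl -!mulrA !normrM.
    by apply: lerD; exact: ler_wpM2l.
  rewrite -mulrA -exprMn ler_wpM2l ?addr_ge0 ?mulr_ge0 // lerXn2r ?nnegrE //.
  exact: le_trans uM.
apply: le_trans (ler_normB _ _) _; rewrite mulrDl -!mulrA !normrM.
by apply: lerD; exact: ler_wpM2l.
Unshelve. all: by end_near. Qed.
(** [tangent_line] collects the velocities of all parametrizations; this makes it one line. *)
Lemma tangent_unique S p phi psi : local_param S p phi -> local_param S p psi ->
  exists r, derive1 psi 0 = r *: derive1 phi 0.
Proof.
move=> pphi ppsi.
have [c c0] : exists c, coord c (derive1 phi 0) != 0.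
  apply: contrapT => /forallNP h; have [_ _ _ /eqP + _] := pphi; apply.
  apply: coord_inj => b; have /negP := h b; rewrite negbK => /eqP ->.
  by case: b => [[] []].
exists (coord c (derive1 psi 0) / coord c (derive1 phi 0)).
apply: coord_inj => d; rewrite coordZ mulrAC.
apply: (mulIf c0); rewrite divfK // mulrC [RHS]mulrC.
by rewrite (first_order_parallel pphi ppsi (local_param_first_order c pphi)
  (local_param_first_order d pphi) (local_param_first_order c ppsi)
  (local_param_first_order d ppsi)).
Qed.

End LocalParam.

(** * Laurent polynomials along an arc *)

Section IntegerPowers.
Variable U : comNzRingType.
Implicit Types u v : U.

(* [u ^ m] when [v] is the inverse of [u]; germs have no unit structure. *)
Definition gpow u v (m : int) : U :=
  match m with Posz n => u ^+ n | Negz n => v ^+ n.+1 end.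

Lemma gpowS u v (m : int) : u * v = 1 -> gpow u v (m + 1) = u * gpow u v m.
Proof.
move=> uv; case: m => [n|[|n]].
- by rewrite -PoszD addn1 /= exprS.
- by rewrite /= expr0 expr1.
rewrite (_ : Negz n.+1 + 1 = Negz n); last by rewrite !NegzE; lia.
by rewrite /= [in RHS]exprS mulrA uv mul1r.
Qed.

Lemma gpowD u v (m n : int) : u * v = 1 ->
  gpow u v (m + n) = gpow u v m * gpow u v n.
Proof.
move=> uv; have pos (n' : nat) (l : int) : gpow u v (l + n'%:Z) = u ^+ n' * gpow u v l.
  elim: n' => [|n' IH]; first by rewrite addr0 mul1r.
  by rewrite -addn1 PoszD addrA gpowS // IH exprD expr1; ring.
case: n => [n|n]; first by rewrite pos mulrC.
have := pos n.+1 (m + Negz n); rewrite -addrA (_ : Negz n + _ = 0) ?addr0; last first.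
  by rewrite NegzE addNr.
by move=> ->; rewrite /= mulrAC -exprMn uv expr1n mul1r.
Qed.

Variables z z' w w' : U.

Definition gmon (m : int * int) : U := gpow z z' m.1 * gpow w w' m.2.

Hypotheses (zz' : z * z' = 1) (ww' : w * w' = 1).

Lemma gmon0 : gmon (0, 0) = 1.
Proof. by rewrite /gmon /= !expr0 mulr1. Qed.

Lemma gmonD (m n : int * int) : gmon (m + n) = gmon m * gmon n.
Proof. by rewrite /gmon /= !gpowD //; ring. Qed.

End IntegerPowers.

(* The shift [h] is meant to make the exponents nonnegative, since [absz] forgets
   signs. *)
Definition lpoly (k : numClosedFieldType) (T : Type) (r : seq T) (c : T -> k)
    (e1 e2 : T -> int) (h : nat) : {poly {poly k}} :=
  \sum_(m <- r) (c m *: 'X^(absz (e1 m + h%:Z)))%:P * 'X^(absz (e2 m + h%:Z)).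

Lemma lpoly_neq0 (k : numClosedFieldType) (T : eqType) (r : seq T) (c : T -> k)
    (e1 e2 : T -> int) (h : nat) (m0 : T) : uniq r -> m0 \in r ->
  (forall m, m \in r -> 0 <= e1 m + h%:Z /\ 0 <= e2 m + h%:Z) ->
  {in r &, forall m n, e1 m = e1 n -> e2 m = e2 n -> m = n} -> c m0 != 0 ->
  lpoly r c e1 e2 h != 0.
Proof.
move=> ru m0r rh einj; apply: contra_neq.
move=> /(congr1 (fun P : {poly {poly k}} => P`_(absz (e2 m0 + h%:Z))`_(absz (e1 m0 + h%:Z)))).
rewrite !coef0 /lpoly coef_sum coef_sum (bigD1_seq m0) //= big_seq_cond big1 ?addr0.
  by rewrite coefCM coefXn eqxx mulr1 coefZ coefXn eqxx mulr1.
move=> m /andP[mr m0m]; rewrite coefCM !coefXn.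
have [e2E|] := eqVneq; last by rewrite mulr0 coef0.
rewrite mulr1 coefZ coefXn; have [e1E|] := eqVneq; last by rewrite mulr0.
case/eqP: m0m; have [h1 h2] := rh m mr; have [h3 h4] := rh m0 m0r.
by apply: einj => //; lia.
Qed.

Lemma ev2_lpoly (k : numClosedFieldType) (U : comAlgType k) (x x' y y' : U)
    (T : eqType) (r : seq T) (c : T -> k) (e1 e2 : T -> int) (h : nat) :
  x * x' = 1 -> y * y' = 1 ->
  (forall m, m \in r -> 0 <= e1 m + h%:Z /\ 0 <= e2 m + h%:Z) ->
  ev2 x y (lpoly r c e1 e2 h) =
  x ^+ h * y ^+ h * \sum_(m <- r) c m *: (gpow x x' (e1 m) * gpow y y' (e2 m)).
Proof.
move=> xx' yy' rh; rewrite (big_morph _ (ev2D x y) (ev20 x y)) mulr_sumr.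
apply: eq_big_seq => m /rh[h1 h2]; rewrite ev2M ev2C.
have powE (u u' : U) (e : int) : u * u' = 1 -> 0 <= e + h%:Z ->
    u ^+ absz (e + h%:Z) = u ^+ h * gpow u u' e.
  move=> uu' eh; rewrite -[LHS]/(gpow u u' (absz (e + h%:Z))%:Z) gez0_abs // gpowD //=.
  by rewrite mulrC.
rewrite linearZ rmorphXn /= horner_algX /ev2 map_polyXn hornerXn.
rewrite (powE x x') // (powE y y') // -scalerAl mul1r -scalerAl -scalerAr; congr (_ *: _); ring.
Qed.

Section MonomialExpansions.
Variables (R : realType) (I : Type) (i0 : I).
Notation C := R[i].
Notation G := (@germ C I i0).
Implicit Types (u v z w : G) (i : I) (f g : R -> C).

Lemma gpow_index u v i m :
  gpow u v m i = gpow ((fun=> u i) : germ C tt) (fun=> v i) m tt.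
Proof.
have X (a : G) n : (a ^+ n) i = (((fun=> a i) : germ C tt) ^+ n) tt.
  by elim: n => [|n IH] //; rewrite !exprS; apply: funext => l; rewrite !germM IH.
by case: m => n /=; exact: X.
Qed.

Lemma expands_gpow u v i f m : u * v = 1 -> expands (u i) f -> u i 0%N != 0 ->
  expands (gpow u v m i) (fun t => f t ^ m).
Proof.
move=> uv uf u0; case: m => n; first exact: expandsX.
have [_ vf] := expandsV uv uf u0.
apply: expands_eq (expandsX n.+1 vf) _.
by near=> t; rewrite NegzE -exprnN exprVn.
Unshelve. all: by end_near. Qed.

Lemma expands_gmon z z' w w' i f g m : z * z' = 1 -> w * w' = 1 ->
  expands (z i) f -> z i 0%N != 0 -> expands (w i) g -> w i 0%N != 0 ->
  expands (gmon z z' w w' m i) (fun t => f t ^ m.1 * g t ^ m.2).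
Proof. by move=> zz' ww' zf z0 wg w0; apply: expandsM; exact: expands_gpow. Qed.

End MonomialExpansions.

(** * Continuity of roots *)

Section RootContinuity.
Variable R : realType.
Notation C := R[i].
Notation nc := (@ComplexField.Normc.normc R).

Lemma normc0 : nc 0 = 0.
Proof. by apply/eqP; rewrite normc_eq0. Qed.

(** A factor [X - x] multiplies the constant coefficient by |x| in modulus, and the bound on the
    others by at most [1 + |x| <= (1 + 1/e) |x|]. The contrapositive yields a root smaller than
    [e]. *)
Lemma coef_le_const (p : {poly C}) (e : R) : 0 < e ->
  (forall x, root p x -> e <= nc x) ->
  forall k, nc p`_k <= (1 + e^-1) ^+ size p * nc p`_0.
Proof.
move=> e0; have [r ->] := closed_field_poly_normal p.
set c := lead_coef p => roots.
have [c0|c0] := eqVneq c 0.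
  by move=> k; rewrite c0 scale0r !coef0 normc0 mulr0.
have {}roots : forall x, x \in r -> e <= nc x.
  by move=> x xr; apply: roots; rewrite rootZ // root_prod_XsubC.
have e1 : 0 <= e^-1 by rewrite invr_ge0 ltW.
have h : forall k, nc (\prod_(z <- r) ('X - z%:P))`_k <=
    (1 + e^-1) ^+ size r * nc (\prod_(z <- r) ('X - z%:P))`_0.
  elim: r roots => [_ k|x r IH roots k].
    rewrite big_nil expr0 mul1r !coef1; case: k => // k.
    by rewrite mulr0n normc0 normc_ge0.
  rewrite big_cons; set q := \prod_(z <- r) _ in IH *.
  have {}IH : forall k, nc q`_k <= (1 + e^-1) ^+ size r * nc q`_0.
    by apply: IH => z zr; apply: roots; rewrite inE zr orbT.
  have ex : e <= nc x by apply: roots; rewrite mem_head.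
  set M := (1 + e^-1) ^+ size r * nc q`_0 in IH.
  have M0 : 0 <= M by exact: le_trans (normc_ge0 _) (IH 0%N).
  rewrite mulrBl !coefB !coefXM !coefCM /= sub0r normcN ComplexField.Normc.normcM.
  have -> : (1 + e^-1) ^+ (size r).+1 * (nc x * nc q`_0) = (1 + e^-1) * nc x * M.
    by rewrite exprS /M; ring.
  have hx : 1 + nc x <= (1 + e^-1) * nc x.
    by rewrite mulrDl mul1r addrC lerD2l mulrC ler_pdivlMr // mul1r.
  apply: le_trans (_ : (1 + nc x) * M <= _); last by rewrite ler_wpM2r.
  apply: le_trans (le_normcD _ _) _; rewrite normcN ComplexField.Normc.normcM mulrDl mul1r.
  apply: lerD; last by apply: ler_wpM2l; [exact: normc_ge0|exact: IH].
  by case: eqP => _; [rewrite normc0|exact: IH].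
move=> k; rewrite !coefZ !ComplexField.Normc.normcM mulrCA ler_wpM2l ?normc_ge0 //.
apply: le_trans (h k) _; rewrite ler_wpM2r ?normc_ge0 //.
by rewrite size_scale // size_prod_XsubC ler_eXn2l ?ltrDl ?invr_gt0.
Qed.

Lemma poly_near0 (p : {poly C}) (e : R) : 0 < e -> exists2 d : R, 0 < d &
  forall x, nc x < d -> nc (p.[x] - p.[0]) < e.
Proof.
move=> e0; pose q := drop_poly 1 p.
have q0 : 0 < norm1 q + 1 by rewrite ltr_wpDl ?norm1_ge0.
exists (Num.min 1 (e / (norm1 q + 1))); first by rewrite lt_min ltr01 divr_gt0.
move=> x; rewrite lt_min => /andP[x1 xe].
have -> : p.[x] - p.[0] = q.[x] * x.
  have pE : p = (p`_0)%:P + q * 'X.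
    rewrite -[LHS](poly_take_drop 1); congr (_ + _).
    by apply/polyP => -[|n]; rewrite coef_take_poly coefC.
  by rewrite pE !hornerD !hornerM !hornerX !hornerC mulr0 addr0 addrC addKr.
rewrite ComplexField.Normc.normcM ltr_pdivlMr // in xe *.
apply: le_lt_trans xe; rewrite mulrC ler_wpM2l ?normc_ge0 //.
by apply: le_trans (horner_bound _ (ltW x1)) _; rewrite lerDl.
Qed.

Lemma isolated_roots (p : {poly C}) (a : C) : p != 0 -> exists2 d : R, 0 < d &
  forall x, nc x < d -> x != 0 -> p.[a + x] != 0.
Proof.
move=> p0; have [r pE] := closed_field_poly_normal p.
have [d d0 rd] : exists2 d : R, 0 < d & forall x, nc x < d -> x != 0 -> a + x \notin r.
  elim: (r) => [|b s [d d0 sd]]; first by exists 1.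
  have [ab|ab] := eqVneq a b.
    exists d => // x xd x0; rewrite inE negb_or sd // andbT ab.
    by rewrite -subr_eq0 addrC addKr.
  exists (Num.min d (nc (b - a))).
    by rewrite lt_min d0 normc_gt0 subr_eq0 eq_sym.
  move=> x; rewrite lt_min => /andP[xd xb] x0; rewrite inE negb_or sd // andbT.
  by apply: contraTneq xb => <-; rewrite addrC addKr ltxx.
exists d => // x xd x0; have := rd x xd x0; apply: contra => px.
by rewrite -root_prod_XsubC -(rootZ _ _ (_ : lead_coef p != 0)) ?lead_coef_eq0 // -pE.
Qed.

Definition eval2 (x y : C) (P : {poly {poly C}}) : C :=
  (map_poly (horner_eval x) P).[y].

Lemma eval2D x y : {morph eval2 x y : P Q / P + Q}.
Proof. by move=> P Q; rewrite /eval2 rmorphD hornerD. Qed.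

Lemma eval2M x y : {morph eval2 x y : P Q / P * Q}.
Proof. by move=> P Q; rewrite /eval2 rmorphM hornerM. Qed.

Lemma eval2C x y p : eval2 x y p%:P = p.[x].
Proof. by rewrite /eval2 map_polyC hornerC. Qed.

Lemma eval2_0 x y : eval2 x y 0 = 0.
Proof. by rewrite /eval2 rmorph0 horner0. Qed.

Lemma eval2_translateE (x a b : C) (P : {poly {poly C}}) :
  map_poly (horner_eval x) (translate a b P) =
  map_poly (horner_eval (x + a)) P \Po ('X + b%:P).
Proof.
rewrite /translate map_comp_poly rmorphD /= map_polyX map_polyC /=.
rewrite (_ : horner_eval x b%:P = b); last exact: hornerC.
rewrite -map_poly_comp; congr (_ \Po _).
apply: eq_map_poly => p /=; rewrite /horner_eval horner_comp.
by rewrite hornerD hornerX hornerC.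
Qed.

Lemma eval2_translate x y a b P :
  eval2 x y (translate a b P) = eval2 (x + a) (y + b) P.
Proof.
by rewrite /eval2 eval2_translateE horner_comp hornerD hornerX hornerC.
Qed.

(* Up to a denominator, [F] and [H] are multiples of the minimal relation of the
   germ, whose roots are continuous. *)
Lemma common_zero (Z W : germ C tt) (F H : {poly {poly C}}) :
  Z tt 1%N != 0 -> F != 0 -> ev2 Z W F = 0 -> ev2 Z W H = 0 ->
  forall e : R, 0 < e -> exists2 d : R, 0 < d &
    forall x, nc x < d -> x != 0 -> exists2 y, nc y < e &
      eval2 (Z tt 0%N + x) (W tt 0%N + y) F = 0 /\
      eval2 (Z tt 0%N + x) (W tt 0%N + y) H = 0.
Proof.
move=> Z1 F0 evF evH e e0; set z := Z tt 0%N; set w := W tt 0%N.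
have Zreg c : regular (Z - c%:A).
  apply: germ_regular => -[] /(congr1 (fun s : nat -> C => s 1%N)) /eqP.
  by rewrite germD germN germC subr0 (negbTE Z1).
have [P [P0 evP _ Pdiv Pprim]] := primitive_relation Zreg F0 evF.
have [c [S [c0 eF]]] := Pdiv F evF; have [c' [S' [c'0 eH]]] := Pdiv H evH.
pose T := translate z w P.
have T00 : T`_0`_0 = 0.
  have := congr1 (fun u : germ C tt => u tt 0%N) (ev2_translate Z W z w P).
  rewrite evP germ0; have [||//|_ ->] := @ev2_order _ _ tt (Z - z%:A) (W - w%:A) tt T 0.
  - by rewrite germD germN germC subrr.
  - by rewrite germD germN germC subrr.
  by rewrite big_ord1 subn0 !expr0 !mulr1.
(* As [P] is primitive, it does not vanish identically over [z]. *)
have [k Tk] : exists k, (T`_k).[0] != 0.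
  apply: contrapT => /forallNP Tk; have := Pprim z; apply/negP; rewrite negbK.
  have TE : map_poly (horner_eval 0) T = map_poly (horner_eval z) P \Po ('X + w%:P).
    by rewrite eval2_translateE add0r.
  have sP : size (map_poly (horner_eval z) P \Po ('X + w%:P)) = size (map_poly (horner_eval z) P).
    by rewrite size_comp_poly2 // -[w]opprK polyCN size_XsubC.
  rewrite -size_poly_eq0 -sP -TE size_poly_eq0; apply/eqP/polyP => n.
  by rewrite coef_map coef0; apply/eqP/negPn/negP; exact: Tk.
pose M := (1 + e^-1) ^+ size T; set a := nc (T`_k).[0].
have a0 : 0 < a by rewrite normc_gt0.
have M1 : 1 <= M by rewrite exprn_ege1 // lerDl invr_ge0 ltW.
have M0 : 0 < M := lt_le_trans ltr01 M1.
have a2 : 0 < a / 2 by rewrite divr_gt0.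
(* [d1] and [d2] keep the k-th coefficient large and the constant one small, which forces a root
   smaller than [e]; [d3] and [d4] avoid the zeros of the denominators other than [z] itself. *)
have [d1 d10 h1] := poly_near0 T`_k a2.
have [d2 d20 h2] := poly_near0 T`_0 (divr_gt0 a2 M0).
have [d3 d30 h3] := isolated_roots z c0; have [d4 d40 h4] := isolated_roots z c'0.
exists (Num.min (Num.min d1 d2) (Num.min d3 d4)); first by rewrite !lt_min d10 d20 d30.
move=> x; rewrite !lt_min => /andP[/andP[x1 x2] /andP[x3 x4]] x0.
pose t := map_poly (horner_eval x) T.
have [y yt ye] : exists2 y, root t y & nc y < e.
  apply: contrapT => /forall2NP noroot.
  have : nc t`_k <= M * nc t`_0.
    apply: le_trans (coef_le_const e0 _ k) _.
      by move=> y ty; have [//|] := noroot y; rewrite leNgt => /negP.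
    by rewrite ler_wpM2r ?normc_ge0 // /M ler_eXn2l ?size_poly // ltrDl invr_gt0.
  rewrite !coef_map /horner_eval; have := h1 x x1; have := h2 x x2.
  rewrite horner_coef0 T00 subr0 => h0 hk; rewrite leNgt => /negP; apply.
  have : a - nc ((T`_k).[x] - (T`_k).[0]) <= nc (T`_k).[x].
    rewrite -[X in _ <= nc X](subrKC (T`_k).[0]).
    by apply: le_trans (normc_lerB _ _); rewrite lerB.
  rewrite ltr_pdivlMr // mulrC in h0; lra.
have evP0 : eval2 (z + x) (w + y) P = 0.
  by rewrite [z + x]addrC [w + y]addrC -eval2_translate; apply/eqP.
have multiple G b S0 : b.[z + x] != 0 -> b *: G = S0 * P -> eval2 (z + x) (w + y) G = 0.
  move=> b0 /(congr1 (eval2 (z + x) (w + y))); rewrite -mul_polyC !eval2M evP0 mulr0 eval2C.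
  by move/eqP; rewrite mulf_eq0 (negbTE b0) /= => /eqP.
exists y => //; split.
  by apply: (multiple F c S _ eF); exact: h3.
by apply: (multiple H c' S' _ eH); exact: h4.
Qed.
End RootContinuity.

Section CommonZeroLaurent.
Variable R : realType.
Notation C := R[i].
Notation nc := (@ComplexField.Normc.normc R).

Lemma eval2_lpoly (x y : C) (T : eqType) (r : seq T) (c : T -> C) (e1 e2 : T -> int)
    (h : nat) : x != 0 -> y != 0 ->
  (forall m, m \in r -> 0 <= e1 m + h%:Z /\ 0 <= e2 m + h%:Z) ->
  eval2 x y (lpoly r c e1 e2 h) =
  x ^+ h * y ^+ h * \sum_(m <- r) c m * (x ^ e1 m * y ^ e2 m).
Proof.
move=> x0 y0 rh; rewrite (big_morph _ (eval2D x y) (eval2_0 x y)) mulr_sumr.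
apply: eq_big_seq => m /rh[h1 h2]; rewrite eval2M eval2C.
have powE (u : C) (e : int) : u != 0 -> 0 <= e + h%:Z ->
    u ^+ absz (e + h%:Z) = u ^+ h * u ^ e.
  by move=> u0 eh; rewrite -[LHS]/(u ^ (absz (e + h%:Z))%:Z) gez0_abs // expfzDr // mulrC.
rewrite hornerZ hornerXn /eval2 map_polyXn hornerXn (powE x) // (powE y) //; ring.
Qed.

Lemma exponent_shift (T : eqType) (r : seq T) (e1 e2 : T -> int) :
  exists h : nat, forall m, m \in r -> 0 <= e1 m + h%:Z /\ 0 <= e2 m + h%:Z.
Proof.
exists (\sum_(m <- r) (absz (e1 m) + absz (e2 m)))%N => m mr.
by rewrite (big_rem m mr) /=; split; lia.
Qed.

Lemma common_zero_laurent (Z Z' W W' : germ C tt) (T : eqType) (r : seq T)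
    (c c' : T -> C) (e1 e2 : T -> int) (m0 : T) :
  uniq r -> m0 \in r -> c m0 != 0 ->
  {in r &, forall m n, e1 m = e1 n -> e2 m = e2 n -> m = n} ->
  Z * Z' = 1 -> W * W' = 1 -> Z tt 1%N != 0 ->
  \sum_(m <- r) c m *: (gpow Z Z' (e1 m) * gpow W W' (e2 m)) = 0 ->
  \sum_(m <- r) c' m *: (gpow Z Z' (e1 m) * gpow W W' (e2 m)) = 0 ->
  forall e : R, 0 < e -> exists2 d : R, 0 < d &
    forall x, nc x < d -> x != 0 -> exists2 y, nc y < e &
      [/\ Z tt 0%N + x != 0, W tt 0%N + y != 0,
        \sum_(m <- r) c m * ((Z tt 0%N + x) ^ e1 m * (W tt 0%N + y) ^ e2 m) = 0 &
        \sum_(m <- r) c' m * ((Z tt 0%N + x) ^ e1 m * (W tt 0%N + y) ^ e2 m) = 0].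
Proof.
move=> ru m0r cm0 einj ZZ' WW' Z1 sc sc' e e0.
have [h rh] := exponent_shift r e1 e2.
have unit0 (u v : germ C tt) : u * v = 1 -> u tt 0%N != 0.
  move=> /(congr1 (fun a : germ C tt => a tt 0%N)); rewrite germM0 germ1.
  by apply: contra_eq_neq => ->; rewrite mul0r eq_sym oner_eq0.
set z := Z tt 0%N; set w := W tt 0%N.
have z0 : z != 0 := unit0 _ _ ZZ'; have w0 : w != 0 := unit0 _ _ WW'.
have shift_neq0 (u x : C) : u != 0 -> nc x < nc u -> u + x != 0.
  move=> u0 xu; rewrite -normc_gt0; apply: lt_le_trans (normc_lerB _ _).
  by rewrite subr_gt0.
have F0 : lpoly r c e1 e2 h != 0 by exact: lpoly_neq0 ru m0r rh einj cm0.
have ev (b : T -> C) : \sum_(m <- r) b m *: (gpow Z Z' (e1 m) * gpow W W' (e2 m)) = 0 ->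
    ev2 Z W (lpoly r b e1 e2 h) = 0.
  by move=> sb; rewrite (ev2_lpoly _ ZZ' WW' rh) sb mulr0.
have e'0 : 0 < Num.min e (nc w) by rewrite lt_min e0 normc_gt0.
have [d d0 hd] := common_zero Z1 F0 (ev c sc) (ev c' sc') e'0.
exists (Num.min d (nc z)); first by rewrite lt_min d0 normc_gt0.
move=> x; rewrite lt_min => /andP[xd xz] x0.
have [y] := hd x xd x0; rewrite lt_min => /andP[ye yw] [hF hH].
have zx0 := shift_neq0 _ _ z0 xz; have wy0 := shift_neq0 _ _ w0 yw.
exists y => //.
have back (b : T -> C) : eval2 (z + x) (w + y) (lpoly r b e1 e2 h) = 0 ->
    \sum_(m <- r) b m * ((z + x) ^ e1 m * (w + y) ^ e2 m) = 0.
  rewrite eval2_lpoly // => /eqP.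
  by rewrite !mulf_eq0 !expf_eq0 (negbTE zx0) (negbTE wy0) !andbF /= => /eqP.
by split=> //; apply: back; [exact: hF|exact: hH].
Qed.

End CommonZeroLaurent.

(** * Nonconstancy of the Gauss map along an arc *)

Section Nonconstant.
Variable R : realType.
Notation C := R[i].
Notation rc := (real_complex R).
Notation nc := (@ComplexField.Normc.normc R).
Implicit Types (S : set (RR4 R)) (p : RR4 R) (phi : R -> RR4 R) (f : laurent R).

(** Near [p] the coordinate runs along [a0 + a1 t + O(t ^ 2)] with real [t]. Meeting the orthogonal
    line [a0 + i s a1] requires |i s - t| = O(t ^ 2), and |t| is at most the left side. *)
Lemma not_on_arc S p phi (i : bool) (a : nat -> C) : local_param S p phi ->
  expands a (fun t => cpx (if i then (phi t).1 else (phi t).2)) -> a 1%N != 0 ->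
  \forall q \near p, S q -> forall s : R,
    cpx (if i then q.1 else q.2) = a 0%N + rc s * 'i%C * a 1%N -> s = 0.
Proof.
move=> [_ _ _ _ onto] ea a1.
have [K [e /= e0 hK]] := ea 2%N.
have K0 : 0 <= K.
  have [|b bK _] := hK 0; first by rewrite /= subrr normr0.
  exact: le_trans (normc_ge0 _) bK.
have eps0 : 0 < Num.min e (nc (a 1%N) / (K + 1)).
  by rewrite lt_min e0 divr_gt0 ?normc_gt0 // ltr_wpDl.
apply: filterS (onto _ eps0) => q qS Sq s.
have [t] := qS Sq; rewrite lt_min => /andP[te ta] <-.
have [|b bK ->] := hK t; first by rewrite /= sub0r normrN.
rewrite horner_poly !big_ord_recl big_ord0 addr0 /= /bump /= expr0 expr1 mulr1.
rewrite -addrA => /addrI h.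
have {}h : a 1%N * (rc s * 'i%C - rc t) = b * rc t * rc t.
  by rewrite mulrBr; apply/eqP; rewrite subr_eq [_ * (rc s * _)]mulrC -h expr2; apply/eqP; ring.
have nt : `|t| <= nc (rc s * 'i%C - rc t).
  rewrite /= !mul0r !mulr0 !mulr1 ?subr0 ?oppr0 ?addr0 ?sub0r ?add0r.
  rewrite -sqrtr_sqr ler_sqrt; last by rewrite addr_ge0 ?sqr_ge0.
  by rewrite sqrrN lerDl sqr_ge0.
have t0 : t = 0.
  apply/eqP; apply: contraTT ta => tn0; rewrite -leNgt ler_pdivrMr ?ltr_wpDl //.
  have tp : 0 < `|t| by rewrite normr_gt0.
  have : nc (a 1%N) * `|t| <= K * `|t| * `|t|.
    apply: le_trans (_ : nc (a 1%N * (rc s * 'i%C - rc t)) <= _).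
      by rewrite ComplexField.Normc.normcM ler_wpM2l ?normc_ge0.
    by rewrite h !ComplexField.Normc.normcM !normc_real !ler_wpM2r.
  by rewrite ler_pM2r // => h'; nra.
move: h; rewrite t0 rmorph0 mulr0 subr0 => /eqP.
rewrite !mulf_eq0 (negbTE a1) /= -!normc_eq0 normc_real /= !expr0n expr1n add0r sqrtr1.
by rewrite oner_eq0 orbF normr_eq0 => /eqP.
Qed.

Lemma near_cpx (p : RR4 R) (Q : set (RR4 R)) : (\forall q \near p, Q q) ->
  exists2 e : R, 0 < e & forall x y, nc (x - cpx p.1) < e -> nc (y - cpx p.2) < e ->
    Q (uncpx x, uncpx y).
Proof.
move=> /nbhs_ballP[e /= e0 hQ]; exists e => // x y xe ye; apply: hQ.
have small (u : R * R) (v : C) : nc (v - cpx u) < e -> ball u e (uncpx v).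
  case: u v => [u1 u2] [v1 v2] /=; rewrite /cpx /= => h.
  have le1 (a b : R) : `|a| <= Num.sqrt (a ^+ 2 + b ^+ 2).
    by rewrite -sqrtr_sqr ler_sqrt ?lerDl ?sqr_ge0 ?addr_ge0 ?sqr_ge0.
  have h1 : `|v1 - u1| < e := le_lt_trans (le1 _ (v2 - u2)) h.
  have h2 : `|v2 - u2| < e.
    by apply: le_lt_trans h; apply: le_trans (le1 _ (v1 - u1)) _; rewrite addrC.
  by split; rewrite /ball /= distrC.
by split; exact: small.
Qed.

Lemma real_direction_critical f (al be : R) (x y : C) : smooth_curve f ->
  (al, be) != 0 -> x != 0 -> y != 0 -> leval f x y = 0 ->
  rc al * theta_z f x y = rc be * theta_w f x y ->
  critical_locus f (uncpx x, uncpx y).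
Proof.
move=> sf ab x0 y0 fxy h.
have fp : curve f (uncpx x, uncpx y) by split; rewrite /= !uncpxK.
apply/(critical_locusP sf fp); rewrite /= !uncpxK.
have rcJ (t : R) : (rc t)^* = rc t := conjc_real t.
have hJ : rc al * (theta_z f x y)^* = rc be * (theta_w f x y)^*.
  by rewrite -[rc al]rcJ -[rc be]rcJ -!rmorphM h.
have [al0|al0] := eqVneq al 0.
  have be0 : rc be != 0.
    rewrite -normc_eq0 normc_real normr_eq0; apply: contra ab => /eqP ->.
    by rewrite al0.
  move: h; rewrite al0 rmorph0 mul0r => /esym/eqP; rewrite mulf_eq0 (negbTE be0) /= => /eqP ->.
  by rewrite rmorph0 mulr0 mul0r.
have {}al0 : rc al != 0 by rewrite -normc_eq0 normc_real normr_eq0.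
apply: (mulfI al0); rewrite mulrA h [in RHS]mulrCA hJ; ring.
Qed.

Lemma imaginary_step (a : C) (d : R) : a != 0 -> 0 < d -> exists2 s : R, s != 0 &
  nc (rc s * 'i%C * a) < d /\ rc s * 'i%C * a != 0.
Proof.
move=> a0 d0; have na : 0 < nc a by rewrite normc_gt0.
have s0 : 0 < d / 2 / nc a by rewrite !divr_gt0.
have nE : nc (rc (d / 2 / nc a) * 'i%C * a) = d / 2.
  rewrite !ComplexField.Normc.normcM normc_real gtr0_norm //=.
  by rewrite expr0n expr1n add0r sqrtr1 mulr1 divfK ?lt0r_neq0.
exists (d / 2 / nc a); first exact: lt0r_neq0.
split; first by rewrite nE; lra.
by rewrite -normc_gt0 nE divr_gt0.
Qed.

(* Otherwise the critical locus would contain a complex curve through [p], which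
   has a point in the direction ['i * derive1 phi 0], off the real arc [phi]. *)
Lemma constant_direction f p phi (z z' w w' : germ C tt) (al be : R) :
  smooth_curve f -> critical_locus f p -> local_param (critical_locus f) p phi ->
  expands (z tt) (fun t => cpx (phi t).1) -> expands (w tt) (fun t => cpx (phi t).2) ->
  z tt 1%N = cpx (derive1 phi 0).1 -> w tt 1%N = cpx (derive1 phi 0).2 ->
  z * z' = 1 -> w * w' = 1 -> (al, be) != 0 ->
  \sum_(m <- finsupp f) f m *: gmon z z' w w' m = 0 ->
  \sum_(m <- finsupp f) ((rc al * m.1%:~R - rc be * m.2%:~R) * f m) *: gmon z z' w w' m
    <> 0.
Proof.
move=> sf Sp pphi ez ew z1 w1 zz' ww' ab sc sc'.
have [phi0 _ _ dphi _] := pphi.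
have zE : z tt 0%N = cpx p.1 by rewrite -(expands0 ez) phi0.
have wE : w tt 0%N = cpx p.2 by rewrite -(expands0 ew) phi0.
have [m0 m0f] : exists m0, m0 \in finsupp f.
  have [fp _] := Sp; have := theta_neq0 sf fp; rewrite /theta_z /theta_w.
  case: (enum_fset (finsupp f)) (fun m => id : m \in enum_fset (finsupp f) -> m \in finsupp f).
    by rewrite !big_nil eqxx.
  by move=> m0 r h _; exists m0; apply: h; rewrite mem_head.
have fm0 : f m0 != 0 by rewrite -mem_finsupp.
set c' := fun m : int * int => (rc al * m.1%:~R - rc be * m.2%:~R) * f m.
have crit (x y : C) : x != 0 -> y != 0 ->
    \sum_(m <- finsupp f) f m * (x ^ m.1 * y ^ m.2) = 0 ->
    \sum_(m <- finsupp f) c' m * (x ^ m.1 * y ^ m.2) = 0 ->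
    critical_locus f (uncpx x, uncpx y).
  move=> x0 y0 h h'; apply: (real_direction_critical sf ab) => //.
    by rewrite -[RHS]h; apply: eq_bigr => m _; rewrite mulrA.
  apply/eqP; rewrite -subr_eq0 -[X in _ == X]h' /theta_z /theta_w !mulr_sumr -sumrB.
  by apply/eqP; apply: eq_bigr => m _; rewrite /c'; ring.
have inj : {in finsupp f &, forall m n, m.1 = n.1 -> m.2 = n.2 -> m = n}.
  by move=> [? ?] [? ?] _ _ /= -> ->.
have inj' : {in finsupp f &, forall m n, m.2 = n.2 -> m.1 = n.1 -> m = n}.
  by move=> [? ?] [? ?] _ _ /= -> ->.
(* A coordinate with nonzero velocity serves as the parameter of the complex curve. *)
have [z10|z10] := eqVneq (z tt 1%N) 0; last first.
  have [e e0 he] := near_cpx (not_on_arc (i := true) pphi ez z10).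
  have [d d0 hd] := common_zero_laurent (fset_uniq _) m0f fm0 inj zz' ww' z10 sc sc' e0.
  have de0 : 0 < Num.min d e by rewrite lt_min d0.
  have [s s0 []] := imaginary_step z10 de0; rewrite lt_min => /andP[xd xe] x0.
  have [y ye [zx wy h h']] := hd _ xd x0.
  case/eqP: s0; apply: (he _ (w tt 0%N + y) _ _ (crit _ _ zx wy h h')).
  - by rewrite zE addrC addKr.
  - by rewrite wE addrC addKr.
  by rewrite /= uncpxK.
have w10 : w tt 1%N != 0.
  apply: contra dphi => /eqP w10; move: z10 w10; rewrite z1 w1.
  by case: (derive1 phi 0) => [[? ?] [? ?]] [-> ->] [-> ->].
have [e e0 he] := near_cpx (not_on_arc (i := false) pphi ew w10).
have swap (b : int * int -> C) : \sum_(m <- finsupp f) b m *: gmon z z' w w' m = 0 ->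
    \sum_(m <- finsupp f) b m *: (gpow w w' m.2 * gpow z z' m.1) = 0.
  by move=> sb; rewrite -[RHS]sb; apply: eq_bigr => m _; rewrite [_ * gpow z _ _]mulrC.
have [d d0 hd] := common_zero_laurent (fset_uniq _) m0f fm0 inj' ww' zz' w10
  (swap _ sc) (swap _ sc') e0.
have de0 : 0 < Num.min d e by rewrite lt_min d0.
have [s s0 []] := imaginary_step w10 de0; rewrite lt_min => /andP[xd xe] x0.
have [y ye [wx zy h h']] := hd _ xd x0.
have unswap (b : int * int -> C) x : \sum_(m <- finsupp f) b m *
      ((w tt 0%N + x) ^ m.2 * (z tt 0%N + y) ^ m.1) = 0 ->
    \sum_(m <- finsupp f) b m * ((z tt 0%N + y) ^ m.1 * (w tt 0%N + x) ^ m.2) = 0.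
  by move=> sb; rewrite -[RHS]sb; apply: eq_bigr => m _; congr (_ * _); rewrite mulrC.
case/eqP: s0.
apply: (he (z tt 0%N + y) _ _ _ (crit _ _ zy wx (unswap _ _ h) (unswap _ _ h'))).
- by rewrite zE addrC addKr.
- by rewrite wE addrC addKr.
by rewrite /= uncpxK.
Qed.
End Nonconstant.

(** * Velocities of the contour *)

Section Velocities.
Variable R : realType.
Notation C := R[i].
Notation rc := (real_complex R).
Notation nc := (@ComplexField.Normc.normc R).
Implicit Types (p v : RR4 R) (phi : R -> RR4 R) (f : laurent R).

Definition log_velocity p v : R * R :=
  (complex.Re (cpx v.1 / cpx p.1), complex.Re (cpx v.2 / cpx p.2)).

Lemma log_velocityZ p v (c : R) : log_velocity p (c *: v) = c *: log_velocity p v.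
Proof.
have h (u w : R * R) : complex.Re (cpx (c *: u) / cpx w) = c * complex.Re (cpx u / cpx w).
  by case: u w => [u1 u2] [w1 w2] /=; rewrite /GRing.scale /=; ring.
by rewrite /log_velocity !h.
Qed.

Lemma contour_tangentE f p phi : critical_locus f p ->
  local_param (critical_locus f) p phi ->
  contour_tangent f p = [set c *: log_velocity p (derive1 phi 0) | c in setT].
Proof.
move=> [[p1 p2 _] _] pphi; apply/seteqP; split=> [_ [v [psi ppsi [c ->]] <-]|_ [c _ <-]].
  have [r ->] := tangent_unique pphi ppsi.
  exists (c * r) => //; rewrite diff_Log //.
  rewrite -[RHS]/(log_velocity p (c *: (r *: derive1 phi 0))).
  by rewrite !log_velocityZ scalerA.
exists (c *: derive1 phi 0); first by exists phi => //; exists c.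
by rewrite diff_Log // -[LHS]/(log_velocity p (c *: derive1 phi 0)) log_velocityZ.
Qed.

Lemma velocity_neq0 f p phi : critical_locus f p ->
  local_param (critical_locus f) p phi -> immersive_at f p ->
  log_velocity p (derive1 phi 0) != 0.
Proof.
move=> Sp pphi immp; have [[p1 p2 _] _] := Sp; have [_ _ _ dphi _] := pphi.
have := immp (derive1 phi 0); rewrite diff_Log //; apply => //.
by exists phi => //; exists 1; rewrite scale1r.
Qed.

Lemma line_eq (b b' : R * R) : b != 0 -> b' != 0 -> b.1 * b'.2 = b'.1 * b.2 ->
  [set c *: b | c in setT] = [set c *: b' | c in setT].
Proof.
have scE (c x y : R) : c *: ((x, y) : R * R) = (c * x, c * y) by [].
have line (a a' : R * R) : a' != 0 -> a.1 * a'.2 = a'.1 * a.2 ->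
    [set c *: a | c in setT] `<=` [set c *: a' | c in setT].
  case: a a' => [a1 a2] [a1' a2'] a'0 /= h _ [c _ <-].
  have [a10|a10] := eqVneq a1' 0.
    have a20 : a2' != 0 by apply: contraNneq a'0 => ->; rewrite a10.
    have {}h : a1 = 0 by apply: (mulIf a20); rewrite h a10 !mul0r.
    by exists (c * a2 / a2') => //; rewrite !scE h a10 !mulr0 divfK.
  exists (c * a1 / a1') => //; rewrite !scE divfK //; congr pair.
  by apply: (mulIf a10); rewrite mulrAC divfK // -mulrA h; ring.
by move=> b0 b'0 h; apply/seteqP; split; apply: line => //; rewrite h mulrC.
Qed.

Lemma velocities_independent f p p' phi phi' :
  critical_locus f p -> critical_locus f p' ->
  local_param (critical_locus f) p phi -> local_param (critical_locus f) p' phi' ->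
  immersive_at f p -> immersive_at f p' -> contour_tangent f p <> contour_tangent f p' ->
  (log_velocity p (derive1 phi 0)).1 * (log_velocity p' (derive1 phi' 0)).2 !=
  (log_velocity p' (derive1 phi' 0)).1 * (log_velocity p (derive1 phi 0)).2.
Proof.
move=> Sp Sp' pphi pphi' imm imm' ne; apply/eqP => e; apply: ne.
rewrite (contour_tangentE Sp pphi) (contour_tangentE Sp' pphi').
apply: line_eq e; first exact: velocity_neq0 imm.
exact: velocity_neq0 imm'.
Qed.

Lemma normcXz (x : C) (m : int) : nc (x ^ m) = nc x ^ m.
Proof.
case: m => n; first exact: normcX.
by rewrite -[x ^ _]/((x ^+ n.+1)^-1) ComplexField.Normc.normcV normcX.
Qed.

Lemma normc_monomial (x y : C) (m n : int) :
  nc (x ^ m * y ^ n) = nc x ^ m * nc y ^ n.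
Proof. by rewrite ComplexField.Normc.normcM !normcXz. Qed.

Lemma mul_conj (x : C) : x * x^* = rc (nc x ^+ 2).
Proof. by rewrite -normCK normc_def /nc; case: x => a b; rewrite rmorphXn. Qed.

(** The derivative of |z|^2 along an arc with value [x] and velocity [y]: up to the factor
    [2 |x|^2], the velocity of [Z] is that of log|z|. *)
Lemma conj_derivative (x y : C) : x != 0 ->
  x * y^* + y * x^* = rc (2 * nc x ^+ 2 * complex.Re (y / x)).
Proof.
move=> x0; have nx0 : nc x != 0 by rewrite normc_eq0.
have -> : x * y^* + y * x^* = rc (nc x ^+ 2) * ((y / x)^* + y / x).
  rewrite -mul_conj mulrDr rmorphM fmorphV; field.
  by rewrite conjC_eq0 x0.
rewrite addrC; have -> (z : C) : z + z^* = rc (2 * complex.Re z).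
  by case: z => a b; apply/eqP; rewrite eq_complex /=; apply/andP; split; apply/eqP; ring.
by rewrite -rmorphM; congr (rc _); ring.
Qed.

Lemma Log_inj p q : cpx p.1 != 0 -> cpx p.2 != 0 -> cpx q.1 != 0 -> cpx q.2 != 0 ->
  Log p = Log q -> nc (cpx p.1) = nc (cpx q.1) /\ nc (cpx p.2) = nc (cpx q.2).
Proof.
move=> p1 p2 q1 q2 [e1 e2].
by split; apply: ln_inj; rewrite // posrE normc_gt0.
Qed.

Lemma fiber_points f (x : R * R) (s : nat) : (critical_fiber f x #= `I_s)%card ->
  exists pt : 'I_s -> RR4 R, injective pt /\ forall j, critical_fiber f x (pt j).
Proof.
rewrite card_eq_sym => /card_set_bijP[g [gf gi _]].
exists (fun j : (ordinal s) => g j); split=> [j j' e|j]; last by apply: gf; rewrite /= ltn_ord.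
by apply/val_inj/gi => //; rewrite inE /= ltn_ord.
Qed.

End Velocities.

(** * The germs of the arcs over the nodes *)

Section Arcs.
Variable R : realType.
Notation C := R[i].
Notation rc := (real_complex R).
Notation nc := (@ComplexField.Normc.normc R).
Variables (f : laurent R) (I : finType) (i0 : I).
Notation G := (@germ C I i0).
Notation A := (enum_fset (finsupp f)).
Variables (p : I -> RR4 R) (phi : I -> R -> RR4 R) (z z' w w' : G).
Hypothesis sf : smooth_curve f.
Hypothesis p_crit : forall i, critical_locus f (p i).
Hypothesis p_phi : forall i, local_param (critical_locus f) (p i) (phi i).
Hypothesis z_exp : forall i, expands (z i) (fun t => cpx (phi i t).1).
Hypothesis w_exp : forall i, expands (w i) (fun t => cpx (phi i t).2).
Hypothesis z1 : forall i, z i 1%N = cpx (derive1 (phi i) 0).1.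
Hypothesis w1 : forall i, w i 1%N = cpx (derive1 (phi i) 0).2.
Hypothesis zz' : z * z' = 1.
Hypothesis ww' : w * w' = 1.

Definition arc_mon : Z2 -> G := gmon z z' w w'.
Definition arc_mons (m : Z2) : G := germ_conj (arc_mon m).

Let p_curve i : curve f (p i). Proof. by have [] := p_crit i. Qed.

Lemma arc_z0 i : z i 0%N = cpx (p i).1.
Proof. by rewrite -(expands0 (z_exp i)); have [-> _ _ _ _] := p_phi i. Qed.

Lemma arc_w0 i : w i 0%N = cpx (p i).2.
Proof. by rewrite -(expands0 (w_exp i)); have [-> _ _ _ _] := p_phi i. Qed.

Let z_neq0 i : z i 0%N != 0. Proof. by rewrite arc_z0; have [] := p_curve i. Qed.
Let w_neq0 i : w i 0%N != 0. Proof. by rewrite arc_w0; have [] := p_curve i. Qed.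

Lemma arc_mon0 : arc_mon 0 = 1. Proof. exact: gmon0. Qed.
Lemma arc_monD a b : arc_mon (a + b) = arc_mon a * arc_mon b.
Proof. exact: gmonD. Qed.
Lemma arc_mons0 : arc_mons 0 = 1.
Proof. by rewrite /arc_mons arc_mon0 germ_conj1. Qed.
Lemma arc_monsD a b : arc_mons (a + b) = arc_mons a * arc_mons b.
Proof. by rewrite /arc_mons arc_monD germ_conjM. Qed.
Lemma arc_mon_e1 : arc_mon e1 = z.
Proof. by rewrite /arc_mon /gmon /= expr1 expr0 mulr1. Qed.
Lemma arc_mon_e2 : arc_mon e2 = w.
Proof. by rewrite /arc_mon /gmon /= expr1 expr0 mul1r. Qed.

Lemma expands_arc (c : Z2 -> C) i :
  expands ((\sum_(m <- A) c m *: arc_mon m) i)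
    (fun t => \sum_(m <- A) c m * (cpx (phi i t).1 ^ m.1 * cpx (phi i t).2 ^ m.2)).
Proof.
by apply: expands_sum => m; apply: expandsZ; exact: expands_gmon.
Qed.

Lemma arc_relation : \sum_(m <- A) f m *: arc_mon m = 0.
Proof.
apply: germP => i n; rewrite (@expands_uniq _ _ i0 _ i) //.
apply: expands_eq (expands_arc f i) _; have [_ Sphi _ _ _] := p_phi i.
apply: filterS Sphi => t [[_ _ ft] _]; rewrite -[RHS]ft.
by apply: eq_bigr => m _; rewrite mulrA.
Qed.

Lemma conj_arc_sum (c : Z2 -> C) :
  \sum_(m <- A) (c m)^* *: arc_mons m = germ_conj (\sum_(m <- A) c m *: arc_mon m).
Proof. by rewrite germ_conj_sum; apply: eq_bigr => m _; rewrite germ_conjZ. Qed.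

Definition arc_theta1 : G := \sum_(m <- A) (m.1%:~R * f m) *: arc_mon m.
Definition arc_theta0 : G := \sum_(m <- A) (m.2%:~R * f m) *: arc_mon m.

Lemma arc_critical : arc_theta1 * germ_conj arc_theta0 = arc_theta0 * germ_conj arc_theta1.
Proof.
apply/eqP; rewrite -subr_eq0 -mulN1r; apply/eqP/germP => i n.
have e1 := @expands_arc (fun m => m.1%:~R * f m) i.
have e2 := @expands_arc (fun m => m.2%:~R * f m) i.
rewrite (@expands_uniq _ _ i0 _ i) //.
have E := expandsD (expandsM e1 (expands_conj e2))
  (expandsM (expandsC i0 (-1) i) (expandsM e2 (expands_conj e1))).
rewrite (_ : -1 = (-1)%:A :> G); last by rewrite scaleN1r.
apply: expands_eq E _; have [_ Sphi _ _ _] := p_phi i.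
apply: filterS Sphi => t Sp; have [ft _] := Sp.
have /(critical_locusP sf ft)/= h := Sp.
by rewrite mulN1r; apply/eqP; rewrite subr_eq0; apply/eqP.
Qed.

Lemma arc_theta1_0 i : arc_theta1 i 0%N = theta_z f (cpx (p i).1) (cpx (p i).2).
Proof.
have e := expands0 (@expands_arc (fun m => m.1%:~R * f m) i).
by have [ph _ _ _ _] := p_phi i; rewrite ph in e; exact: esym e.
Qed.

Lemma arc_theta0_0 i : arc_theta0 i 0%N = theta_w f (cpx (p i).1) (cpx (p i).2).
Proof.
have e := expands0 (@expands_arc (fun m => m.2%:~R * f m) i).
by have [ph _ _ _ _] := p_phi i; rewrite ph in e; exact: esym e.
Qed.

Lemma avoid_zeros (a b : I -> C) : (forall i, (a i != 0) || (b i != 0)) ->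
  exists n : nat, forall i, a i + n%:R * b i != 0.
Proof.
move=> ab; have [n ns] := nat_avoid [seq - a i / b i | i <- enum I].
exists n => i; apply: contra ns => /eqP e; have [b0|b0] := eqVneq (b i) 0.
  by move: e (ab i); rewrite b0 mulr0 addr0 => ->; rewrite eqxx.
apply/mapP; exists i; first by rewrite mem_enum.
by apply: (mulIf b0); rewrite divfK //; apply/eqP; rewrite -addr_eq0 addrC e.
Qed.

(** A natural [n] is fixed by conjugation, so that the denominator [u] and its conjugate have the
    same shape; criticality along the arcs then gives both curves the same [lam]. *)
Lemma arc_direction : exists (n : nat) (lam : G),
  let th : C := n%:R in let u := arc_theta0 + th *: arc_theta1 in
  [/\ regular u, regular (germ_conj u), arc_theta1 = lam * u,
    germ_conj arc_theta1 = lam * germ_conj u &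
    forall i c, (lam - c%:A) i <> (fun=> 0)].
Proof.
have [n nP] : exists n : nat, forall i, arc_theta0 i 0%N + n%:R * arc_theta1 i 0%N != 0.
  apply: avoid_zeros => i; rewrite arc_theta0_0 arc_theta1_0 orbC.
  exact: theta_neq0.
set th : C := n%:R in nP; set u := arc_theta0 + th *: arc_theta1.
have u0 i : u i 0%N != 0 by exact: nP.
have [v uv] := germ_inverse u0.
have thJ : th^* = th by rewrite /th rmorph_nat.
have uJ : germ_conj u = germ_conj arc_theta0 + th *: germ_conj arc_theta1.
  by rewrite /u germ_conjD germ_conjZ thJ.
have cross : arc_theta1 * germ_conj u = germ_conj arc_theta1 * u.
  by rewrite uJ /u !mulrDr -!scalerAr arc_critical [in LHS]mulrC [X in _ + _ *: X]mulrC.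
have E1 : arc_theta1 = arc_theta1 * v * u by rewrite -mulrA [v * u]mulrC uv mulr1.
have E2 : germ_conj arc_theta1 = arc_theta1 * v * germ_conj u.
  by rewrite mulrAC cross -mulrA uv mulr1.
exists n, (arc_theta1 * v); split=> //.
- apply: germ_regular => i /(congr1 (fun s : nat -> C => s 0%N)) ui.
  by move: (u0 i); rewrite (ui : u i 0%N = 0) eqxx.
- apply: germ_regular => i /(congr1 (fun s : nat -> C => s 0%N)) ui.
  by move: (u0 i); rewrite -conjC_eq0 (ui : (u i 0%N)^* = 0) eqxx.
(* A constant value [c] is real, as [lam] serves both [arc_theta1] and its conjugate. This gives the
   real linear relation between the two derivatives that [constant_direction] excludes. *)
move=> i c; set lam := arc_theta1 * v; move=> lc.
have lam0 : lam i 0%N = c.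
  have := congr1 (fun s : nat -> C => s 0%N) lc; rewrite germD germN germC /= => /eqP.
  by rewrite subr_eq0 => /eqP.
have cJ : c^* = c.
  have h1 := congr1 (fun s : G => s i 0%N) E1; rewrite germM0 -/lam lam0 in h1.
  have h2 := congr1 (fun s : G => s i 0%N) E2; rewrite germM0 -/lam lam0 in h2.
  rewrite -[LHS]/((arc_theta1 i 0%N)^*) in h2.
  have uJ0 : (u i 0%N)^* != 0 by rewrite conjC_eq0.
  by apply: (mulIf uJ0); rewrite -[RHS]/(c * germ_conj u i 0%N) -h2 h1 rmorphM.
pose be := complex.Re c; have cE : c = rc be.
  case: (c) cJ @be => a b /eqP; rewrite eq_complex /= => /andP[_ /eqP h].
  by apply/eqP; rewrite eq_complex /= eqxx /=; apply/eqP; lra.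
pose al : R := 1 - be * n%:R.
have alE : rc al = 1 - c * th.
  by rewrite /al rmorphB rmorph1 rmorphM rmorph_nat [in RHS]cE.
have ab : (al, be) != 0.
  apply/eqP => -[]; rewrite /al => + be0; rewrite be0 mul0r subr0 => /eqP.
  by rewrite oner_eq0.
have flat : (rc al *: arc_theta1 - rc be *: arc_theta0) i = (fun=> 0).
  have -> : rc al *: arc_theta1 - rc be *: arc_theta0 = (lam - c%:A) * u.
    rewrite mulrBl -E1 mulr_algl /u scalerDr scalerA opprD addrCA addrC.
    by rewrite alE -cE scalerBl scale1r addrAC.
  apply: funext => k; rewrite germM big1 // => j _.
  by rewrite (congr1 (fun s : nat -> C => s j) lc) mul0r.
pose zi : germ C tt := fun=> z i; pose zi' : germ C tt := fun=> z' i.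
pose wi : germ C tt := fun=> w i; pose wi' : germ C tt := fun=> w' i.
have restr (b b' : G) : b * b' = 1 ->
    ((fun=> b i) : germ C tt) * ((fun=> b' i) : germ C tt) = 1.
  by move=> bb'; apply: germP => -[] k; exact: (congr1 (fun s : G => s i k) bb').
have sumE (b : Z2 -> C) k : (\sum_(m <- A) b m *: arc_mon m) i k =
    (\sum_(m <- A) b m *: gmon zi zi' wi wi' m) tt k.
  rewrite !germ_sum; apply: eq_bigr => m _; rewrite !germZ; congr (_ * _).
  rewrite /arc_mon /gmon !germM; apply: eq_bigr => j _.
  by rewrite !(gpow_index _ _ i).
apply: (constant_direction sf (p_crit i) (p_phi i) (z_exp i : expands (zi tt) _)
  (w_exp i : expands (wi tt) _) (z1 i : zi tt 1%N = _) (w1 i : wi tt 1%N = _)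
  (restr _ _ zz') (restr _ _ ww') ab).
  by apply: germP => -[] k; rewrite -sumE arc_relation.
apply: germP => -[] k; rewrite -sumE -[RHS](congr1 (fun s : nat -> C => s k) flat).
rewrite /arc_theta1 /arc_theta0 !scaler_sumr -sumrB; congr ((_ : G) i k).
by apply: eq_bigr => m _; rewrite !scalerA -scalerBl; congr (_ *: _); ring.
Qed.

End Arcs.

Section NodeBound.
Variable R : realType.
Notation C := R[i].
Notation rc := (real_complex R).
Notation nc := (@ComplexField.Normc.normc R).
Notation A f := (enum_fset (finsupp f)).

(* [d] bounds, for every curve with the support of [f], the degree of the
   monomial [u] on that curve. *)
Definition support_degree (f : laurent R) (u : Z2) (d : nat) :=
  forall (U : comAlgType C) (mon : Z2 -> U) (h : Z2 -> C), mon 0 = 1 ->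
    (forall a b, mon (a + b) = mon a * mon b) -> (forall a : Z2, a \in A f -> h a != 0) ->
    \sum_(a <- A f) h a *: mon a = 0 -> deg_le mon u d.

Lemma scaled_cross (a b : R) (v v' : R * R) : a != 0 -> b != 0 ->
  v.1 * v'.2 != v'.1 * v.2 ->
  rc (2 * a ^+ 2 * v.1) * rc (2 * b ^+ 2 * v'.2) !=
  rc (2 * a ^+ 2 * v'.1) * rc (2 * b ^+ 2 * v.2).
Proof.
move=> a0 b0; apply: contra_neq => /(congr1 (fun c : C => complex.Re c)) /=.
rewrite !mul0r !subr0 => h.
have c0 : 4 * a ^+ 2 * b ^+ 2 != 0 by rewrite !mulf_neq0 ?expf_neq0 ?pnatr_eq0.
apply: (mulfI c0).
rewrite (_ : _ * (v.1 * v'.2) = 2 * a ^+ 2 * v.1 * (2 * b ^+ 2 * v'.2)); last by ring.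
by rewrite h; ring.
Qed.

Lemma node_bound (f : laurent R) (s N n0 d1 d2 : nat) (x : 'I_N -> R * R) (u1 u2 : Z2) :
  smooth_curve f -> smooth_real_curve (critical_locus f) -> (2 <= s)%N ->
  injective x -> (forall n, s_node f s (x n)) ->
  A f != [::] -> area_bound (A f) n0 -> u1.1 * u2.2 - u1.2 * u2.1 != 0 ->
  support_degree f u1 d1 -> support_degree f u2 d2 ->
  (N * (s * s.-1) <= 2 * ((2 * n0 * d1) * (2 * n0 * d2)))%N.
Proof.
move=> sf srf s2 xinj xnode A0 hA u12 du1 du2.
have [->|N0] := posnP N; first by rewrite mul0n.
pose I := ('I_N * 'I_s)%type.
have s0 : (0 < s)%N by exact: leq_trans s2.
pose i0 : I := (Ordinal N0, Ordinal s0).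
have [pt ptP] : {pt : forall n, 'I_s -> RR4 R & forall n, injective (pt n) /\
    forall j, critical_fiber f (x n) (pt n j)}.
  apply: (@boolp.choice _ _ (fun n g => injective g /\ forall j, critical_fiber f (x n) (g j))) => n.
  by have [_ card _ _] := xnode n; exact: fiber_points.
pose p (i : I) := pt i.1 i.2.
have p_fib i : critical_fiber f (x i.1) (p i) by have [_] := ptP i.1; apply.
have p_crit i : critical_locus f (p i) by have [] := p_fib i.
have p_log i : Log (p i) = x i.1 by have [] := p_fib i.
have p_inj : injective p.
  move=> [n j] [n' j'] e; have nn' : n = n'.
    by apply: xinj; rewrite -(p_log (n, j)) -(p_log (n', j')) e.
  by move: e; rewrite -nn' /p /= => /(ptP n).1 ->.
have [phi p_phi] : {phi : I -> R -> RR4 R & forall i, local_param (critical_locus f) (p i) (phi i)}.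
  by apply: (@boolp.choice _ _ (fun i g => local_param (critical_locus f) (p i) g)) => i; exact: srf.
have [zw zwP] : {zw : I -> (nat -> C) * (nat -> C) & forall i,
    [/\ expands (zw i).1 (fun t => cpx (phi i t).1), expands (zw i).2 (fun t => cpx (phi i t).2),
     (zw i).1 1%N = cpx (derive1 (phi i) 0).1 & (zw i).2 1%N = cpx (derive1 (phi i) 0).2]}.
  apply: (@boolp.choice _ _ (fun i (g : (nat -> C) * (nat -> C)) =>
    [/\ expands g.1 (fun t => cpx (phi i t).1), expands g.2 (fun t => cpx (phi i t).2),
     g.1 1%N = cpx (derive1 (phi i) 0).1 & g.2 1%N = cpx (derive1 (phi i) 0).2])) => i.
  by have [a [b abP]] := local_param_expansion (p_phi i); exists (a, b).
pose z : germ C i0 := fun i => (zw i).1; pose w : germ C i0 := fun i => (zw i).2.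
have z_exp i : expands (z i) (fun t => cpx (phi i t).1) by have [] := zwP i.
have w_exp i : expands (w i) (fun t => cpx (phi i t).2) by have [] := zwP i.
have z1 i : z i 1%N = cpx (derive1 (phi i) 0).1 by have [] := zwP i.
have w1 i : w i 1%N = cpx (derive1 (phi i) 0).2 by have [] := zwP i.
have z0 i : z i 0%N = cpx (p i).1.
  by rewrite -(expands0 (z_exp i)); have [-> _ _ _ _] := p_phi i.
have w0 i : w i 0%N = cpx (p i).2.
  by rewrite -(expands0 (w_exp i)); have [-> _ _ _ _] := p_phi i.
have pz i : cpx (p i).1 != 0 by have [[]] := p_crit i.
have pw i : cpx (p i).2 != 0 by have [[]] := p_crit i.
have [z' zz'] : exists z', z * z' = 1 by apply: germ_inverse => i; rewrite z0.
have [w' ww'] : exists w', w * w' = 1 by apply: germ_inverse => i; rewrite w0.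
have [n [lam]] := arc_direction sf p_crit p_phi z_exp w_exp z1 w1 zz' ww'.
set mon := arc_mon z z' w w'; pose mons := arc_mons z z' w w'.
move=> [X_reg Y_reg X1E Y1E lam_nc].
have mon0 : mon 0 = 1 by exact: arc_mon0.
have monD a b : mon (a + b) = mon a * mon b by exact: arc_monD.
have mons0 : mons 0 = 1 by exact: arc_mons0.
have monsD a b : mons (a + b) = mons a * mons b by exact: arc_monsD.
have fA a : a \in A f -> f a != 0 by move=> aA; rewrite -mem_finsupp.
have gA a : a \in A f -> (f a)^* != 0 by move=> /fA; rewrite conjC_eq0.
have feq : \sum_(a <- A f) f a *: mon a = 0 by exact: arc_relation p_phi z_exp w_exp zz' ww'.
have geq : \sum_(a <- A f) (f a)^* *: mons a = 0.
  by rewrite conj_arc_sum feq; apply: germP => i k; exact: conjC0.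
have theta1J : germ_conj (arc_theta1 f z z' w w') =
    \sum_(a <- A f) (a.1%:~R * (f a)^*) *: mons a.
  by rewrite -conj_arc_sum; apply: eq_bigr => a _; rewrite rmorphM rmorph_int.
have theta0J : germ_conj (arc_theta0 f z z' w w') =
    \sum_(a <- A f) (a.2%:~R * (f a)^*) *: mons a.
  by rewrite -conj_arc_sum; apply: eq_bigr => a _; rewrite rmorphM rmorph_int.
rewrite germ_conjD germ_conjZ rmorph_nat theta1J theta0J in Y_reg Y1E.
have modulus k j j' : nc (cpx (p (k, j)).1) = nc (cpx (p (k, j')).1) /\
    nc (cpx (p (k, j)).2) = nc (cpx (p (k, j')).2).
  by apply: Log_inj => //; rewrite !p_log.
have mon_val u i : mon u i 0%N = cpx (p i).1 ^ u.1 * cpx (p i).2 ^ u.2.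
  have zi : z i 0%N != 0 by rewrite z0.
  have wi : w i 0%N != 0 by rewrite w0.
  have := expands0 (expands_gmon u zz' ww' (z_exp i) zi (w_exp i) wi).
  by have [-> _ _ _ _] := p_phi i.
(* At a critical point [Z] and [W] are |z|^2 and |w|^2, which [Log] determines: they agree over a
   node. *)
have ZZ_val u i : (mon u * mons u) i 0%N =
    rc ((nc (cpx (p i).1) ^ u.1 * nc (cpx (p i).2) ^ u.2) ^+ 2).
  transitivity (mon u i 0%N * (mon u i 0%N)^*); first exact: germM0.
  by rewrite mul_conj mon_val normc_monomial.
have ZZ0 u k j j' : (mon u * mons u) (k, j) 0%N = (mon u * mons u) (k, j') 0%N.
  by rewrite !ZZ_val; have [-> ->] := modulus k j j'.
have mon_e1 : mon e1 = z by exact: arc_mon_e1.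
have mon_e2 : mon e2 = w by exact: arc_mon_e2.
have ZZe1 i : (mon e1 * mons e1) i 1%N =
    rc (2 * nc (cpx (p i).1) ^+ 2 * (log_velocity (p i) (derive1 (phi i) 0)).1).
  transitivity (mon e1 i 0%N * (mon e1 i 1%N)^* + mon e1 i 1%N * (mon e1 i 0%N)^*).
    exact: germM1.
  by rewrite mon_e1 z0 z1; exact: conj_derivative.
have ZZe2 i : (mon e2 * mons e2) i 1%N =
    rc (2 * nc (cpx (p i).2) ^+ 2 * (log_velocity (p i) (derive1 (phi i) 0)).2).
  transitivity (mon e2 i 0%N * (mon e2 i 1%N)^* + mon e2 i 1%N * (mon e2 i 0%N)^*).
    exact: germM1.
  by rewrite mon_e2 w0 w1; exact: conj_derivative.
have ZZ1 k j j' : j != j' ->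
    (mon e1 * mons e1) (k, j) 1%N * (mon e2 * mons e2) (k, j') 1%N !=
    (mon e1 * mons e1) (k, j') 1%N * (mon e2 * mons e2) (k, j) 1%N.
  move=> jj'; have [_ _ imm tan] := xnode k.
  have pp' : p (k, j) <> p (k, j') by move=> /p_inj[e]; rewrite e eqxx in jj'.
  have := velocities_independent (p_crit (k, j)) (p_crit (k, j')) (p_phi (k, j))
    (p_phi (k, j')) (imm _ (p_fib (k, j))) (imm _ (p_fib (k, j')))
    (tan _ _ (p_fib (k, j)) (p_fib (k, j')) pp').
  have [ez ew] := modulus k j j'.
  have := ZZe1 (k, j); have := ZZe1 (k, j'); have := ZZe2 (k, j); have := ZZe2 (k, j').
  rewrite -ez -ew => -> -> -> ->.
  by apply: scaled_cross; rewrite normc_eq0.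
(* A generic combination [z + n' w] must have nonzero velocity on each germ and separate each pair.
   The default 1 on the diagonal of the pairs makes that condition void. *)
pose J := (I + I * I)%type.
pose dz (k : J) := match k with inl i => z i 1%N | inr (i, i') =>
  if i == i' then 1 else z i 0%N - z i' 0%N end.
pose dw (k : J) := match k with inl i => w i 1%N | inr (i, i') => w i 0%N - w i' 0%N end.
have dzw k : (dz k != 0) || (dw k != 0).
  rewrite -negb_and; apply/negP => /andP[/eqP + /eqP]; case: k => [i|[i i']] /=.
    rewrite z1 w1 => dz0 dw0; have [_ _ _ /eqP + _] := p_phi i; apply.
    by move: dz0 dw0; case: (derive1 (phi i) 0) => [[? ?] [? ?]] [-> ->] [-> ->].
  case: eqVneq => [_ /eqP|/eqP ii' /eqP]; first by rewrite oner_eq0.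
  rewrite subr_eq0 => /eqP zii' /eqP; rewrite subr_eq0 => /eqP wii'; apply: ii'; apply: p_inj.
  move: zii' wii'; rewrite !z0 !w0 => /(can_inj (@cpxK R)) e /(can_inj (@cpxK R)) e'.
  by rewrite [p i]surjective_pairing e e' -surjective_pairing.
have [n' n'P] := avoid_zeros dzw.
pose l := mon e1 + n'%:R *: mon e2.
pose E1 : seq (Z2 * Z2) := [:: (e1, 0); (e2, 0)].
have lE : lspan (mset (mon4 mon mons) E1) l.
  apply: lspanD; last apply: lspanZ.
    have -> : mon e1 = mon4 mon mons (e1, 0) by rewrite /mon4 mons0 mulr1.
    by apply: lspan_mem; apply: mset_mem; rewrite mem_head.
  have -> : mon e2 = mon4 mon mons (e2, 0) by rewrite /mon4 mons0 mulr1.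
  by apply: lspan_mem; apply: mset_mem; rewrite !inE eqxx orbT.
have l0 i i' : i != i' -> l i 0%N != l i' 0%N.
  move=> ii'; have := n'P (inr (i, i')).
  rewrite /= (negbTE ii') /l mon_e1 mon_e2 !germD !germZ.
  by apply: contra_neq => e; rewrite mulrBr addrACA -opprD e subrr.
have l1 i : l i 1%N != 0.
  by have := n'P (inl i); rewrite /= /l mon_e1 mon_e2 germD germZ.
have bound := algebraic_bound mon0 monD mons0 monsD A0 fA gA (fset_uniq _) feq geq hA
  X_reg Y_reg X1E Y1E lam_nc s2 ZZ0 ZZ1 lE l0 l1 u12
  (du1 _ mon f mon0 monD fA feq) (du2 _ mon f mon0 monD fA feq)
  (du1 _ mons _ mons0 monsD gA geq) (du2 _ mons _ mons0 monsD gA geq).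
by rewrite card_ord in bound.
Qed.
End NodeBound.

(** * The bounds *)

Section Counting.

(** An infinite set contains arbitrarily large finite families, so that a bound on these gives
    finiteness too. *)
Lemma card_bound (T : choiceType) (X : set T) (M : nat) :
  (forall N (x : 'I_N -> T), injective x -> (forall n, X (x n)) -> (N <= M)%N) ->
  finite_set X /\ (#|` fset_set X| <= M)%N.
Proof.
move=> h.
have sub (B : {fset T}) : [set` B] `<=` X -> (#|` B| <= M)%N.
  move=> BX; have [->|B0] := eqVneq B fset0; first by rewrite cardfs0.
  have /fset0Pn[b0 _] := B0.
  apply: (h _ (fun n : 'I_#|` B| => nth b0 B n)) => [n n' /eqP|n].
    by rewrite nth_uniq ?fset_uniq // => /eqP; exact: val_inj.
  by apply: BX; rewrite /= mem_nth.
have fX : finite_set X.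
  apply: contrapT => /(infinite_set_fset M.+1)[B BX].
  by rewrite leqNgt ltnS sub.
by split=> //; apply: sub; rewrite fset_setK.
Qed.

Lemma simplex_range (a a' v : Z2) (d h : nat) :
  [&& 0 <= a.1 + v.1, 0 <= a.2 + v.2 & a.1 + v.1 + (a.2 + v.2) <= d%:Z] ->
  [&& 0 <= a'.1 + v.1, 0 <= a'.2 + v.2 & a'.1 + v.1 + (a'.2 + v.2) <= d%:Z] ->
  (a'.1 = a.1 + h%:Z -> (h <= d)%N) /\ (a'.2 = a.2 + h%:Z -> (h <= d)%N).
Proof. by move=> /and3P[? ? ?] /and3P[? ? ?]; split; lia. Qed.

End Counting.

Section Assembly.
Variable R : realType.
Notation C := R[i].
Notation A f := (enum_fset (finsupp f)).

Lemma newton_polygonE (f : laurent R) : newton_polygon f = polygon (A f).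
Proof.
by congr (hull (_ @` _)); apply: funext => m; rewrite /= mem_finsupp.
Qed.

Lemma area_ge0 (Delta : set (R * R)) : 0 <= area Delta.
Proof. exact: fine_ge0. Qed.

Lemma support_degree_box (f : laurent R) (al be : int) (h1 h2 : nat) : A f != [::] ->
  (forall a : Z2, a \in A f ->
    [&& al <= a.1, a.1 <= al + h1%:Z, be <= a.2 & a.2 <= be + h2%:Z]) ->
  support_degree f e1 h2 /\ support_degree f e2 h1.
Proof.
move=> A0 box; split=> U mon h mon0 monD hA heq.
  exact: (deg_fst monD A0 hA (fset_uniq _) heq box).
exact: (deg_snd monD A0 hA (fset_uniq _) heq box).
Qed.

Lemma support_degree_edge (f : laurent R) (n0 : nat) (m0 m1 : Z2) :
  area_bound (A f) n0 -> m0 \in A f -> m1 \in A f -> support_degree f (m1 - m0) n0.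
Proof.
move=> hA m0A m1A U mon h mon0 monD hA' heq.
have A0 : A f != [::] by case: (A f) m0A.
exact: (deg_edge mon0 monD A0 hA' (fset_uniq _) heq hA m0A m1A).
Qed.

End Assembly.

Section Bounds.
Variable R : realType.
Notation A f := (enum_fset (finsupp f)).

Section Curve.
Variables (f : laurent R) (s : nat) (nodes : set (R * R)).
Hypothesis sf : smooth_curve f.
Hypothesis srf : smooth_real_curve (critical_locus f).
Hypothesis s2 : (2 <= s)%N.
Hypothesis sub : nodes `<=` s_node f s.
Hypothesis A0 : A f != [::].

Lemma nodes_card (n0 d1 d2 : nat) (u1 u2 : Z2) : area_bound (A f) n0 ->
  u1.1 * u2.2 - u1.2 * u2.1 != 0 -> support_degree f u1 d1 -> support_degree f u2 d2 ->
  finite_set nodes /\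
  (#|` fset_set nodes| * (s * s.-1) <= 2 * ((2 * n0 * d1) * (2 * n0 * d2)))%N.
Proof.
move=> hA u12 du1 du2; pose M := (2 * ((2 * n0 * d1) * (2 * n0 * d2)))%N.
have ss0 : (0 < s * s.-1)%N by rewrite muln_gt0; lia.
have [fin card] : finite_set nodes /\ (#|` fset_set nodes| <= M %/ (s * s.-1))%N.
  apply: card_bound => N x xinj xn; rewrite leq_divRL //.
  by apply: (node_bound sf srf s2 xinj _ A0 hA u12 du1 du2) => n; exact: sub.
by split=> //; rewrite -leq_divRL.
Qed.

Lemma nodes_floor (n0 d1 d2 : nat) (u1 u2 : Z2) (n w1 w2 : R) :
  area_bound (A f) n0 ->
  u1.1 * u2.2 - u1.2 * u2.1 != 0 -> support_degree f u1 d1 -> support_degree f u2 d2 ->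
  n0%:R <= n -> d1%:R <= w1 -> d2%:R <= w2 ->
  (#|` fset_set nodes|%:Z <=
     Num.floor (8 * n ^+ 2 * w1 * w2 / (s%:R * (s%:R - 1))))%R.
Proof.
move=> hA u12 du1 du2 hn h1 h2; have [_ card] := nodes_card hA u12 du1 du2.
have s1 : s%:R - 1 = s.-1%:R :> R by rewrite -subn1 natrB // ltnW.
have ss0 : 0 < (s * s.-1)%:R :> R by rewrite ltr0n muln_gt0; lia.
rewrite floor_ge_int s1 -natrM ler_pdivlMr //.
have n00 : 0 <= n0%:R :> R by [].
have d10 : 0 <= d1%:R :> R by [].
have d20 : 0 <= d2%:R :> R by [].
apply: (@le_trans _ _ (8 * n0%:R ^+ 2 * d1%:R * d2%:R)).
  move: card; rewrite -(ler_nat R) !natrM => /le_trans; apply.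
  by rewrite le_eqVlt; apply/orP; left; apply/eqP; ring.
rewrite ler_pM ?mulr_ge0 ?exprn_ge0 //.
rewrite ler_pM ?mulr_ge0 ?exprn_ge0 //.
by rewrite ler_wpM2l // lerXn2r ?nnegrE // (le_trans n00).
Qed.

End Curve.
End Bounds.

Theorem theorem5p1 (R : realType) (Delta : set (R * R)) (f : laurent R) (s : nat)
    (Delta_lattice : lattice_polygon Delta) (Delta_2dim : two_dimensional Delta)
    (f_class : curve_class Delta f) (s_ge2 : (2 <= s)%N) :
  let n : R := 2 * area Delta in
  let ss1 : R := s%:R * (s%:R - 1) in
  let bounds (nodes : set (R * R)) :=
    finite_set nodes /\
    let N : int := #|` fset_set nodes|%:Z in
    [/\ N <= Num.floor (8 * n ^+ 2 * width_z Delta * width_w Delta / ss1),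
        N <= Num.floor (8 * n ^+ 4 / ss1),
        Num.floor (8 * n ^+ 4 / ss1)
        = Num.floor (128 * area Delta ^+ 4 / ss1) &
        forall (d : nat) (v : int * int),
          (forall u, Delta u -> simplex d (u + lat R v)) ->
          N <= Num.floor (8 * d%:R ^+ 6 / ss1)] in
  bounds (isolated_nodes f s) /\ bounds (residual_nodes f s).
Proof.
move=> n ss1 bounds.
(* Both sets consist of s-nodes, and the count applies to any set of s-nodes. *)
suff main nodes : nodes `<=` s_node f s -> bounds nodes.
  by split; apply: main; [exact: isolatedS|move=> x []].
move=> sub; have [DeltaE sf srf _] := f_class.
pose A := enum_fset (finsupp f).
have {}DeltaE : Delta = polygon A by rewrite -newton_polygonE.
have [m0 [m1 [m2 [m0A m1A m2A det]]]] : exists m0 m1 m2 : Z2, [/\ m0 \in A, m1 \in A,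
    m2 \in A & (m1 - m0).1 * (m2 - m0).2 - (m1 - m0).2 * (m2 - m0).1 != 0].
  by apply: (@noncollinear R); rewrite -DeltaE.
have A0 : A != [::] by case: (A) m0A.
have [a [a' [h1 [aA a'A ea' ha]]]] := @seq_range A fst A0.
have [b [b' [h2 [bA b'A eb' hb]]]] := @seq_range A snd A0.
(* The indices cross: the degree of z is the range of the exponents of w. *)
have [d2 d1] : support_degree f e1 h2 /\ support_degree f e2 h1.
  apply: (@support_degree_box _ _ a.1 b.2 _ _ A0) => m mA.
  have /andP[? ?] := ha m mA; have /andP[? ?] := hb m mA.
  exact/and4P.
have [hw hz] : h1%:R <= width_w Delta /\ h2%:R <= width_z Delta.
  by rewrite DeltaE; exact: (@coordinate_range R A a.1 b.2 _ _ a a' b b').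
have n_ge0 : 0 <= n by rewrite mulr_ge0 // area_ge0.
(* Truncation gives [n < n0 + 1], which is the condition of [area_bound_polygon]. *)
have [n0 n0n hA] : exists2 n0 : nat, n0%:R <= n & area_bound A n0.
  have /andP[nlo nhi] := truncn_itv n_ge0.
  exists (Num.truncn n) => //; apply: (@area_bound_polygon R).
  by rewrite -DeltaE.
have e12 : (e1.1 * e2.2 - e1.2 * e2.1 : int) != 0 by [].
have [fin _] := nodes_card sf srf s_ge2 sub A0 hA e12 d2 d1.
split=> //; split.
- exact: (nodes_floor sf srf s_ge2 sub A0 hA e12 d2 d1).
- have := nodes_floor sf srf s_ge2 sub A0 hA det (support_degree_edge hA m0A m1A)
    (support_degree_edge hA m0A m2A) n0n n0n n0n.
  by rewrite (_ : 8 * n ^+ 2 * n * n = 8 * n ^+ 4); last ring.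
- by congr (Num.floor (_ / _)); rewrite /n; ring.
move=> d v dv; have dA := @simplex_lattice R A d v _.
have {}dA : forall m : Z2, m \in A -> [&& 0 <= m.1 + v.1, 0 <= m.2 + v.2 &
    m.1 + v.1 + (m.2 + v.2) <= d%:Z].
  by apply: dA => u; rewrite -DeltaE; exact: dv.
have h1d : (h1 <= d)%N := (simplex_range h1 (dA a aA) (dA a' a'A)).1 ea'.
have h2d : (h2 <= d)%N := (simplex_range h2 (dA b bA) (dA b' b'A)).2 eb'.
(* Here [d ^ 2], twice the area of the simplex, takes the place of [n0], and both widths are at most
   [d]. *)
have := nodes_floor sf srf s_ge2 sub A0 (area_bound_simplex dA) e12 d2 d1
  (lexx _) (_ : h2%:R <= d%:R) (_ : h1%:R <= d%:R).
rewrite !ler_nat h1d h2d.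
rewrite (_ : 8 * (d ^ 2)%:R ^+ 2 * d%:R * d%:R = 8 * d%:R ^+ 6); last by rewrite natrX; ring.
by apply.
Qed.
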